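(* Let $H$ be a separable real Hilbert space and let $A$ be a self-adjoint nonnegative (possibly unbounded) linear operator on $H$ with dense domain $D(A)$. Assume that there exist a countable (not necessarily complete) orthonormal system $\{e_k\}_{k\ge 1}$ in $H$ and an increasing unbounded sequence $\{\lambda_k\}_{k\ge 1}$ of positive real numbers such that $Ae_k=\lambda_k^2e_k$ for every $k\ge 1$. Let $\omega:[0,+\infty)\to[0,+\infty)$ be a continuous increasing function such that $\omega(0)=0$, $\omega(a+b)\le\omega(a)+\omega(b)$ for every $a\ge 0$, $b\ge 0$, and such that the function $\sigma\mapsto\sigma/\omega(\sigma)$ is nondecreasing. Let $\varphi:[0,+\infty)\to[1,+\infty)$ be a function such that $$\lim_{\sigma\to+\infty}\sigma\left[\varphi\left(\frac{\sigma}{\sqrt{\omega(1/\sigma)}}\right)\right]^{-1}=+\infty .$$ Then there exist $c:[0,1]\to[0,3/2]$ and $v:[0,1]\to H$ such that (1) $c$ is $\omega$-continuous; (2) $(v(0),v'(0))\in\mathcal{G}_{\varphi,r,3/4}(A)\times\mathcal{G}_{\varphi,r,1/4}(A)$ for every $r>0$; (3) $v\in C^1([0,1];D(A^{1/4}))\cap C^0([0,1];D(A^{3/4}))$ is a solution of the linear equation $v''(t)+c(t)Av(t)=0$; (4) for every $t\in(0,1]$ we have that $(v(t),v'(t))\notin V_\beta$ for every $\beta\ge 1$; (5) there exists a sequence $\tau_k\to0^+$ such that $|A^{(\beta+1)/2}v(\tau_k)|$ is unbounded (in $k$) for every $\beta>1/2$.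
   Context: $|x|$ denotes the norm of $x\in H$. A function $f:X\to\mathbb{R}$ with $X\subseteq\mathbb{R}$ is $\omega$-continuous if there is a constant $L\in\mathbb{R}$ with $|f(a)-f(b)|\le L\,\omega(|a-b|)$ for all $a,b\in X$. The powers $A^\beta$ ($\beta\ge0$), with domains $D(A^\beta)$, are those given by the spectral theorem. The quantity $|A^\beta x|$ is regarded as an element of $[0,+\infty]$, equal to $+\infty$ when $x\notin D(A^\beta)$. The phase spaces are $V_\beta:=D(A^{(\beta+1)/2})\times D(A^{\beta/2})$. Spaces $\mathcal{G}_{\varphi,r,\beta}(A)$ (for $r>0$, $\beta>0$): if $u=\sum_k u_k e_k$ lies in the closed span of orthonormal eigenvectors $e_k$ with $Ae_k=\lambda_k^2e_k$, set $$\|u\|^2_{\varphi,r,\beta}:=\sum_{k}\lambda_k^{4\beta}u_k^2\exp\left(r\varphi(\lambda_k)\right),$$ and $\mathcal{G}_{\varphi,r,\beta}(A):=\{u\in H:\|u\|^2_{\varphi,r,\beta}<+\infty\}$. (For a general $A$ and general $u\in H$ the sum is replaced by the corresponding spectral integral given by the spectral theorem.) The differential equation is understood in the usual weak sense (as an equality in the dual space $D(A^{-1/4})$ of $D(A^{1/4})$). *)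

(* Defs.v *)
From HB Require Import structures.
From mathcomp Require Import all_boot all_order all_algebra.
From mathcomp Require Import all_classical all_reals all_analysis.

Set Implicit Arguments.
Unset Strict Implicit.
Unset Printing Implicit Defensive.

Import Order.TTheory GRing.Theory Num.Theory.
Import numFieldNormedType.Exports.

Local Open Scope classical_set_scope.
Local Open Scope ring_scope.

Section Hilbert.
Context {R : realType}.

(* A real Hilbert space is a [completeNormedModType] whose norm is induced by
   an inner product. *)
Record hilbert_dot (H : completeNormedModType R) := HilbertDot {
  dot_form :> {dot H for idfun};
  dot_norm : forall x, dot_form x x = `|x| ^+ 2 }.

Definition separable (H : completeNormedModType R) : Prop :=
  exists2 S : set H, countable S & dense S.

Definition orthonormal_seq (H : completeNormedModType R)
    (ip : hilbert_dot H) (e : nat -> H) : Prop :=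
  forall i j, ip (e i) (e j) = (i == j)%:R.

(* The values of [op_fun] outside [op_dom] are irrelevant. *)
Record unbounded_op (H : completeNormedModType R) := UnboundedOp {
  op_dom : set H;
  op_fun :> H -> H }.

Definition op_linear (H : completeNormedModType R) (A : unbounded_op H) :=
  forall (a : R) x y, op_dom A x -> op_dom A y ->
    op_dom A (a *: x + y) /\ A (a *: x + y) = a *: A x + A y.

(* The left-hand side of the equivalence is the graph of the adjoint of [A]. *)
Definition op_self_adjoint (H : completeNormedModType R) (ip : hilbert_dot H)
    (A : unbounded_op H) :=
  dense (op_dom A) /\
  forall y z, (forall x, op_dom A x -> ip (A x) y = ip x z) <->
              (op_dom A y /\ A y = z).

Definition op_nonneg (H : completeNormedModType R) (ip : hilbert_dot H)
    (A : unbounded_op H) :=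
  forall x, op_dom A x -> 0 <= ip (A x) x.

(* Projection-valued Borel measures concentrated on [0, +oo[. By [proj_cap]
   and [proj_sym], every [proj B] with [B] Borel is an orthogonal projection. *)
Record spectral_measure (H : completeNormedModType R) (ip : hilbert_dot H) :=
  SpectralMeasure {
    proj :> set (measurableTypeR R) -> H -> H;
    proj_linear : forall B, measurable B -> forall (a : R) x y,
      proj B (a *: x + y) = a *: proj B x + proj B y;
    proj_sym : forall B, measurable B -> forall x y,
      ip (proj B x) y = ip x (proj B y);
    proj_cap : forall B C, measurable B -> measurable C -> forall x,
      proj (B `&` C) x = proj B (proj C x);
    proj_set0 : forall x, proj set0 x = 0;
    proj_nonneg : forall x, proj `[0, +oo[ x = x;
    proj_sigma_additive : forall F : nat -> set (measurableTypeR R),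
      (forall i, measurable (F i)) -> trivIset setT F ->
      forall x, (fun n => \sum_(0 <= i < n) proj (F i) x) @ \oo -->
        proj (\bigcup_i F i) x }.

End Hilbert.

Section SpectralCalculus.
Context {R : realType} {H : completeNormedModType R} {ip : hilbert_dot H}.
Variable E : spectral_measure ip.

(* |E(B)x|^2 = <E(B)x, x> *)
Definition scalar_measure (x : H) (B : set (measurableTypeR R)) : \bar R :=
  (`|E B x| ^+ 2)%:E.

Let scalar_measure0 x : scalar_measure x set0 = 0%E.
Proof. by rewrite /scalar_measure proj_set0 normr0 expr0n. Qed.

Let scalar_measure_ge0 x B : (0 <= scalar_measure x B)%E.
Proof. by rewrite lee_fin exprn_ge0. Qed.

Let scalar_measure_sigma_additive x : semi_sigma_additive (scalar_measure x).
Proof.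
move=> F mF tF _.
have orth i j : i != j -> ip (E (F i) x) (E (F j) x) = 0.
  move=> ij; rewrite proj_sym// -proj_cap//.
  move/trivIsetP : tF => /(_ i j I I ij) ->.
  by rewrite proj_set0 linear0r.
have orthS n j : (n <= j)%N ->
    ip (\sum_(0 <= i < n) E (F i) x) (E (F j) x) = 0.
  elim: n => [|n IHn] nj; first by rewrite big_nil linear0l.
  by rewrite big_nat_recr//= linearDl /= IHn 1?ltnW// orth ?addr0// neq_ltn nj.
have pyth n : `|\sum_(0 <= i < n) E (F i) x| ^+ 2 =
    \sum_(0 <= i < n) `|E (F i) x| ^+ 2.
  elim: n => [|n IHn]; first by rewrite !big_nil normr0 expr0n.
  rewrite [RHS]big_nat_recr//= -IHn -!(dot_norm ip) big_nat_recr//=.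
  rewrite linearDl !linearDr /= orthS// addr0.
  have -> : ip (E (F n) x) (\sum_(0 <= i < n) E (F i) x) = 0.
    by rewrite hermC /= expr0 mul1r orthS.
  by rewrite add0r.
have -> : (fun n => (\sum_(0 <= i < n) scalar_measure x (F i))%E) =
    (fun n => (`|\sum_(0 <= i < n) E (F i) x| ^+ 2)%:E).
  by apply/funext => n; rewrite sumEFin pyth.
apply: cvg_EFin; first by near=> n.
have h : `|\sum_(0 <= i < n) E (F i) x| @[n --> \oo] -->
    `|E (\bigcup_i F i) x|.
  by apply: cvg_norm; exact: proj_sigma_additive.
exact: (cvgM h h).
Unshelve. all: by end_near. Qed.

HB.instance Definition _ x := isMeasure.Build _ _ _ (scalar_measure x)
  (scalar_measure0 x) (scalar_measure_ge0 x)
  (@scalar_measure_sigma_additive x).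

(* Integral over the half-line of a nonnegative function. When [f] is not
   Borel this is the lower integral; it is still the sum of the values of [f]
   over the atoms, weighted by their masses, whenever [scalar_measure x] is
   carried by countably many points. *)
Definition spectral_integral (f : R -> R) (x : H) : \bar R :=
  (\int[scalar_measure x]_(s in `[0%R, +oo[) (f s)%:E)%E.

(* |A^b x|^2 in [0, +oo], for A the operator with spectral measure [E] *)
Definition pow_sqnorm (b : R) (x : H) : \bar R :=
  spectral_integral (fun s : R => s `^ (2 * b)) x.

Definition pow_norm (b : R) (x : H) : \bar R := sqrte (pow_sqnorm b x).

Definition pow_dom (b : R) : set H := [set x | (pow_sqnorm b x < +oo)%E].

(* The integral of s^b against <E(ds)x, y>, by polarization; both terms are
   finite when x and y belong to [pow_dom b]. *)
Definition pow_form (b : R) (x y : H) : R :=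
  (fine (spectral_integral (fun s : R => s `^ b) (x + y)) -
   fine (spectral_integral (fun s : R => s `^ b) (x - y))) / 4.

(* z = A^b x. As [pow_dom b] is dense, z is unique. *)
Definition is_pow (b : R) (x z : H) : Prop :=
  pow_dom b x /\ forall y, pow_dom b y -> ip z y = pow_form b x y.

Definition pow_op (b : R) (x : H) : H := xget 0 [set z | is_pow b x z].

Definition spectral_resolution (A : unbounded_op H) : Prop :=
  (forall x, op_dom A x <-> pow_dom 1 x) /\
  (forall x, op_dom A x -> is_pow 1 x (A x)).

Definition phase_space (b : R) : set (H * H) :=
  pow_dom ((b + 1) / 2) `*` pow_dom (b / 2).

(* The spectral variable is s = lambda^2, so that lambda^(4b) = s^(2b). *)
Definition gevrey_space (phi : R -> R) (r b : R) : set H :=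
  [set u | (spectral_integral
     (fun s : R => s `^ (2 * b) * expR (r * phi (Num.sqrt s)))%R u < +oo)%E].

Definition graph_norm (b : R) (x : H) : \bar R :=
  sqrte ((`|x| ^+ 2)%:E + pow_sqnorm b x)%E.

Definition C0_pow (b : R) (u : R -> H) : Prop :=
  forall t, t \in `[0, 1] -> pow_dom b (u t) /\
    graph_norm b (u s - u t) @[s --> within `[0, 1] (nbhs t)] --> 0%E.

(* [du] is the derivative of [u] on [0, 1], one-sided at the endpoints. *)
Definition is_derive_pow (b : R) (u du : R -> H) : Prop :=
  forall t, t \in `[0, 1] ->
    graph_norm b ((s - t)^-1 *: (u s - u t) - du t)
      @[s --> within (`[0, 1] `\ t) (nbhs t)] --> 0%E.

Definition C1_pow (b : R) (u du : R -> H) : Prop :=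
  [/\ C0_pow b u, C0_pow b du & is_derive_pow b u du].

(* The norm of D(A^(-b)), the dual of D(A^b) with its graph norm; an element
   is represented by its action on D(A^b), and h in H acts by w |-> <h, w>. *)
Definition dual_norm (b : R) (l : H -> R) : \bar R :=
  ereal_sup [set (`|l w|)%:E | w in [set w | (graph_norm b w <= 1)%E]].

(* v'' + c A v = 0 on [0, 1], where v'' is the derivative of [dv] = v' in
   D(A^(-1/4)) and A v(t) in D(A^(-1/4)) is the functional
   w |-> <A^(3/4) v(t), A^(1/4) w>. *)
Definition weak_solution (c : R -> R) (v dv : R -> H) : Prop :=
  forall t, t \in `[0, 1] ->
    dual_norm (1 / 4) (fun w =>
        ip ((s - t)^-1 *: (dv s - dv t)) w +
        c t * ip (pow_op (3 / 4) (v t)) (pow_op (1 / 4) w))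
      @[s --> within (`[0, 1] `\ t) (nbhs t)] --> 0%E.

End SpectralCalculus.

Definition omega_continuous {R : realType} (omega : R -> R) (X : set R)
    (f : R -> R) : Prop :=
  exists L : R, forall a b, X a -> X b -> `|f a - f b| <= L * omega `|a - b|.

(* Main.v *)
(* On the interval [t_k, 2 t_k], with t_k -> 0 fast, the coefficient is
   c(t) = delta_k gam(sigma_k t), where delta_k = omega(1 / sigma_k) and gam is
   a De Giorgi-Colombini-Spagnolo oscillation around 1; c is affine on each gap
   [2 t_(k+1), t_k].  The component of frequency lambda with
   lambda^2 delta_k = sigma_k^2 resonates on [t_k, 2 t_k], where its energy
   grows by the factor exp(sigma_k t_k / 8), while elsewhere its energy changes
   by factors controlled by the parameters of the previous steps.  As lambda is
   sigma_k / sqrt(omega(1 / sigma_k)), the hypothesis says that phi(lambda) is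
   negligible with respect to sigma_k, so the growth beats every Gevrey weight
   exp(r phi(lambda)).  Normalized so that the energies in
   D(A^(3/4)) x D(A^(1/4)) are at most of order 2^-k at all times, the k-th
   component is invisible in the Gevrey norms at t = 0, yet its energy in V_1 is
   at least k for all t >= 2 t_k, and at the last peak
   tau_k = 2 t_k - pi / (2 sigma_k) its D(A^(3/4)) norm is at least
   lambda^(-epsilon_k) with epsilon_k -> 0. *)

(* On a gap the coefficient rises from delta_(k+1) to delta_k, by a ratio that nothing controls, so
   a two-sided bound on c'/c is useless there. As c is nondecreasing on gaps, F = w'^2 + lambda^2 c
   w^2 cannot decrease and F/c cannot increase: all lower bounds go through F and all upper bounds
   through F/c. Only the oscillation blocks met after the resonance cost something, and these were
   fixed before lambda was chosen.

   The price is that F and F/c differ by the factor delta_k = sigma_k^2 / lambda^2 at 2 t_k. With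
   F/c normalized in D(A^(3/4)) x D(A^(1/4)), F leaves in V_1 a lower bound of order sigma_k^2 /
   lambda, up to factors of the previous steps; it diverges because omega(1/sigma) >=
   omega(1)/sigma. At a peak of w inside the block there is no such loss, hence the separate
   sequence tau_k.

   The solution lives in the closed span of the selected eigenvectors, but the test vectors of the
   weak equation are arbitrary, which requires fractional powers for a general spectral measure. *)
Require Import Defs.
From HB Require Import structures.
From mathcomp Require Import all_boot all_order all_algebra.
From mathcomp Require Import all_classical all_reals all_analysis.
From mathcomp Require Import measurable_realfun.
From mathcomp Require Import ring lra.

Set Implicit Arguments.
Unset Strict Implicit.
Unset Printing Implicit Defensive.

Import Order.TTheory GRing.Theory Num.Theory.
Import numFieldNormedType.Exports.

Local Open Scope classical_set_scope.
Local Open Scope ring_scope.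

(** * Differentiation of real functions *)

Section Derivatives.
Context {R : realType}.
Implicit Types (f g : R -> R) (x a b : R).

(* Not a class, so that no instance search interferes when the value of the
   derivative is still unknown. *)
Definition has_deriv f x a : Prop := is_derive x 1 f a.

Lemma has_deriv_eq f x a b : has_deriv f x a -> a = b -> has_deriv f x b.
Proof. by move=> + <-. Qed.

Lemma derive_fcst (k x : R) : has_deriv (fun=> k) x 0.
Proof. exact: is_derive_cst. Qed.

Lemma derive_fid (x : R) : has_deriv (fun t => t) x 1.
Proof. exact: is_derive_id. Qed.

Lemma derive_fadd f g x a b : has_deriv f x a -> has_deriv g x b ->
  has_deriv (fun t => f t + g t) x (a + b).
Proof. by move=> fa gb; exact: is_deriveD. Qed.

Lemma derive_fsub f g x a b : has_deriv f x a -> has_deriv g x b ->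
  has_deriv (fun t => f t - g t) x (a - b).
Proof. by move=> fa gb; exact: is_deriveB. Qed.

Lemma derive_fopp f x a : has_deriv f x a ->
  has_deriv (fun t => - f t) x (- a).
Proof. by move=> fa; exact: is_deriveN. Qed.

Lemma derive_fmul f g x a b : has_deriv f x a -> has_deriv g x b ->
  has_deriv (fun t => f t * g t) x (a * g x + f x * b).
Proof.
move=> fa gb; have := is_deriveM fa gb.
by rewrite /GRing.scale/= addrC [g x * a]mulrC.
Qed.

Lemma derive_fscale (k : R) f x a : has_deriv f x a ->
  has_deriv (fun t => k * f t) x (k * a).
Proof.
move=> fa; apply: has_deriv_eq.
  by apply: derive_fmul; [exact: derive_fcst|exact: fa].
by rewrite mul0r add0r.
Qed.

Lemma derive_fsqr f x a : has_deriv f x a ->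
  has_deriv (fun t => f t ^+ 2) x (2 * f x * a).
Proof.
move=> fa; apply: has_deriv_eq; first exact: (derive_fmul fa fa).
by ring.
Qed.

Lemma derive_fcomp f g x a b : has_deriv f (g x) a -> has_deriv g x b ->
  has_deriv (fun t => f (g t)) x (a * b).
Proof. by move=> fa gb; exact: is_derive1_comp. Qed.

Lemma derive_fexp f x a : has_deriv f x a ->
  has_deriv (fun t => expR (f t)) x (expR (f x) * a).
Proof. by move=> fa; apply: derive_fcomp fa; exact: is_derive_expR. Qed.

Lemma derive_linear (k x : R) : has_deriv ( *%R k) x k.
Proof.
apply: has_deriv_eq; first exact: (derive_fscale k (derive_fid x)).
by rewrite mulr1.
Qed.

Lemma derive_continuous f x a : has_deriv f x a -> {for x, continuous f}.
Proof.
by move=> [fx _]; apply: differentiable_continuous; exact/derivable1_diffP.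
Qed.

Lemma derive_within_continuous f (df : R -> R) a b :
  (forall x, x \in `[a, b] -> has_deriv f x (df x)) ->
  {within `[a, b], continuous f}.
Proof.
move=> fdf; apply: continuous_in_subspaceT => x; rewrite inE/= => xab.
exact: (derive_continuous (fdf x _)).
Qed.

Lemma mvt f (df : R -> R) a b : a <= b ->
  (forall x, x \in `[a, b] -> has_deriv f x (df x)) ->
  exists2 z, z \in `[a, b] & f b - f a = df z * (b - a).
Proof.
move=> ab fdf; apply: MVT_segment => //.
  by move=> x xab; apply: fdf; exact: subset_itv_oo_cc xab.
exact: derive_within_continuous fdf.
Qed.

Lemma derive_ge0_le f (df : R -> R) a b : a <= b ->
  (forall x, x \in `[a, b] -> has_deriv f x (df x)) ->
  (forall x, x \in `[a, b] -> 0 <= df x) -> f a <= f b.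
Proof.
move=> ab fdf df0; have [z zab e] := mvt ab fdf.
by rewrite -subr_ge0 e mulr_ge0 ?df0// subr_ge0.
Qed.

Lemma mvt_le f (df : R -> R) (M a b : R) : a <= b ->
  (forall x, x \in `[a, b] -> has_deriv f x (df x)) ->
  (forall x, x \in `[a, b] -> `|df x| <= M) -> `|f b - f a| <= M * (b - a).
Proof.
move=> ab fdf dfM; have [z zab ->] := mvt ab fdf.
by rewrite normrM [`|b - a|]ger0_norm ?subr_ge0// ler_wpM2r ?subr_ge0// dfM.
Qed.

(** The product [expR (m * (t - a)) * f t] has a nonnegative derivative. *)
Lemma gronwall_ge f (df : R -> R) (m a b : R) : a <= b ->
  (forall x, x \in `[a, b] -> has_deriv f x (df x)) ->
  (forall x, x \in `[a, b] -> - m * f x <= df x) ->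
  f a * expR (- m * (b - a)) <= f b.
Proof.
move=> ab fdf dfm.
have := @derive_ge0_le (fun t => expR (m * (t - a)) * f t)
  (fun t => expR (m * (t - a)) * (m * f t + df t)) a b ab.
rewrite subrr mulr0 expR0 mul1r => H.
have {}H : f a <= expR (m * (b - a)) * f b.
  apply: H => x xab; last first.
    by rewrite mulr_ge0 ?expR_ge0// -lerBlDl sub0r -mulNr dfm.
  apply: has_deriv_eq; first apply: derive_fmul (fdf x xab).
    apply: derive_fexp; apply: derive_fscale.
    by apply: derive_fsub; [exact: derive_fid|exact: derive_fcst].
  by rewrite /=; ring.
by rewrite mulNr expRN ler_pdivrMr ?expR_gt0// mulrC.
Qed.

Lemma gronwall_le f (df : R -> R) (m a b : R) : a <= b ->
  (forall x, x \in `[a, b] -> has_deriv f x (df x)) ->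
  (forall x, x \in `[a, b] -> df x <= m * f x) ->
  f b <= f a * expR (m * (b - a)).
Proof.
move=> ab fdf dfm.
have := @gronwall_ge (fun t => - f t) (fun t => - df t) (- m) a b ab.
rewrite opprK mulNr lerN2; apply => x xab.
  exact: derive_fopp (fdf x xab).
by rewrite mulrN lerN2 dfm.
Qed.

End Derivatives.

(** The rate survives in the limit; the Picard iteration below needs it to get locally uniform
    convergence. *)
Lemma cauchy_bound_cvg (R : realType) (V : completeNormedModType R)
    (u : nat -> V) (eps : nat -> R) : eps @ \oo --> 0 ->
  (forall n m, (n <= m)%N -> `|u m - u n| <= eps n) ->
  exists2 l, u @ \oo --> l & forall n, `|l - u n| <= eps n.
Proof.
move=> eps0 ueps.
have ucvg : cvg (u @ \oo).
  apply: cauchy_cvg; apply: cauchy_exP => e e0.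
  have [N _ HN] := cvgr_lt 0 eps0 e e0.
  exists (u N); exists N => // m /= Nm.
  rewrite -ball_normE /ball_/= distrC; apply: (le_lt_trans (ueps N m Nm)).
  by apply: HN => /=.
exists (lim (u @ \oo)) => // n.
have H : `|u m - u n| @[m --> \oo] --> `|lim (u @ \oo) - u n|.
  by apply: cvg_norm; apply: cvgB => //; exact: cvg_cst.
apply: ler_cvg_to H (cvg_cst (eps n)) _.
by exists n => // m /= nm; exact: ueps.
Qed.

Section Antiderivative.
Context {R : realType}.

Let has_deriv0_eq (F G f : R -> R) (r : R) :
  (forall x, x \in `[- r, r] -> has_deriv F x (f x)) ->
  (forall x, x \in `[- r, r] -> has_deriv G x (f x)) ->
  F 0 = G 0 -> forall x, x \in `[- r, r] -> F x = G x.
Proof.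
move=> dF dG FG0 x xr.
have dFG y : y \in `[- r, r] -> has_deriv (fun t => F t - G t) y 0.
  by move=> yr; apply: has_deriv_eq (derive_fsub (dF y yr) (dG y yr)) _; rewrite subrr.
have H a b : a \in `[- r, r] -> b \in `[- r, r] -> a <= b -> F b - G b = F a - G a.
  rewrite !in_itv/= => /andP[ra ar] /andP[rb br] ab.
  apply/eqP; rewrite -subr_eq0 -normr_le0.
  have := @mvt_le _ (fun t => F t - G t) (fun=> 0) 0 a b ab.
  rewrite mul0r; apply=> y; rewrite in_itv/= => /andP[ay yb].
    by apply: dFG; rewrite in_itv/= (le_trans ra)//= (le_trans yb).
  by rewrite normr0.
apply/eqP; rewrite -subr_eq0; apply/eqP.
move: xr; rewrite in_itv/= => /andP[rx xr].
have r0 : 0 <= r by lra.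
have z0 : (0:R) \in `[- r, r] by rewrite in_itv/= r0 oppr_le0 r0.
have [x0|x0] := leP 0 x.
  by rewrite (H 0 x) ?in_itv/= ?rx//; lra.
by rewrite -(H x 0) ?in_itv/= ?rx//; lra.
Qed.

(** Integration from [- (n%:R + 1)] gives an antiderivative [G n] on a bounded interval only. Those
    that vanish at 0 agree on overlaps, so they glue to a global one. *)
Lemma antiderivative (f : R -> R) : continuous f ->
  exists2 F : R -> R, F 0 = 0 & forall x, has_deriv F x (f x).
Proof.
move=> cf.
pose G n x : R := \int[lebesgue_measure]_(t in `[- (n%:R + 1), x]) f t -
  \int[lebesgue_measure]_(t in `[- (n%:R + 1), 0]) f t.
have G0 n : G n 0 = 0 by rewrite /G subrr.
have dG n x : - (n%:R + 1) < x -> x < n%:R + 1 -> has_deriv (G n) x (f x).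
  move=> nx xn; rewrite /G.
  rewrite -(subr0 (f x)).
  apply: derive_fsub; last exact: derive_fcst.
  have [||dx ex] := @continuous_FTC1_closed R f (- (n%:R + 1)) x (n%:R + 1) xn _ nx.
  - apply: continuous_compact_integrable; first by apply: segment_compact.
    by apply: continuous_subspaceT => z; exact: cf.
  - exact: cf.
  - rewrite /has_deriv -ex derive1E; exact/derivableP.
pose N (x : R) := Num.truncn `|x|.
have NP x : `|x| < (N x)%:R + 1 by rewrite natr1 truncnS_gt.
have GE n m x : `|x| < n%:R + 1 -> (n <= m)%N -> G n x = G m x.
  move=> xn nm; have nm' : (n%:R : R) <= m%:R by rewrite ler_nat.
  apply: (@has_deriv0_eq (G n) (G m) f `|x|); last 2 first.
  - by rewrite !G0.
  - by rewrite in_itv/= ler_norm andbT lerNl -normrN ler_norm.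
  - move=> y; rewrite in_itv/= => /andP[y1 y2].
    by apply: dG; lra.
  - move=> y; rewrite in_itv/= => /andP[y1 y2].
    by apply: dG; lra.
exists (fun x => G (N x) x); first exact: G0.
move=> x.
have xlt := NP x.
(* The index [N y] varies with [y]; one step above [N x] gives a single representative valid for all
   [y] near [x]. *)
have := @dG (N x).+1 x.
have x1 : - ((N x).+1%:R + 1) < x /\ x < (N x).+1%:R + 1.
  by rewrite -natr1; have := ler_norm x; have := ler_norm (- x); rewrite normrN; lra.
move=> /(_ x1.1 x1.2).
apply: near_eq_is_derive.
near=> y.
have yx : `|y| < (N x).+1%:R + 1.
  have : `|x - y| < 1 by near: y; exact: cvgr_dist_lt.
  rewrite -natr1; have := ler_distD x y 0; rewrite !subr0 (distrC y x); lra.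
have [h|h] := leqP (N y) (N x).+1; first exact/esym/GE.
by apply: GE => //; exact: ltnW.
Unshelve. all: by end_near. Qed.

End Antiderivative.

(** * Linear second order differential equations *)

Section LinearODE.
Context {R : realType}.

(** Integration gains a factor [1 / K] in the norm weighted by [expR (- K x)], which makes the
    Picard operator contract globally on the half-line. *)
Let exp_bound (F f : R -> R) (B K : R) : 0 < K -> 0 <= B -> F 0 = 0 ->
  (forall x, has_deriv F x (f x)) ->
  (forall x, 0 <= x -> `|f x| <= B * expR (K * x)) ->
  forall x, 0 <= x -> `|F x| <= B / K * expR (K * x).
Proof.
move=> K0 B0 F0 dF fB x x0.
have dE y : has_deriv (fun t => B / K * expR (K * t)) y (B * expR (K * y)).
  apply: has_deriv_eq.
    by apply: derive_fscale; apply: derive_fexp; apply: derive_linear.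
  by field; rewrite gt_eqF.
have BK : 0 <= B / K by rewrite divr_ge0// ltW.
have fB' y : y \in `[0, x] -> - (B * expR (K * y)) <= f y <= B * expR (K * y).
  by rewrite in_itv/= => /andP[y0 _]; rewrite -ler_norml fB.
rewrite ler_norml; apply/andP; split.
  have := @derive_ge0_le _ (fun t => F t + B / K * expR (K * t))
    (fun t => f t + B * expR (K * t)) 0 x x0.
  rewrite F0 mulr0 expR0 => H.
  suff : 0 + B / K * 1 <= F x + B / K * expR (K * x) by lra.
  apply: H => y yx; first exact: derive_fadd (dF y) (dE y).
  by have /andP[] := fB' y yx; lra.
have := @derive_ge0_le _ (fun t => B / K * expR (K * t) - F t)
  (fun t => B * expR (K * t) - f t) 0 x x0.
rewrite F0 mulr0 expR0 => H.
suff : B / K * 1 - 0 <= B / K * expR (K * x) - F x by lra.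
apply: H => y yx; first exact: derive_fsub (dE y) (dF y).
by have /andP[] := fB' y yx; lra.
Qed.

(** Since [q] vanishes for negative times, no weighted estimate is needed on that side. *)
Let zero_left (F f : R -> R) : F 0 = 0 ->
  (forall x, has_deriv F x (f x)) -> (forall x, x <= 0 -> f x = 0) ->
  forall x, x <= 0 -> F x = 0.
Proof.
move=> F0 dF f0 x x0.
have [z] := mvt x0 (fun y _ => dF y).
by rewrite in_itv/= => /andP[_ z0]; rewrite (f0 z z0) F0 mul0r; lra.
Qed.

Variables (q : R -> R) (M : R).
Hypothesis cq : continuous q.
Hypothesis q_left : forall x, x <= 0 -> q x = 0.
Hypothesis q_le : forall x, `|q x| <= M.

(** Integration from 0, as a total operator. The default value never occurs, [I] being applied to
    continuous functions only. *)
Let I (f : R -> R) : R -> R :=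
  xget (cst 0) [set F | F 0 = 0 /\ forall x, has_deriv F x (f x)].

Let IP (f : R -> R) : continuous f ->
  I f 0 = 0 /\ forall x, has_deriv (I f) x (f x).
Proof.
move=> cf; have [F F0 dF] := antiderivative cf.
by apply: (@xgetPex _ (cst 0) [set F | F 0 = 0 /\ forall x, has_deriv F x (f x)]); exists F.
Qed.

Let cI f : continuous f -> continuous (I f).
Proof. by move=> /IP[_ dI] x; exact: derive_continuous (dI x). Qed.

Let cqm f : continuous f -> continuous (fun x => - q x * f x).
Proof. by move=> cf x; apply: cvgM; [apply: cvgN; exact: cq|exact: cf]. Qed.

(** Chosen so that [2 * M <= K * K]: two integrations of [q * u] then gain a factor
    [M / K ^+ 2 <= 1 / 2]. That [K] is at least 1 also gives [x <= expR (K * x)]. *)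
Let K := 1 + 2 * M.

Let K_ge1 : 1 <= K /\ 0 <= M.
Proof. by have := q_le 0; have := normr_ge0 (q 0); rewrite /K; lra. Qed.

Section InitialData.
Variables a b : R.

Let T (u : R -> R) (x : R) : R := a + b * x + I (I (fun x => - q x * u x)) x.

Let cT u : continuous u -> continuous (T u).
Proof.
move=> cu x; apply: cvgD; last exact/cI/cI/cqm.
apply: (@derive_continuous _ (fun x => a + b * x) x (0 + b)).
by apply: derive_fadd; [exact: derive_fcst|exact: derive_linear].
Qed.

(** On the right each of the two integrations divides by [K]. On the left the integrand is zero, so
    [T u] is the affine function given by the data whatever [u] is. *)
Let T_contract (u w : R -> R) (B : R) : continuous u -> continuous w -> 0 <= B ->
  (forall x, 0 <= x -> `|u x - w x| <= B * expR (K * x)) ->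
  (forall x, 0 <= x -> `|T u x - T w x| <= B / 2 * expR (K * x)) /\
  (forall x, x <= 0 -> T u x = T w x).
Proof.
move=> cu cw B0 uw.
have [J0u dJu] := IP (cqm cu); have [J0w dJw] := IP (cqm cw).
have [I0u dIu] := IP (cI (cqm cu)); have [I0w dIw] := IP (cI (cqm cw)).
have [K1 M0] := K_ge1.
have K0 : 0 < K by lra.
set Ju := I (fun x => - q x * u x) in J0u dJu I0u dIu *.
set Jw := I (fun x => - q x * w x) in J0w dJw I0w dIw *.
have E x : T u x - T w x = I Ju x - I Jw x by rewrite /T -/Ju -/Jw; ring.
have h1 : forall x, 0 <= x -> `|Ju x - Jw x| <= (M * B) / K * expR (K * x).
  apply: (exp_bound (F := fun x => Ju x - Jw x) K0 _ _
    (fun x => derive_fsub (dJu x) (dJw x))).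
  - by rewrite mulr_ge0.
  - by rewrite J0u J0w subrr.
  - move=> x x0; rewrite !mulNr opprK addrC -mulrBr normrM distrC -mulrA.
    by rewrite ler_pM// uw.
have h2 : forall x, 0 <= x -> `|I Ju x - I Jw x| <= (M * B) / K / K * expR (K * x).
  apply: (exp_bound (F := fun x => I Ju x - I Jw x) K0 _ _
    (fun x => derive_fsub (dIu x) (dIw x))) => //.
  - by rewrite divr_ge0 ?(ltW K0)// mulr_ge0.
  - by rewrite I0u I0w subrr.
split=> x x0.
  rewrite E; apply: le_trans (h2 x x0) _.
  rewrite ler_wpM2r ?expR_ge0// !ler_pdivrMr//.
  have : 2 * M <= K * K by rewrite /K; nra.
  by move=> h; nra.
apply/eqP; rewrite -subr_eq0 E; apply/eqP.
apply: (zero_left (F := fun x => I Ju x - I Jw x) _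
    (fun x => derive_fsub (dIu x) (dIw x))) => //.
  by rewrite I0u I0w subrr.
apply: (zero_left (F := fun x => Ju x - Jw x) _
    (fun x => derive_fsub (dJu x) (dJw x))).
  by rewrite J0u J0w subrr.
by move=> y y0; rewrite (q_left y0) oppr0 !mul0r subrr.
Qed.

Let u n := iter n T (fun=> 0).

Let cu n : continuous (u n).
Proof. by elim: n => [|n IHn]; [move=> x; exact: cvg_cst|exact: cT]. Qed.

Let B : R := `|a| + `|b|.

Let u_step n x : 0 <= x -> `|u n.+1 x - u n x| <= B / 2 ^+ n * expR (K * x).
Proof.
have B0 : 0 <= B by rewrite addr_ge0.
have [K1 M0] := K_ge1.
elim: n x => [x x0|n IHn x x0].
  rewrite expr0 divr1 /u/= subr0 /T.
  have -> : I (I (fun x => - q x * 0)) x = 0.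
    have c0 : continuous (fun x => - q x * 0) by apply: (@cqm (fun=> 0)) => ?; exact: cvg_cst.
    have [J0 dJ] := IP c0; have [I0 dI] := IP (cI c0).
    have h1 : forall x, 0 <= x -> `|I (fun x => - q x * 0) x| <= 0 / 1 * expR (1 * x).
      by apply: (exp_bound _ _ _ dJ) => // y _; rewrite mulr0 normr0 mul0r.
    have h2 : forall x, 0 <= x -> `|I (I (fun x => - q x * 0)) x| <= (0 / 1) / 1 * expR (1 * x).
      by apply: (exp_bound _ _ _ dI) => //; rewrite mul0r.
    by apply/eqP; rewrite -normr_le0; apply: le_trans (h2 x x0) _; rewrite !mul0r.
  rewrite addr0; apply: le_trans (ler_normD _ _) _.
  rewrite normrM (ger0_norm x0) /B mulrDl.
  have xK : x <= K * x by rewrite ler_peMl.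
  have := expR_ge1Dx (K * x) => h.
  apply: lerD; first by rewrite ler_peMr//; lra.
  by rewrite ler_wpM2l//; lra.
have Bn : 0 <= B / 2 ^+ n by rewrite divr_ge0// exprn_ge0.
have [h _] := T_contract (@cu n.+1) (@cu n) Bn IHn.
by rewrite exprS invfM [2^-1 * _]mulrC mulrA; exact: h.
Qed.

(** On the left the iteration is stationary, but only from [u 1] on since [u 0] is 0; hence the
    shifted index in what follows. *)
Let u_left n x : x <= 0 -> u n.+1 x = u 1 x.
Proof.
elim: n => // n IHn x0; rewrite -IHn//.
have Bn : 0 <= B / 2 ^+ n by rewrite divr_ge0 ?exprn_ge0// addr_ge0.
by have [_ h] := T_contract (@cu n.+1) (@cu n) Bn (@u_step n); exact: h.
Qed.

Let u_cauchy x n m : (n <= m)%N ->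
  `|u m.+1 x - u n.+1 x| <= B * expR (K * Num.max 0 x) / 2 ^+ n.
Proof.
have B0 : 0 <= B by rewrite addr_ge0.
move=> nm; have [x0|x0] := leP x 0.
  by rewrite !u_left// subrr normr0 divr_ge0 ?exprn_ge0// mulr_ge0// expR_ge0.
have {x0} x0 := ltW x0.
(* The subtracted term makes the bound telescope, so that induction on [m] goes through. *)
suff : `|u m.+1 x - u n.+1 x| <= B * expR (K * x) * ((2 ^+ n)^-1 - (2 ^+ m)^-1).
  move/le_trans; apply; rewrite ler_wpM2l ?mulr_ge0 ?expR_ge0//.
  by rewrite gerBl invr_ge0 exprn_ge0.
elim: m nm => [|m IHm]; first by rewrite leqn0 => /eqP ->; rewrite !subrr normr0 mulr0.
rewrite leq_eqVlt => /predU1P[->|]; first by rewrite !subrr normr0 mulr0.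
rewrite ltnS => nm; have := u_step m.+1 x0; have := IHm nm.
have := ler_distD (u m.+1 x) (u m.+2 x) (u n.+1 x).
rewrite exprS invfM; set p := (2 ^+ m)^-1; set s := (2 ^+ n)^-1; set e := expR _.
have -> : B * e * (s - 2^-1 * p) = B * e * (s - p) + B * (2^-1 * p) * e by lra.
lra.
Qed.

Let eps0 (C : R) : (fun n => C / 2 ^+ n) @ \oo --> 0.
Proof.
rewrite (_ : (fun n => _) = geometric C 2^-1); last first.
  by apply/funext => n; rewrite /= exprVn.
by apply: cvg_geometric; rewrite ger0_norm ?invr_ge0// invf_lt1 ?ltr1n.
Qed.

Let limit_sol x : exists l, forall n,
  `|l - u n.+1 x| <= B * expR (K * Num.max 0 x) / 2 ^+ n.
Proof.
have [||l _ h] := @cauchy_bound_cvg R R^o (fun n => u n.+1 x)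
  (fun n => B * expR (K * Num.max 0 x) / 2 ^+ n).
- exact: eps0.
- by move=> n m; exact: u_cauchy.
- by exists l.
Qed.

Lemma linear_ode : exists w dw : R -> R, [/\ w 0 = a, dw 0 = b,
  forall x, has_deriv w x (dw x) & forall x, has_deriv dw x (- q x * w x)].
Proof.
have [w wP] := choice limit_sol.
have B0 : 0 <= B by rewrite addr_ge0.
have [K1 M0] := K_ge1.
have cw : continuous w.
  move=> x; apply/cvgrPdist_lt => e e0.
  (* The error bound is monotone in the point, so its value at [x + 1] serves for all [y <= x + 1]:
     the convergence is uniform near [x]. *)
  pose C := B * expR (K * Num.max 0 (x + 1)).
  have [n _ hn] := cvgr_lt 0 (eps0 C) (e / 3) (divr_gt0 e0 (ltr0Sn _ _)).
  have {}hn : C / 2 ^+ n < e / 3 by apply: hn => /=.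
  have wC y : y <= x + 1 -> `|w y - u n.+1 y| < e / 3.
    move=> yx; apply: le_lt_trans hn; apply: le_trans (wP y n) _.
    rewrite ler_wpM2r ?invr_ge0 ?exprn_ge0// /C ler_wpM2l// ler_expR.
    rewrite ler_wpM2l ?(le_trans _ K1)//.
    by rewrite ge_max !le_max lexx yx orbT.
  near=> y.
  have yx : y <= x + 1.
    have : `|x - y| < 1 by near: y; exact: cvgr_dist_lt.
    by rewrite ltr_norml; lra.
  have h1 := wC x _; have h2 := wC y yx.
  have h3 : `|u n.+1 x - u n.+1 y| < e / 3.
    by near: y; apply: cvgr_dist_lt; [exact: cu|rewrite divr_gt0].
  have := ler_distD (u n.+1 x) (w x) (w y).
  have := ler_distD (u n.+1 y) (u n.+1 x) (w y).
  rewrite (distrC (u n.+1 y) (w y)).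
  have : `|w x - u n.+1 x| < e / 3 by apply: h1; rewrite lerDl.
  lra.
have uw n x : 0 <= x -> `|u n.+1 x - w x| <= B / 2 ^+ n * expR (K * x).
  move=> x0; rewrite distrC; apply: le_trans (wP x n) _.
  by rewrite (max_idPr x0) mulrAC.
(* Both [w] and [T w] are limits of the iterates, the second by the contraction estimate.
   Differentiability of [w] is then read off from [T w]. *)
have fixw x : w x = T w x.
  have [x0|x0] := leP 0 x; last first.
    have e2 : T (u 1%N) x = u 1%N x := u_left 1 (ltW x0).
    have B00 : 0 <= B / 2 ^+ 0 by rewrite expr0 divr1.
    have [_ h] := T_contract (@cu 1%N) cw B00 (uw 0%N).
    rewrite -(h x (ltW x0)) e2; apply/eqP; rewrite -subr_eq0 -normr_le0.
    have H : `|w x - u 1%N x| <= 0.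
      apply: (@ler_cvg_to nat \oo _ R (fun=> `|w x - u 1%N x|)
        (fun n => B * expR (K * Num.max 0 x) / 2 ^+ n)).
      - exact: cvg_cst.
      - exact: eps0.
      - by apply: nearW => n; rewrite -(u_left n (ltW x0)).
    exact: H.
  apply/eqP; rewrite -subr_eq0 -normr_le0.
  apply: (@ler_cvg_to nat \oo _ R (fun=> `|w x - T w x|)
        (fun n => (2 * B * expR (K * x)) / 2 ^+ n)).
  - exact: cvg_cst.
  - exact: eps0.
  - apply: nearW => n.
    have h1 : 0 <= B / 2 ^+ n by rewrite divr_ge0// exprn_ge0.
    have [h _] := T_contract (@cu n.+1) cw h1 (uw n).
    have {}h := h x x0; rewrite -/(u n.+2) in h.
    have := uw n.+1 x x0; have := h; have := ler_distD (u n.+2 x) (w x) (T w x).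
    rewrite (distrC (w x) (u n.+2 x)) exprS invfM.
    have : 0 <= B / 2 ^+ n * expR (K * x) by rewrite mulr_ge0// expR_ge0.
    by set p := (2 ^+ n)^-1; set e := expR _; lra.
have [J0 dJ] := IP (cqm cw); have [I0 dI] := IP (cI (cqm cw)).
exists w, (fun x => b + I (fun x => - q x * w x) x); split.
- by rewrite fixw /T I0 mulr0 !addr0.
- by rewrite J0 addr0.
- move=> x; rewrite (_ : w = T w); last exact/funext.
  apply: derive_fadd; last by rewrite -(funext fixw); exact: dI.
  apply: has_deriv_eq.
    by apply: derive_fadd; [exact: derive_fcst|exact: derive_linear].
  by rewrite add0r.
- move=> x; apply: has_deriv_eq (derive_fadd (derive_fcst b x) (dJ x)) _.
  by rewrite add0r.
Unshelve. all: by end_near. Qed.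

End InitialData.

End LinearODE.

(** * Initial data, uniqueness and energy inequalities for oscillators *)

Section OscillatorTools.
Context {R : realType}.
Implicit Types (w dw q f df : R -> R).

(** [linear_ode] prescribes data at 0 only. The Wronskian of the two fundamental solutions is
    constantly 1, so Cramer's rule at [t0] gives the coefficients [C1] and [C2]. *)
Lemma ode_initial_data q (M t0 A B : R) : continuous q ->
  (forall x, x <= 0 -> q x = 0) -> (forall x, `|q x| <= M) ->
  exists w dw, [/\ w t0 = A, dw t0 = B,
    forall x, has_deriv w x (dw x) & forall x, has_deriv dw x (- q x * w x)].
Proof.
move=> cq q0 qM.
have [w1 [d1 [w10 d10 dw1 dd1]]] := linear_ode cq q0 qM 1 0.
have [w2 [d2 [w20 d20 dw2 dd2]]] := linear_ode cq q0 qM 0 1.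
pose W x := w1 x * d2 x - d1 x * w2 x.
have dW x : has_deriv W x 0.
  apply: has_deriv_eq.
    by apply: derive_fsub; apply: derive_fmul; [exact: dw1|exact: dd2|exact: dd1|exact: dw2].
  by rewrite /=; ring.
have Wcst a b : a <= b -> W a = W b.
  move=> ab; have [z _] := mvt ab (fun x _ => dW x).
  by rewrite mul0r => /eqP; rewrite subr_eq0 => /eqP.
have W1 : W t0 = 1.
  have W01 : W 0 = 1 by rewrite /W w10 d20 d10 w20; ring.
  by have [/Wcst <-|/ltW/Wcst ->] := leP 0 t0.
pose C1 := A * d2 t0 - B * w2 t0; pose C2 := B * w1 t0 - A * d1 t0.
exists (fun x => C1 * w1 x + C2 * w2 x), (fun x => C1 * d1 x + C2 * d2 x); split.
- by rewrite -[RHS]mulr1 -W1 /C1 /C2 /W; ring.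
- by rewrite -[RHS]mulr1 -W1 /C1 /C2 /W; ring.
- by move=> x; apply: derive_fadd; apply: derive_fscale.
- move=> x; apply: has_deriv_eq.
    by apply: derive_fadd; apply: derive_fscale; [exact: dd1|exact: dd2].
  by rewrite /=; ring.
Qed.

(** Gronwall for the squared phase-space distance [P], whose derivative
    [2 (w - u) (w' - u') (1 - q)] is at most [(1 + M) * P]. *)
Lemma ode_unique q w dw u du (M a b : R) : a <= b ->
  (forall x, x \in `[a, b] -> `|q x| <= M) ->
  (forall x, x \in `[a, b] -> has_deriv w x (dw x)) ->
  (forall x, x \in `[a, b] -> has_deriv dw x (- q x * w x)) ->
  (forall x, x \in `[a, b] -> has_deriv u x (du x)) ->
  (forall x, x \in `[a, b] -> has_deriv du x (- q x * u x)) ->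
  w a = u a -> dw a = du a -> w b = u b /\ dw b = du b.
Proof.
move=> ab qM Hw Hdw Hu Hdu wa dwa.
pose P x := (w x - u x) ^+ 2 + (dw x - du x) ^+ 2.
pose dP x := 2 * (w x - u x) * (dw x - du x) * (1 - q x).
have HP x : x \in `[a, b] -> has_deriv P x (dP x).
  move=> xab; apply: has_deriv_eq.
    apply: derive_fadd; apply: derive_fsqr; apply: derive_fsub.
    - exact: Hw.
    - exact: Hu.
    - exact: Hdw.
    - exact: Hdu.
  by rewrite /dP /=; ring.
have := @gronwall_le _ P dP (1 + M) a b ab HP.
rewrite /P wa dwa !subrr !expr0n/= addr0 mul0r => H.
have {}H : (w b - u b) ^+ 2 + (dw b - du b) ^+ 2 <= 0.
  apply: H => x xab; rewrite /dP.
  set z := w x - u x; set y := dw x - du x.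
  apply: le_trans (ler_norm _) _.
  rewrite normrM mulrC; apply: ler_pM => //.
    by apply: le_trans (ler_normB _ _) _; rewrite normr1 lerD2l qM.
  rewrite ler_norml; apply/andP; split.
    by rewrite -subr_ge0 opprK; have := sqr_ge0 (z + y); lra.
  by rewrite -subr_ge0; have := sqr_ge0 (z - y); lra.
have h1 := sqr_ge0 (w b - u b); have h2 := sqr_ge0 (dw b - du b).
have e1 : (w b - u b) ^+ 2 = 0 by lra.
have e2 : (dw b - du b) ^+ 2 = 0 by lra.
move/eqP: e1; move/eqP: e2; rewrite !sqrf_eq0 !subr_eq0 => /eqP -> /eqP ->.
by [].
Qed.

(* Along [w'' + L^2 f w = 0] the energy [F = w'^2 + L^2 f w^2] has
   [F' = L^2 f' w^2] whereas [(F / f)' = - f' w'^2 / f^2]: a lower bound on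
   [f' / f] controls [F] from below and [F / f] from above. *)
Lemma energy_estimates w dw f df (L m a b : R) : a <= b -> 0 <= m ->
  (forall x, x \in `[a, b] -> has_deriv w x (dw x)) ->
  (forall x, x \in `[a, b] -> has_deriv dw x (- (L ^+ 2 * f x) * w x)) ->
  (forall x, x \in `[a, b] -> has_deriv f x (df x)) ->
  (forall x, x \in `[a, b] -> 0 < f x) ->
  (forall x, x \in `[a, b] -> - m * f x <= df x) ->
  (dw a ^+ 2 + L ^+ 2 * f a * w a ^+ 2) * expR (- m * (b - a)) <=
    dw b ^+ 2 + L ^+ 2 * f b * w b ^+ 2 /\
  dw b ^+ 2 / f b + L ^+ 2 * w b ^+ 2 <=
    (dw a ^+ 2 / f a + L ^+ 2 * w a ^+ 2) * expR (m * (b - a)).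
Proof.
move=> ab m0 Hw Hdw Hf f0 fm; split.
  apply: (@gronwall_ge _ (fun x => dw x ^+ 2 + L ^+ 2 * f x * w x ^+ 2)
    (fun x => L ^+ 2 * df x * w x ^+ 2)) => // x xab.
    apply: has_deriv_eq.
      apply: derive_fadd.
        by apply: derive_fsqr; exact: Hdw.
      apply: derive_fmul.
        by apply: derive_fscale; exact: Hf.
      by apply: derive_fsqr; exact: Hw.
    by rewrite /=; ring.
  have h : 0 <= L ^+ 2 * w x ^+ 2 * (df x + m * f x).
    apply: mulr_ge0; first by apply: mulr_ge0; exact: sqr_ge0.
    by have := fm x xab; lra.
  have : 0 <= m * dw x ^+ 2 by rewrite mulr_ge0// sqr_ge0.
  by move: h; rewrite mulrDr; lra.
apply: (@gronwall_le _ (fun x => dw x ^+ 2 / f x + L ^+ 2 * w x ^+ 2)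
    (fun x => - dw x ^+ 2 * df x / f x ^+ 2)) => // x xab.
  have fx0 : f x != 0 by rewrite gt_eqF// f0.
  have dV : has_deriv (fun x => (f x)^-1) x (- f x ^- 2 *: df x).
    by apply: is_deriveV => //; exact: Hf.
  apply: has_deriv_eq.
    apply: derive_fadd.
      apply: derive_fmul; last exact: dV.
      by apply: derive_fsqr; exact: Hdw.
    by apply: derive_fscale; apply: derive_fsqr; exact: Hw.
  by rewrite /= /GRing.scale/=; field.
have fx0 := f0 x xab.
have h1 : 0 <= m * (L ^+ 2 * w x ^+ 2) by rewrite mulr_ge0// mulr_ge0 ?sqr_ge0.
have h2 : 0 <= dw x ^+ 2 / f x ^+ 2 * (df x + m * f x).
  apply: mulr_ge0; first by apply: divr_ge0; exact: sqr_ge0.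
  by have := fm x xab; lra.
rewrite mulrDr.
have -> : m * (dw x ^+ 2 / f x) = dw x ^+ 2 / f x ^+ 2 * (m * f x).
  by field; rewrite gt_eqF.
by move: h2; rewrite mulrDr; lra.
Qed.

(** The derivative of the energy is [2 L^2 w w' (1 - f)], at most [L] times the energy in absolute
    value. No derivative of [f] enters, so this works up to time 0, where the coefficient
    degenerates while oscillating. *)
Lemma free_energy_backward w dw f (L a b : R) : a <= b -> 0 <= L ->
  (forall x, x \in `[a, b] -> has_deriv w x (dw x)) ->
  (forall x, x \in `[a, b] -> has_deriv dw x (- (L ^+ 2 * f x) * w x)) ->
  (forall x, x \in `[a, b] -> 0 <= f x <= 2) ->
  (dw a ^+ 2 + L ^+ 2 * w a ^+ 2) * expR (- L * (b - a)) <=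
    dw b ^+ 2 + L ^+ 2 * w b ^+ 2.
Proof.
move=> ab L0 Hw Hdw f02.
apply: (@gronwall_ge _ (fun x => dw x ^+ 2 + L ^+ 2 * w x ^+ 2)
    (fun x => 2 * dw x * (L ^+ 2 * w x) * (1 - f x))) => // x xab.
  apply: has_deriv_eq.
    apply: derive_fadd; first by apply: derive_fsqr; exact: Hdw.
    by apply: derive_fscale; apply: derive_fsqr; exact: Hw.
  by rewrite /=; ring.
have /andP[f0 f2] := f02 x xab.
have n1 : `|1 - f x| <= 1 by rewrite ler_norml; lra.
set y := dw x; set z := L * w x.
have -> : L ^+ 2 * w x ^+ 2 = z ^+ 2 by rewrite /z; ring.
have -> : 2 * y * (L ^+ 2 * w x) * (1 - f x) = L * (2 * y * z * (1 - f x)).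
  by rewrite /z; ring.
rewrite mulNr -mulrN ler_wpM2l//.
have : `|2 * y * z * (1 - f x)| <= (y ^+ 2 + z ^+ 2) * 1.
  rewrite normrM; apply: ler_pM => //.
  rewrite ler_norml; apply/andP; split.
    by have := sqr_ge0 (z + y); lra.
  by have := sqr_ge0 (z - y); lra.
by rewrite mulr1 ler_norml => /andP[].
Qed.

End OscillatorTools.

(** * The explicit resonant solution *)

Section ResonantCoefficient.
Context {R : realType}.
Implicit Types s x t : R.

(* The De Giorgi-Colombini-Spagnolo coefficient with [epsilon = 1/32]:
   [sin (x t) exp (b t)] with [b = (2 x t - sin (2 x t)) / 32] solves
   [w'' + x^2 gam (x t) w = 0], and grows like [exp (x t / 16)]. *)
Definition gam s : R := 1 - (sin s * cos s) / 2 - sin s ^+ 4 / 64.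

Definition res_exp s : R := expR (s / 16 - sin s * cos s / 16).

Definition res_sol x t : R := sin (x * t) * res_exp (x * t).

Definition res_dsol x t : R :=
  x * (cos (x * t) + sin (x * t) ^+ 3 / 8) * res_exp (x * t).

Lemma sin_sqr s : sin s ^+ 2 = 1 - cos s ^+ 2.
Proof. by have := cos2Dsin2 s; lra. Qed.

Lemma sin_cos_bound s : `|sin s * cos s| <= 1 / 2.
Proof.
rewrite ler_norml; have := cos2Dsin2 s.
have := sqr_ge0 (sin s - cos s); have := sqr_ge0 (sin s + cos s).
by rewrite sqrrB sqrrD; lra.
Qed.

Lemma sin_expn_le1 s n : `|sin s ^+ n| <= 1.
Proof.
rewrite normrX exprn_ile1// ler_norml.
by rewrite sin_geN1 sin_le1.
Qed.

Lemma gam_bound s : 1 / 2 <= gam s <= 3 / 2.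
Proof.
have := sin_cos_bound s; have := sin_expn_le1 s 4.
by rewrite /gam !ler_norml; lra.
Qed.

Lemma derive_fsin x t : has_deriv (fun t => sin (x * t)) t (x * cos (x * t)).
Proof.
apply: has_deriv_eq; first apply: derive_fcomp (derive_linear x t).
  exact: is_derive_sin.
by rewrite mulrC.
Qed.

Lemma derive_fcos x t : has_deriv (fun t => cos (x * t)) t (- x * sin (x * t)).
Proof.
apply: has_deriv_eq; first apply: derive_fcomp (derive_linear x t).
  exact: is_derive_cos.
by ring.
Qed.

Lemma derive_pow (f : R -> R) t a n : has_deriv f t a ->
  has_deriv (fun t => f t ^+ n.+1) t (n.+1%:R * f t ^+ n * a).
Proof.
move=> fa; elim: n => [|n IHn]; first by rewrite expr0 mulr1 mul1r.
apply: has_deriv_eq.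
  rewrite (_ : (fun _ => _) = (fun t => f t * f t ^+ n.+1)).
    exact: (derive_fmul fa IHn).
  by apply/funext => y; rewrite exprS.
by rewrite /= -[n.+2%:R]natr1 exprS; ring.
Qed.

Definition dgam x t : R := x * (- (cos (x * t) ^+ 2 - sin (x * t) ^+ 2) / 2
  - sin (x * t) ^+ 3 * cos (x * t) / 16).

Lemma derive_gam x t : has_deriv (fun t => gam (x * t)) t (dgam x t).
Proof.
rewrite /gam; apply: has_deriv_eq.
  apply: derive_fsub.
    apply: derive_fsub; first exact: derive_fcst.
    apply: derive_fmul; last exact: derive_fcst.
    by apply: derive_fmul; [exact: derive_fsin|exact: derive_fcos].
  apply: derive_fmul; last exact: derive_fcst.
  by apply: derive_pow; exact: derive_fsin.
by rewrite /dgam /=; field.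
Qed.

Lemma dgam_bound x t : 0 <= x -> `|dgam x t| <= x.
Proof.
move=> x0; rewrite /dgam normrM ger0_norm// ler_piMr//.
have h1 := sin_cos_bound (x * t).
have h2 := sin_expn_le1 (x * t) 2.
have h3 : `|sin (x * t) ^+ 3 * cos (x * t)| <= 1 * (1 / 2).
  by rewrite exprSr -mulrA normrM ler_pM.
move: h3; have := cos2Dsin2 (x * t); have := sqr_ge0 (sin (x * t)); have := sqr_ge0 (cos (x * t)).
rewrite !ler_norml.
lra.
Qed.

Lemma derive_res_exp x t : has_deriv (fun t => res_exp (x * t)) t
  (res_exp (x * t) * (x * sin (x * t) ^+ 2 / 8)).
Proof.
rewrite /res_exp; apply: derive_fexp; apply: has_deriv_eq.
  apply: derive_fsub.
    apply: derive_fmul; last exact: derive_fcst.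
    exact: derive_linear.
  apply: derive_fmul; last exact: derive_fcst.
  by apply: derive_fmul; [exact: derive_fsin|exact: derive_fcos].
have := sin_sqr (x * t) => h.
have -> : sin (x * t) ^+ 2 = (sin (x * t) ^+ 2 + 1 - cos (x * t) ^+ 2) / 2 by lra.
by rewrite /=; field.
Qed.

Lemma derive_res_sol x t : has_deriv (res_sol x) t (res_dsol x t).
Proof.
apply: has_deriv_eq.
  by apply: derive_fmul; [exact: derive_fsin|exact: derive_res_exp].
by rewrite /res_dsol /=; field.
Qed.

Lemma derive_res_dsol x t :
  has_deriv (res_dsol x) t (- (x ^+ 2 * gam (x * t)) * res_sol x t).
Proof.
apply: has_deriv_eq.
  apply: derive_fmul; last exact: derive_res_exp.
  apply: derive_fscale; apply: derive_fadd; first exact: derive_fcos.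
  apply: derive_fmul; last exact: derive_fcst.
  by apply: derive_pow; exact: derive_fsin.
by rewrite /gam /res_sol /=; field.
Qed.

(** The constant is 3 times 7/3: 3 bounds the factor [expR (1 / 16)] lost in [res_exp ^+ 2] through
    the term [sin * cos], and 7/3 bounds the trigonometric factor. *)
Lemma res_sol_bound x t : 0 <= x -> 0 <= t ->
  x ^+ 2 * res_sol x t ^+ 2 + res_dsol x t ^+ 2 <= 7 * x ^+ 2 * expR (x * t / 8).
Proof.
move=> x0 t0; set e := expR (x * t / 8).
have e1 : res_exp (x * t) ^+ 2 <= 3 * e.
  rewrite /res_exp -expRM_natl.
  have := sin_cos_bound (x * t); rewrite ler_norml => /andP[h _].
  have h4 : expR (1 / 16) <= 3 :> R.
    have := @expR_ge1Dx R (- (1 / 16)); rewrite expRN => h2.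
    have := expR_gt0 (1 / 16 : R) => h3.
    by have := mulfV (lt0r_neq0 h3); nra.
  apply: (@le_trans _ _ (expR (1 / 16) * e)).
    by rewrite /e -expRD ler_expR mulr_natl; lra.
  by rewrite ler_wpM2r ?expR_ge0.
rewrite /res_sol /res_dsol; set s := sin _; set c := cos _; set r := res_exp _ in e1 *.
have s2 : s ^+ 2 <= 1 by have := cos2Dsin2 (x * t); have := sqr_ge0 c; rewrite -/s -/c; lra.
have H : s ^+ 2 + (c + s ^+ 3 / 8) ^+ 2 <= 7 / 3.
  have c2 : c ^+ 2 <= 1 by have := cos2Dsin2 (x * t); have := sqr_ge0 s; rewrite -/s -/c; lra.
  have := cos2Dsin2 (x * t); rewrite -/s -/c => e2.
  have s6 : (s ^+ 3) ^+ 2 <= 1.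
    by rewrite -exprM; have := sin_expn_le1 (x * t) 6; rewrite -/s ler_norml; lra.
  by have := sqr_ge0 (c - s ^+ 3); nra.
have -> : x ^+ 2 * (s * r) ^+ 2 + (x * (c + s ^+ 3 / 8) * r) ^+ 2 =
   x ^+ 2 * ((s ^+ 2 + (c + s ^+ 3 / 8) ^+ 2) * r ^+ 2) by ring.
have -> : 7 * x ^+ 2 * e = x ^+ 2 * (7 / 3 * (3 * e)) by field.
rewrite ler_wpM2l ?sqr_ge0// ler_pM ?sqr_ge0//.
by rewrite addr_ge0 ?sqr_ge0.
Qed.

End ResonantCoefficient.

(** * The coefficient *)

Section Modulus.
Context {R : realType}.
Variable omega : R -> R.

Definition modulus : Prop :=
  [/\ {within `[0, +oo[, continuous omega},
      forall a b, 0 <= a -> a < b -> omega a < omega b,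
      omega 0 = 0,
      forall a b, 0 <= a -> 0 <= b -> omega (a + b) <= omega a + omega b &
      forall a b, 0 < a -> a <= b -> a / omega a <= b / omega b].

Hypothesis m : modulus.

Lemma modulus_gt0 s : 0 < s -> 0 < omega s.
Proof. by case: m => _ incr o0 _ _ s0; rewrite -o0 incr. Qed.

Lemma modulus_ge0 s : 0 <= s -> 0 <= omega s.
Proof.
case: m => _ _ o0 _ _; rewrite le_eqVlt => /predU1P[<-|/modulus_gt0/ltW//].
by rewrite o0.
Qed.

Lemma modulus_le a b : 0 <= a -> a <= b -> omega a <= omega b.
Proof.
case: m => _ incr _ _ _ a0; rewrite le_eqVlt => /predU1P[->//|ab].
by rewrite ltW// incr.
Qed.

Lemma modulus_half s : 0 <= s -> omega s <= 2 * omega (s / 2).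
Proof.
case: m => _ _ _ sub _ s0.
have s20 : 0 <= s / 2 by rewrite divr_ge0.
by have := sub _ _ s20 s20; rewrite -splitr; lra.
Qed.

(** A substitute for concavity: [omega] lies above its chord from the origin to [l]. A Lipschitz
    bound at scale [l] thereby becomes an [omega] bound at all smaller scales. *)
Lemma modulus_scale h l : 0 < h -> h <= l -> omega l * (h / l) <= omega h.
Proof.
case: m => _ _ _ _ ratio h0 hl; have l0 := lt_le_trans h0 hl.
have := ratio h l h0 hl.
rewrite ler_pdivrMr ?modulus_gt0// mulrAC ler_pdivlMr ?modulus_gt0// => H.
by rewrite mulrA ler_pdivrMr//; lra.
Qed.

Lemma modulus_cvg0 (e : R) : 0 < e ->
  exists2 d, 0 < d & forall h, 0 <= h -> h < d -> omega h < e.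
Proof.
move=> e0; have [cont _ o0 _ _] := m.
have /continuous_within_itvcyP[_ om0] := cont.
have : \forall x \near 0^'+, omega x < e by apply: cvgr_lt om0 _ _; rewrite o0.
rewrite near_withinE => -[d /= d0 H]; exists d => // h.
rewrite le_eqVlt => /predU1P[<-|h0 hd]; first by rewrite o0.
by apply: (H h) => //=; rewrite sub0r normrN gtr0_norm.
Qed.

End Modulus.

Section Coefficient.
Context {R : realType}.
Variables (omega : R -> R) (t sig del : nat -> R).

(** Index 0 carries no oscillation: [t 0] is the right end of the interval and [del 0] the value
    there. By [cd_sin] the function [gam] equals 1 at both ends of a block, so the pieces join
    continuously; by [cd_del_t] a variation of order [del k] over a distance of order [t k] is paid
    for by [omega]. *)
Record coef_data : Prop := CoefData {
  cd_modulus : modulus omega;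
  cd_t0 : t 0 = 1;
  cd_t_gt0 : forall k, 0 < t k;
  cd_t_step : forall k, 4 * t k.+1 <= t k;
  cd_del_gt0 : forall k, 0 < del k;
  cd_del_step : forall k, del k.+1 <= del k;
  cd_del0 : del 0 <= 1;
  cd_del_t : forall k, del k <= omega (t k);
  cd_sig_gt0 : forall k, 0 < sig k.+1;
  cd_del_sig : forall k, del k.+1 = omega (1 / sig k.+1);
  cd_sin : forall k, sin (sig k.+1 * t k.+1) = 0 }.

Hypothesis cd : coef_data.

Let t0 := cd_t0 cd.
Let tpos := cd_t_gt0 cd.
Let tstep := cd_t_step cd.
Let dpos := cd_del_gt0 cd.

Lemma t_nonincr i j : (i <= j)%N -> t j <= t i.
Proof.
elim: j => [|j IHj]; first by rewrite leqn0 => /eqP ->.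
rewrite leq_eqVlt => /predU1P[->//|]; rewrite ltnS => /IHj.
by have := tstep j; have := tpos j.+1; lra.
Qed.

Lemma t_le1 k : t k <= 1. Proof. by rewrite -t0 t_nonincr. Qed.

Lemma del_nonincr i j : (i <= j)%N -> del j <= del i.
Proof.
elim: j => [|j IHj]; first by rewrite leqn0 => /eqP ->.
rewrite leq_eqVlt => /predU1P[->//|]; rewrite ltnS => /IHj.
by have := cd_del_step cd j; lra.
Qed.

Lemma del_le1 k : del k <= 1.
Proof. exact: le_trans (del_nonincr (leq0n k)) (cd_del0 cd). Qed.

Lemma t_le_geometric k : t k <= 1 / 2 ^+ k.
Proof.
elim: k => [|k IHk]; first by rewrite t0 expr0 divr1.
rewrite exprS invfM; have := tstep k; have := tpos k.+1.
by move: IHk; set p := (2 ^+ k)^-1; lra.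
Qed.

Lemma cvg_t : t @ \oo --> 0.
Proof.
apply: (@squeeze_cvgr _ _ _ _ (fun=> 0) (geometric 1 2^-1)).
- by apply: nearW => k; rewrite ltW//= exprVn t_le_geometric.
- exact: cvg_cst.
- by apply: cvg_geometric; rewrite ger0_norm ?invr_ge0// invf_lt1 ?ltr1n.
Qed.

Lemma block_exists s : 0 < s -> s <= 1 -> exists k, t k.+1 < s <= t k.
Proof.
move=> s0 s1.
have [n _ /(_ n (leqnn n)) tn] := cvgr_lt 0 cvg_t s s0.
elim: n tn => [|n IHn] /= tn; first by move: tn; rewrite t0; lra.
by have [/IHn//|sn] := ltP (t n) s; exists n; rewrite tn.
Qed.

Definition lin k s :=
  del k.+1 + (del k - del k.+1) * ((s - 2 * t k.+1) / (t k - 2 * t k.+1)).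

Definition block k s :=
  if s <= 2 * t k.+1 then del k.+1 * gam (sig k.+1 * s) else lin k s.

(** Zero for negative times and constant beyond 1, so that it is continuous on the line and vanishes
    on the left, as [linear_ode] requires. The default index of [xget] is never reached. *)
Definition coef s :=
  if s <= 0 then 0 else
  block (xget 0%N [set k | t k.+1 < Num.min s 1 <= t k]) (Num.min s 1).

Let gap k : 0 < t k - 2 * t k.+1.
Proof. by have := tstep k; have := tpos k.+1; lra. Qed.

Let gam1 k : gam (sig k.+1 * t k.+1) = 1.
Proof. by rewrite /gam (cd_sin cd) expr0n/=; lra. Qed.

Let gam2 k : gam (sig k.+1 * (2 * t k.+1)) = 1.
Proof.
rewrite mulrCA mulr_natl mulr2n /gam sinD (cd_sin cd) mul0r mulr0 addr0.
by rewrite expr0n/=; lra.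
Qed.

Let lin_left k : lin k (2 * t k.+1) = del k.+1.
Proof. by rewrite /lin subrr mul0r mulr0 addr0. Qed.

Let lin_right k : lin k (t k) = del k.
Proof. by rewrite /lin divff ?gt_eqF//; lra. Qed.

Let block_unique j k s : t j.+1 < s -> s <= t j -> t k.+1 < s -> s <= t k -> j = k.
Proof.
move=> js sj ks sk; have [jk|kj|//] := ltngtP j k.
  by have := lt_le_trans js (le_trans sk (t_nonincr jk)); rewrite ltxx.
by have := lt_le_trans ks (le_trans sj (t_nonincr kj)); rewrite ltxx.
Qed.

Let blockE k s : t k.+1 < s -> s <= t k -> coef s = block k s.
Proof.
move=> ks sk; have s0 : 0 < s := lt_trans (tpos _) ks.
have s1 : s <= 1 := le_trans sk (t_le1 k).
rewrite /coef leNgt s0/= (min_idPl s1).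
congr block; apply: (@xget_unique _ _ [set k | t k.+1 < s <= t k]).
  by rewrite /= ks.
by move=> j /= /andP[js sj]; exact: block_unique js sj ks sk.
Qed.

Let coef_t k : coef (t k) = del k.
Proof.
rewrite (@blockE k) ?lexx//; last by have := tstep k; have := tpos k.+1; lra.
rewrite /block ifF ?lin_right//.
by apply/negbTE; rewrite -ltNge; have := gap k; lra.
Qed.

Lemma coef_osc k s : s \in `[t k.+1, 2 * t k.+1] ->
  coef s = del k.+1 * gam (sig k.+1 * s).
Proof.
rewrite in_itv/= => /andP[]; rewrite le_eqVlt => /predU1P[<- _|ks sk].
  by rewrite coef_t gam1 mulr1.
have skk : s <= t k by have := gap k; lra.
by rewrite (@blockE k)// /block sk.
Qed.

Lemma coef_lin k s : s \in `[2 * t k.+1, t k] -> coef s = lin k s.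
Proof.
rewrite in_itv/= => /andP[]; rewrite le_eqVlt => /predU1P[<- _|ks sk].
  rewrite lin_left (@coef_osc k) ?gam2 ?mulr1// in_itv/= lexx andbT.
  by have := tpos k.+1; lra.
rewrite (@blockE k)//; last by have := tpos k.+1; lra.
by rewrite /block leNgt ks.
Qed.

Lemma lin_bound k s : s \in `[2 * t k.+1, t k] -> del k.+1 <= lin k s <= del k.
Proof.
rewrite in_itv/= => /andP[ks sk]; rewrite /lin.
have d0 : 0 <= del k - del k.+1 by rewrite subr_ge0 (cd_del_step cd).
have r0 : 0 <= (s - 2 * t k.+1) / (t k - 2 * t k.+1).
  by rewrite divr_ge0 ?subr_ge0// -subr_ge0 ltW.
have r1 : (s - 2 * t k.+1) / (t k - 2 * t k.+1) <= 1.
  by rewrite ler_pdivrMr// mul1r lerD2r.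
by set r := _ / _ in r0 r1 *; apply/andP; split; nra.
Qed.

Lemma coef_block_bound k s : t k.+1 <= s -> s <= t k ->
  del k.+1 / 2 <= coef s <= 3 / 2 * del k.
Proof.
move=> ks sk; have d1 := cd_del_step cd k; have d0 := dpos k.+1.
have [s2|s2] := leP s (2 * t k.+1).
  rewrite (@coef_osc k) ?in_itv/= ?ks//.
  by have /andP[] := gam_bound (sig k.+1 * s); set g := gam _; nra.
have si : s \in `[2 * t k.+1, t k] by rewrite in_itv/= ltW.
by rewrite (@coef_lin k)//; have := lin_bound si; lra.
Qed.

Lemma coef_bound k s : 0 < s -> s <= t k -> 0 < coef s <= 3 / 2 * del k.
Proof.
move=> s0 sk; have [j /andP[js sj]] := block_exists s0 (le_trans sk (t_le1 k)).
have kj : (k <= j)%N.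
  rewrite leqNgt; apply/negP => jk.
  by have := lt_le_trans js (le_trans sk (t_nonincr jk)); rewrite ltxx.
have := coef_block_bound (ltW js) sj; have := del_nonincr kj; have := dpos j.+1.
lra.
Qed.

Lemma coef_le0 s : s <= 0 -> coef s = 0.
Proof. by rewrite /coef => ->. Qed.

Lemma coef_ge1 s : 1 <= s -> coef s = coef 1.
Proof.
move=> s1; rewrite /coef (min_idPr s1) minxx !leNgt ltr01.
by rewrite (lt_le_trans ltr01 s1).
Qed.

Lemma coef_ge0_le s : 0 <= coef s <= 3 / 2.
Proof.
have [s0|s0] := leP s 0; first by rewrite coef_le0//; lra.
have : 0 < Num.min s 1 by rewrite lt_min s0 ltr01.
have -> : coef s = coef (Num.min s 1).
  by have [//|/ltW/coef_ge1 ->] := leP s 1.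
move=> m0; have := @coef_bound 0 _ m0; rewrite t0 ge_min lexx orbT => /(_ isT).
by have := cd_del0 cd; lra.
Qed.

Let m := cd_modulus cd.

(** Up to distance [1 / sig k.+1] the slope is at most [del k.+1 * sig k.+1], the slope of the chord
    of [omega]. Beyond that distance the whole oscillation is at most [del k.+1], which is
    [omega (1 / sig k.+1)]. *)
Let osc_modulus k a b : t k.+1 <= a -> a <= b -> b <= 2 * t k.+1 ->
  `|coef b - coef a| <= omega (b - a).
Proof.
move=> ka; rewrite le_eqVlt => /predU1P[->|ab] bk.
  by rewrite !subrr normr0 modulus_ge0.
have aI : a \in `[t k.+1, 2 * t k.+1] by rewrite in_itv/= ka; lra.
have bI : b \in `[t k.+1, 2 * t k.+1] by rewrite in_itv/= bk; lra.
rewrite !(@coef_osc k)// -mulrBr normrM (gtr0_norm (dpos _)).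
have s0 := cd_sig_gt0 cd k.
have is0 : 0 < 1 / sig k.+1 by rewrite divr_gt0.
have [h|h] := leP (b - a) (1 / sig k.+1).
  apply: (@le_trans _ _ (del k.+1 * (sig k.+1 * (b - a)))).
    rewrite (ler_wpM2l (ltW (dpos _)))//.
    apply: (@mvt_le _ (fun x => gam (sig k.+1 * x)) (dgam (sig k.+1))).
    - exact: ltW.
    - by move=> x _; exact: derive_gam.
    - by move=> x _; apply: dgam_bound; exact: ltW.
  have := modulus_scale m _ h; rewrite subr_gt0 -(cd_del_sig cd) => /(_ ab).
  by rewrite div1r invrK [(b - a) * _]mulrC.
have : `|gam (sig k.+1 * b) - gam (sig k.+1 * a)| <= 1.
  have := gam_bound (sig k.+1 * b); have := gam_bound (sig k.+1 * a).
  by rewrite ler_norml; lra.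
move=> h1; apply: (@le_trans _ _ (del k.+1)); first by rewrite ler_piMr// ltW.
by rewrite (cd_del_sig cd) modulus_le// ltW.
Qed.

(** The gap has length [l >= t k / 2], so the total rise is at most [omega (t k) <= 2 * omega l],
    and affine interpolation stays below the chord. *)
Let lin_modulus k a b : 2 * t k.+1 <= a -> a <= b -> b <= t k ->
  `|coef b - coef a| <= 2 * omega (b - a).
Proof.
move=> ka; rewrite le_eqVlt => /predU1P[->|ab] bk.
  by rewrite !subrr normr0 mulr_ge0// modulus_ge0.
have aI : a \in `[2 * t k.+1, t k] by rewrite in_itv/= ka; lra.
have bI : b \in `[2 * t k.+1, t k] by rewrite in_itv/= bk; lra.
rewrite !(@coef_lin k)//.
have l0 := gap k; set l := t k - 2 * t k.+1 in l0.
have -> : lin k b - lin k a = (del k - del k.+1) * ((b - a) / l).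
  by rewrite /lin -/l; field; rewrite gt_eqF.
have q0 : 0 <= (b - a) / l by apply: divr_ge0; [rewrite subr_ge0; exact: ltW|exact: ltW].
rewrite ger0_norm; last by rewrite mulr_ge0// subr_ge0 (cd_del_step cd).
apply: (@le_trans _ _ (2 * omega l * ((b - a) / l))).
  rewrite ler_wpM2r//.
  have := cd_del_t cd k; have := dpos k.+1; have := modulus_half m (ltW (tpos k)).
  have : omega (t k / 2) <= omega l.
    by apply: modulus_le => //; rewrite /l; have := tstep k; have := tpos k; lra.
  lra.
rewrite -mulrA ler_wpM2l// modulus_scale ?subr_gt0//.
by rewrite /l; lra.
Qed.

(** There may be infinitely many blocks between [a] and the node, so adding up the local bounds is
    not an option. When [a] lies before the gap, both values are of order [del k] and the distance
    is at least [t k / 2], so [del k <= 2 * omega (t k / 2)] is enough. *)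
Let node1_modulus k a : 0 <= a -> a <= t k ->
  `|coef (t k) - coef a| <= 3 * omega (t k - a).
Proof.
move=> a0 ak.
have [h|h] := leP (2 * t k.+1) a.
  apply: le_trans (lin_modulus h ak (lexx _)) _.
  by have := modulus_ge0 m (s := t k - a); rewrite subr_ge0 => /(_ ak); lra.
have ca : 0 <= coef a <= 3 / 2 * del k.
  move: a0; rewrite le_eqVlt => /predU1P[<-|a0].
    by rewrite coef_le0//; have := dpos k; lra.
  by have := coef_bound a0 ak; lra.
have : omega (t k / 2) <= omega (t k - a).
  by apply: modulus_le => //; have := tstep k; have := tpos k; lra.
have := modulus_half m (ltW (tpos k)); have := cd_del_t cd k; have := dpos k.
rewrite coef_t ler_norml; lra.
Qed.

Let node2_modulus k a : 0 <= a -> a <= 2 * t k.+1 ->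
  `|coef (2 * t k.+1) - coef a| <= 3 * omega (2 * t k.+1 - a).
Proof.
move=> a0 ak; have tk := tpos k.+1.
have [h|/ltW h] := leP (t k.+1) a.
  apply: le_trans (osc_modulus h ak (lexx _)) _.
  by have := modulus_ge0 m (s := 2 * t k.+1 - a); rewrite subr_ge0 => /(_ ak); lra.
have -> : coef (2 * t k.+1) = coef (t k.+1).
  rewrite coef_t (@coef_lin k) ?lin_left// in_itv/= lexx/=.
  by have := gap k; lra.
apply: le_trans (node1_modulus a0 h) _.
by rewrite ler_wpM2l// modulus_le// ?subr_ge0//; lra.
Qed.

(** The constant is 3 + 2: from [a] to the last node before [b], then from that node to [b] inside
    one piece. *)
Lemma coef_modulus a b : 0 <= a -> a <= b -> b <= 1 ->
  `|coef b - coef a| <= 5 * omega (b - a).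
Proof.
move=> a0 ab b1.
have := ab; rewrite le_eqVlt => /predU1P[->|ab'].
  by rewrite !subrr normr0 mulr_ge0// modulus_ge0.
have ba0 : 0 <= omega (b - a) by rewrite modulus_ge0 ?subr_ge0.
have [k /andP[kb bk]] := block_exists (le_lt_trans a0 ab') b1.
have tri n : a <= n -> n <= b -> `|coef n - coef a| <= 3 * omega (n - a) ->
    `|coef b - coef n| <= 2 * omega (b - n) -> `|coef b - coef a| <= 5 * omega (b - a).
  move=> an nb h1 h2.
  have : omega (n - a) <= omega (b - a) by apply: modulus_le => //; lra.
  have : omega (b - n) <= omega (b - a) by apply: modulus_le => //; lra.
  have := ler_distD (coef n) (coef b) (coef a); lra.
have [h|h] := leP b (2 * t k.+1).
  have [ha|/ltW ha] := leP (t k.+1) a.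
    by apply: le_trans (osc_modulus ha ab h) _; lra.
  apply: (tri (t k.+1)) => //; first exact: ltW.
    exact: node1_modulus.
  apply: le_trans (osc_modulus (lexx _) (ltW kb) h) _.
  have := modulus_ge0 m (s := b - t k.+1); rewrite subr_ge0 ltW// => /(_ isT); lra.
have [ha|/ltW ha] := leP (2 * t k.+1) a.
  by apply: le_trans (lin_modulus ha ab bk) _; lra.
apply: (tri (2 * t k.+1)) => //; first exact: ltW.
  exact: node2_modulus.
by apply: lin_modulus => //; exact: ltW.
Qed.

Lemma coef_omega_continuous : omega_continuous omega `[0, 1] coef.
Proof.
exists 5 => a b; rewrite /= !in_itv/= => /andP[a0 a1] /andP[b0 b1].
have [ab|/ltW ab] := leP a b.
  by rewrite distrC [`|a - b|]distrC [`|b - a|]ger0_norm ?subr_ge0// coef_modulus.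
by rewrite [`|a - b|]ger0_norm ?subr_ge0// coef_modulus.
Qed.

Lemma coef_continuous : continuous coef.
Proof.
(* Clamping to the unit interval is 1-Lipschitz and does not change [coef], so the modulus extends
   to the line. *)
pose cl x : R := Num.max 0 (Num.min x 1).
have cl01 x : 0 <= cl x <= 1.
  by rewrite /cl le_max lexx/= ge_max ler01 ge_min lexx orbT.
have coef_cl x : coef x = coef (cl x).
  have [x0|/ltW x0] := leP x 0.
    rewrite coef_le0// /cl (max_idPl _) ?coef_le0//.
    by rewrite ge_min x0.
  have [x1|/ltW x1] := leP x 1.
    by rewrite /cl (min_idPl x1) (max_idPr x0).
  by rewrite coef_ge1// /cl (min_idPr x1) (max_idPr ler01).
have clB x y : x <= y -> cl x <= cl y /\ cl y - cl x <= y - x.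
  by move=> xy; rewrite /cl !maxEle !minEle; repeat case: ifPn; rewrite -?ltNge; lra.
have H x y : x <= y -> `|coef y - coef x| <= 5 * omega (y - x).
  move=> xy; rewrite (coef_cl x) (coef_cl y).
  have [h1 h2] := clB x y xy.
  have /andP[a0 _] := cl01 x; have /andP[_ b1] := cl01 y.
  apply: le_trans (coef_modulus a0 h1 b1) _.
  by rewrite ler_wpM2l// modulus_le// subr_ge0.
move=> x; apply/cvgrPdist_lt => e e0.
have [d d0 Hd] := modulus_cvg0 m (divr_gt0 e0 (ltr0Sn R 4)).
near=> y.
have xy : `|x - y| < d by near: y; exact: cvgr_dist_lt.
have := Hd _ (normr_ge0 _) xy.
have [h|/ltW h] := leP x y.
  by rewrite [`|coef x - coef y|]distrC [`|x - y|]distrC [`|y - x|]ger0_norm ?subr_ge0//; have := H x y h; lra.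
by rewrite [`|x - y|]ger0_norm ?subr_ge0//; have := H y x h; lra.
Unshelve. all: by end_near. Qed.

End Coefficient.

(** * Growth and loss of a single mode away from its resonance *)

Section ModeEstimates.
Context {R : realType}.
Variables (omega : R -> R) (t sig del : nat -> R).
Hypothesis cd : coef_data omega t sig del.
Local Notation c := (coef t sig del).

Variables (L : R) (w dw : R -> R).
Hypothesis Hw : forall x, has_deriv w x (dw x).
Hypothesis Hdw : forall x, has_deriv dw x (- (L ^+ 2 * c x) * w x).

Let F s := dw s ^+ 2 + L ^+ 2 * c s * w s ^+ 2.
Let G s := dw s ^+ 2 / c s + L ^+ 2 * w s ^+ 2.

Let F_ge0 s : 0 <= F s.
Proof.
have /andP[c0 _] := coef_ge0_le cd s.
by rewrite addr_ge0 ?sqr_ge0// mulr_ge0 ?sqr_ge0// mulr_ge0 ?sqr_ge0.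
Qed.

Let G_ge0 s : 0 <= G s.
Proof.
have /andP[c0 _] := coef_ge0_le cd s.
by rewrite addr_ge0 ?divr_ge0 ?sqr_ge0// mulr_ge0 ?sqr_ge0.
Qed.

Let t_gt0 := cd_t_gt0 cd.
Let t_step := cd_t_step cd.

(** In a block c'/c is at least [- 2 * sig k.+1], since [gam] is at least 1/2 and its derivative in
    time is at most [sig k.+1]. *)
Lemma energy_osc k a b : t k.+1 <= a -> a <= b -> b <= 2 * t k.+1 ->
  F a * expR (- (2 * sig k.+1) * (b - a)) <= F b /\
  G b <= G a * expR (2 * sig k.+1 * (b - a)).
Proof.
move=> ka ab bk; have d0 := cd_del_gt0 cd k.+1; have s0 := cd_sig_gt0 cd k.
pose f x := del k.+1 * gam (sig k.+1 * x).
have cf x : x \in `[a, b] -> c x = f x.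
  rewrite in_itv/= => /andP[ax xb]; apply: (coef_osc cd (k := k)).
  by rewrite in_itv/= (le_trans ka)//= (le_trans xb).
have := @energy_estimates R w dw f (fun x => del k.+1 * dgam (sig k.+1) x)
  L (2 * sig k.+1) a b ab.
have aab : a \in `[a, b] by rewrite in_itv/= lexx.
have bab : b \in `[a, b] by rewrite in_itv/= lexx andbT.
rewrite -(cf a aab) -(cf b bab); apply.
- by rewrite mulr_ge0// ltW.
- by move=> x _; exact: Hw.
- by move=> x xab; rewrite -cf//; exact: Hdw.
- by move=> x _; apply: derive_fscale; exact: derive_gam.
- by move=> x _; rewrite mulr_gt0//; have := gam_bound (sig k.+1 * x); lra.
- move=> x _; rewrite /f mulrCA ler_wpM2l ?(ltW d0)//.
  have := dgam_bound x (ltW s0); have := gam_bound (sig k.+1 * x).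
  by rewrite ler_norml; set g := gam _; nra.
Qed.

(** The coefficient is nondecreasing here, so [energy_estimates] applies with rate 0, whatever the
    ratio of [del k] to [del k.+1]. *)
Lemma energy_lin k a b : 2 * t k.+1 <= a -> a <= b -> b <= t k ->
  F a <= F b /\ G b <= G a.
Proof.
move=> ka ab bk.
have cf x : x \in `[a, b] -> c x = lin t del k x.
  rewrite in_itv/= => /andP[ax xb]; apply: (coef_lin cd).
  by rewrite in_itv/= (le_trans ka)//= (le_trans xb).
have gap : 0 < t k - 2 * t k.+1 by have := t_step k; have := t_gt0 k.+1; lra.
pose df := (del k - del k.+1) / (t k - 2 * t k.+1).
have := @energy_estimates R w dw (lin t del k) (fun=> df) L 0 a b ab (lexx _).
have aab : a \in `[a, b] by rewrite in_itv/= lexx.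
have bab : b \in `[a, b] by rewrite in_itv/= lexx andbT.
rewrite oppr0 !mul0r expR0 !mulr1 -(cf a aab) -(cf b bab); apply.
- by move=> x _; exact: Hw.
- by move=> x xab; rewrite -cf//; exact: Hdw.
- move=> x _; rewrite /lin; apply: has_deriv_eq.
    apply: derive_fadd; first exact: derive_fcst.
    apply: derive_fscale; apply: derive_fmul; last exact: derive_fcst.
    by apply: derive_fsub; [exact: derive_fid|exact: derive_fcst].
  by rewrite /df /=; field; rewrite gt_eqF.
- move=> x xab; rewrite -cf//; move: xab; rewrite in_itv/= => /andP[ax xb].
  have x0 : 0 < x by have := t_gt0 k.+1; lra.
  by have /andP[] := coef_bound cd x0 (le_trans xb bk).
- by move=> x _; rewrite mul0r divr_ge0 ?(ltW gap)// subr_ge0 (cd_del_step cd).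
Qed.

(** Total phase of blocks 1 to [k], which are those met after time [2 * t k.+1]; all of them are
    fixed before block [k.+1] is chosen. *)
Definition phase_sum (k : nat) : R := \sum_(0 <= i < k) sig i.+1 * t i.+1.

Lemma phase_sum_ge0 k : 0 <= phase_sum k.
Proof.
by apply: sumr_ge0 => i _; rewrite mulr_ge0// ltW// (cd_sig_gt0 cd).
Qed.

(** On the way to the right, gaps are free and the block of index [i] costs at most
    [expR (2 * sig i * t i)]. The local fact [weaken] covers an [s] that stops before all blocks are
    crossed. *)
Let forward k s : 2 * t k.+1 <= s -> s <= 1 ->
  F (2 * t k.+1) * expR (- (2 * phase_sum k)) <= F s /\
  G s <= G (2 * t k.+1) * expR (2 * phase_sum k).
Proof.
elim: k s => [|k IHk] s ks s1.
  rewrite /phase_sum big_nil mulr0 oppr0 expR0 !mulr1.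
  by apply: (energy_lin (k := 0)) => //; rewrite (cd_t0 cd).
have step := t_step k.+1; have tk1 := t_gt0 k.+1; have tk2 := t_gt0 k.+2.
have sg0 := cd_sig_gt0 cd k.
have ps0 := phase_sum_ge0 k.
have -> : phase_sum k.+1 = phase_sum k + sig k.+1 * t k.+1.
  by rewrite /phase_sum big_nat_recr.
set st := sig k.+1 * t k.+1.
have st0 : 0 < st by rewrite mulr_gt0.
have weaken p q : 0 <= p -> 0 <= q -> q <= p ->
    F (2 * t k.+2) * expR (- q) <= F s ->
    G s <= G (2 * t k.+2) * expR q ->
    F (2 * t k.+2) * expR (- p) <= F s /\
    G s <= G (2 * t k.+2) * expR p.
  move=> p0 q0 qp hF hG; split.
    by apply: le_trans hF; rewrite ler_wpM2l// ler_expR lerN2.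
  by apply: le_trans hG _; rewrite ler_wpM2l// ler_expR.
have [sk|/ltW ks'] := leP s (t k.+1).
  have [hF hG] := energy_lin ks (lexx s) sk.
  have [{}hF {}hG] := energy_lin (lexx _) ks sk.
  by apply: (weaken _ 0); rewrite ?oppr0 ?expR0 ?mulr1//; lra.
have [hF1 hG1] := @energy_lin k.+1 (2 * t k.+2) (t k.+1) (lexx _) ltac:(lra) (lexx _).
have osc b : t k.+1 <= b -> b <= 2 * t k.+1 ->
    F (2 * t k.+2) * expR (- (2 * st)) <= F b /\
    G b <= G (2 * t k.+2) * expR (2 * st).
  move=> kb bk; have [hF hG] := energy_osc (lexx _) kb bk.
  have hb : 2 * sig k.+1 * (b - t k.+1) <= 2 * st.
    by rewrite -mulrA ler_wpM2l// /st ler_wpM2l ?(ltW sg0)//; lra.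
  split.
    apply: le_trans hF; apply: ler_pM; rewrite ?expR_ge0//.
    by rewrite ler_expR mulNr lerN2.
  apply: le_trans hG _; apply: ler_pM; rewrite ?expR_ge0//.
  by rewrite ler_expR.
have [sk|/ltW ks2] := leP s (2 * t k.+1).
  have [hF hG] := osc s ks' sk.
  by apply: (weaken _ (2 * st)) => //; lra.
have [hF2 hG2] := osc (2 * t k.+1) ltac:(lra) (lexx _).
have [hF3 hG3] := IHk s ks2 s1.
rewrite mulrDr opprD !expRD; split.
  apply: le_trans hF3; rewrite [X in _ * X]mulrC mulrA.
  by rewrite ler_wpM2r ?expR_ge0.
apply: le_trans hG3 _; rewrite [X in _ <= _ * X]mulrC mulrA.
by rewrite ler_wpM2r ?expR_ge0.
Qed.

(** As [c <= 3 / 2], the plain energy lies between [2 / 3 * F] and [(1 + 3 / 2) * G]. At the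
    starting time [w] vanishes, which makes [F] and [G] explicit. *)
Lemma mode_forward k s : 2 * t k.+1 <= s -> s <= 1 -> w (2 * t k.+1) = 0 ->
  2 / 3 * dw (2 * t k.+1) ^+ 2 * expR (- (2 * phase_sum k)) <=
    L ^+ 2 * w s ^+ 2 + dw s ^+ 2 /\
  L ^+ 2 * w s ^+ 2 + dw s ^+ 2 <=
    5 / 2 * (dw (2 * t k.+1) ^+ 2 / del k.+1) * expR (2 * phase_sum k).
Proof.
move=> ks s1 w0; have [] := forward ks s1.
have s0 : 0 < s by have := t_gt0 k.+1; lra.
have /andP[cs0 _] := @coef_bound _ _ _ _ _ cd 0 s s0 ltac:(by rewrite (cd_t0 cd)).
have /andP[_ cs] := coef_ge0_le cd s.
have cE : c (2 * t k.+1) = del k.+1.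
  rewrite (coef_lin cd (k := k)) /lin ?subrr ?mul0r ?mulr0 ?addr0//.
  by rewrite in_itv/= lexx/=; have := t_step k; have := t_gt0 k.+1; lra.
rewrite /F /G w0 cE expr0n/= !mulr0 !addr0.
set d2 := dw _ ^+ 2; set Lw := L ^+ 2 * w s ^+ 2; set dws := dw s ^+ 2.
have Lw0 : 0 <= Lw by rewrite mulr_ge0 ?sqr_ge0.
have dws0 : 0 <= dws by rewrite sqr_ge0.
have -> : L ^+ 2 * c s * w s ^+ 2 = c s * Lw by rewrite /Lw; ring.
have q0 : 0 <= dws / c s by rewrite divr_ge0// ltW.
have qE : dws = c s * (dws / c s) by rewrite mulrCA divff ?mulr1// gt_eqF.
move=> h1 h2; split.
  have : c s * Lw <= 3 / 2 * Lw by rewrite ler_wpM2r.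
  by move: h1; set X := expR _; lra.
have : c s * (dws / c s) <= 3 / 2 * (dws / c s) by rewrite ler_wpM2r.
by rewrite -qE; move: h2; set X := expR _; lra.
Qed.

(* Backward in time the energy decreases down to [2 t_(k+2)], and on
   [0, 2 t_(k+2)], which is shorter than the wave length, Gronwall's inequality
   for [L^2 w^2 + w'^2] only loses a constant. *)
Lemma mode_backward k s : 0 <= s -> s <= t k.+1 -> w (t k.+1) = 0 ->
  1 <= L -> 2 * t k.+2 * L <= 1 ->
  L ^+ 2 * w s ^+ 2 + dw s ^+ 2 <= 8 * L ^+ 2 * dw (t k.+1) ^+ 2.
Proof.
move=> s0 sk wk L1 tL.
set D := dw (t k.+1) ^+ 2.
have D0 : 0 <= D by rewrite sqr_ge0.
have L2 : 1 <= L ^+ 2 by rewrite exprn_ege1.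
have tk1 := t_le1 cd k.+1.
(* Bounding [w] by [F] would cost a division by the small coefficient. Instead [F] bounds [dw] only,
   and [w] is recovered by the mean value inequality from its zero at [t k.+1 <= 1]. *)
have near_block r : 2 * t k.+2 <= r -> r <= t k.+1 ->
    L ^+ 2 * w r ^+ 2 + dw r ^+ 2 <= 2 * L ^+ 2 * D.
  move=> kr rk.
  have dwD y : y \in `[r, t k.+1] -> `|dw y| <= Num.sqrt D.
    rewrite in_itv/= => /andP[ry yk].
    rewrite -(@ler_pXn2r _ 2) ?nnegrE ?sqrtr_ge0 ?normr_ge0//.
    rewrite sqr_sqrtr// -normrX ger0_norm ?sqr_ge0//.
    have [+ _] := energy_lin (le_trans kr ry) yk (lexx _).
    rewrite /F wk expr0n mulr0 addr0; apply: le_trans.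
    have /andP[c0 _] := coef_ge0_le cd y.
    by rewrite lerDl mulr_ge0 ?sqr_ge0// mulr_ge0 ?sqr_ge0.
  have := @mvt_le _ w dw (Num.sqrt D) r (t k.+1) rk (fun x _ => Hw x) dwD.
  rewrite wk sub0r normrN => wr.
  have w2 : w r ^+ 2 <= D.
    rewrite -(sqr_sqrtr D0) -[w r ^+ 2]ger0_norm ?sqr_ge0// normrX.
    rewrite ler_pXn2r ?nnegrE ?sqrtr_ge0 ?normr_ge0//.
    apply: le_trans wr _; rewrite ler_piMr ?sqrtr_ge0//.
    by have := t_gt0 k.+2; lra.
  have rr : r \in `[r, t k.+1] by rewrite in_itv/= lexx.
  have d2 : dw r ^+ 2 <= D.
    rewrite -(sqr_sqrtr D0) -[dw r ^+ 2]ger0_norm ?sqr_ge0// normrX.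
    by rewrite ler_pXn2r ?nnegrE ?sqrtr_ge0 ?normr_ge0// dwD.
  nra.
have [ks|/ltW sk2] := leP (2 * t k.+2) s.
  by apply: le_trans (near_block s ks sk) _; nra.
have := @free_energy_backward _ w dw c L s (2 * t k.+2) sk2 ltac:(lra)
  (fun x _ => Hw x) (fun x _ => Hdw x).
have c02 x : x \in `[s, 2 * t k.+2] -> 0 <= c x <= 2.
  by move=> _; have := coef_ge0_le cd x; lra.
move=> /(_ c02).
rewrite [dw s ^+ 2 + _]addrC [dw _ ^+ 2 + _ in X in _ <= X]addrC => h.
have st := t_step k.+1; have t2 := t_gt0 k.+2.
have := near_block (2 * t k.+2) (lexx _) ltac:(lra) => h2.
have {h h2} := le_trans h h2.
(* The exponent is at least -1 because [2 * t k.+2 * L <= 1], and [expR (- (1 / 2)) >= 1 / 2]. *)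
have e4 : 1 / 4 <= expR (- L * (2 * t k.+2 - s)).
  apply: (@le_trans _ _ (expR (- (1 / 2)) ^+ 2)); last first.
    by rewrite -expRM_natl ler_expR mulr_natl; nra.
  have := @expR_ge1Dx R (- (1 / 2)); nra.
set P := L ^+ 2 * w s ^+ 2 + dw s ^+ 2 => h.
have P0 : 0 <= P by rewrite addr_ge0 ?sqr_ge0// mulr_ge0 ?sqr_ge0.
have : P * (1 / 4) <= P * expR (- L * (2 * t k.+2 - s)) by rewrite ler_wpM2l.
lra.
Qed.

End ModeEstimates.

(** * Choice of the parameters *)

Section ParameterChoice.
Context {R : realType}.
Variables (omega phi : R -> R) (lambda : nat -> R).
Hypothesis m : modulus omega.
Hypothesis phi_ge1 : forall s, 0 <= s -> 1 <= phi s.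
Hypothesis phi_lim : s * (phi (s / Num.sqrt (omega (1 / s))))^-1
      @[s --> +oo] --> +oo.
Hypothesis lambda_unbounded : forall M : R, exists k, M < lambda k.

Let freq (s : R) : R := s / Num.sqrt (omega (1 / s)).

Let omega_inv_gt0 (s : R) : 0 < s -> 0 < omega (1 / s).
Proof. by move=> s0; apply: modulus_gt0; rewrite ?divr_gt0. Qed.

Let freq_gt0 (s : R) : 0 < s -> 0 < freq s.
Proof. by move=> s0; rewrite divr_gt0// sqrtr_gt0 omega_inv_gt0. Qed.

Let freq_continuous (s : R) : 0 < s -> {for s, continuous freq}.
Proof.
move=> s0; have [cont _ _ _ _] := m.
have /continuous_within_itvcyP[co _] := cont.
have ci : (fun x : R => 1 / x) @ s --> 1 / s.
  by apply: cvgM; [exact: cvg_cst|apply: cvgV => //; rewrite gt_eqF].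
have c1 : (fun x : R => Num.sqrt (omega (1 / x))) @ s --> Num.sqrt (omega (1 / s)).
  apply: (@continuous_comp _ _ _ (fun x : R => omega (1 / x)) Num.sqrt).
    apply: (@continuous_comp _ _ _ (fun x : R => 1 / x) omega); first exact: ci.
    by apply: co; rewrite in_itv/= andbT divr_gt0.
  exact: sqrt_continuous.
apply: cvgM; first exact: cvg_id.
by apply: cvgV; [rewrite gt_eqF// sqrtr_gt0 omega_inv_gt0|exact: c1].
Qed.

(* The hypothesis on [phi] only concerns frequencies of the form [freq s]. *)
Let freq_ivt (M : R) : 1 <= M -> exists n s, M <= s /\ freq s = lambda n.
Proof.
move=> M1; have [n hn] := lambda_unbounded (freq M).
have M0 : 0 < M by apply: lt_le_trans M1.
have l0 : 0 < lambda n := lt_trans (freq_gt0 M0) hn.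
have o1 : 0 < Num.sqrt (omega 1) by rewrite sqrtr_gt0 modulus_gt0.
(* For [s >= 1] one has [omega (1 / s) <= omega 1], so [freq s] is at least
   [s / Num.sqrt (omega 1)]: at [s1] it has passed [lambda n]. *)
pose s1 := Num.max M (lambda n * Num.sqrt (omega 1)).
have Ms1 : M <= s1 by rewrite le_max lexx.
have s10 : 0 < s1 := lt_le_trans M0 Ms1.
have fs1 : lambda n <= freq s1.
  rewrite /freq ler_pdivlMr ?sqrtr_gt0 ?omega_inv_gt0//.
  apply: (@le_trans _ _ (lambda n * Num.sqrt (omega 1))); last first.
    by rewrite le_max lexx orbT.
  rewrite ler_wpM2l ?(ltW l0)// ler_wsqrtr// modulus_le//.
    by rewrite divr_ge0// ltW.
  by rewrite ler_pdivrMr// mul1r (le_trans M1).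
have [||s + fs] := @IVT R freq M s1 (lambda n) Ms1.
- apply: continuous_in_subspaceT => x; rewrite inE/= in_itv/= => /andP[Mx _].
  by apply: freq_continuous; exact: lt_le_trans Mx.
- by rewrite ge_min le_max (ltW hn) fs1 orbT.
by rewrite in_itv/= => /andP[Ms _]; exists n, s.
Qed.

(** Here [T], [L], [D], [S] are the time, frequency, amplitude and accumulated phase of the previous
    step. In the last group, the second condition gives blow-up in V_1, the third lets the resonant
    growth beat the Gevrey weight, and the fourth makes the losses negligible against every positive
    power of the frequency. *)
Definition admissible (k : nat) (T L D S s t : R) : Prop :=
  [/\ 0 < t /\ sin (s * t) = 0, 4 * t <= T /\ 2 * t * L <= 1,
      1 <= s /\ 1 / s <= t, omega (1 / s) <= D &
   [/\ L < freq s, 2 * k%:R * 2 ^+ k * expR (2 * S) ^+ 2 * freq s <= s ^+ 2,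
      s ^+ 2 * expR (k%:R * phi (freq s)) <= expR (s * t / 8),
      (4 ^+ k * expR (2 * S)) ^+ k.+1 <= freq s & s <= freq s]].

(** With [x = s * tau / 128] the assumption reads [s <= x ^+ 2], so
    [s ^+ 2 <= x ^+ 4 <= expR (4 * x)]. *)
Let sqr_le_exp (tau s : R) : 0 < tau -> (128 / tau) ^+ 2 <= s ->
  s ^+ 2 <= expR (s * tau / 32).
Proof.
move=> tau0 hs; set x := s * tau / 128.
have s0 : 0 <= s by apply: le_trans hs; rewrite sqr_ge0.
have x0 : 0 <= x by rewrite divr_ge0// mulr_ge0// ltW.
have xs : s <= x ^+ 2.
  have -> : x ^+ 2 = s * (s / (128 / tau) ^+ 2).
    by rewrite /x; field; rewrite gt_eqF.
  by rewrite ler_peMr// ler_pdivlMr ?mul1r// exprn_gt0// divr_gt0.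
have -> : s * tau / 32 = 4%:R * x by rewrite /x; field.
rewrite expRM_natl; apply: (@le_trans _ _ (x ^+ 4)).
  by rewrite (exprM x 2 2) ler_pXn2r ?nnegrE ?sqr_ge0.
rewrite ler_pXn2r ?nnegrE ?expR_ge0//.
by have := expR_ge1Dx x; lra.
Qed.

Let admissible_exists (k : nat) (T L D S : R) :
  0 < T -> 1 <= L -> 0 < D -> D <= 1 -> 0 <= S ->
  exists n s t, lambda n = freq s /\ admissible k T L D S s t.
Proof.
move=> T0 L1 D0 D1 S0.
have L0 : 0 < L by apply: lt_le_trans L1.
pose tau := Num.min (T / 4) (1 / (2 * L)).
have tau0 : 0 < tau by rewrite lt_min !divr_gt0// mulr_gt0.
have [d d0 Hd] := modulus_cvg0 m D0.
have o1 := modulus_gt0 m (@ltr01 R).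
pose K := expR (2 * S).
pose C := 2 * k%:R * 2 ^+ k * K ^+ 2.
have C0 : 0 <= C by rewrite !mulr_ge0// ?exprn_ge0 ?expR_ge0.
pose B := (4 ^+ k * K) ^+ k.+1.
have : \forall s \near +oo, 32 * k%:R / tau <= s * (phi (freq s))^-1.
  by move/cvgryPge: phi_lim => /(_ (32 * k%:R / tau)).
move=> -[M0 [_ HM0]].
(* One summand for each lower bound required of [s]; all are nonnegative, so [M <= s] gives them
   all. *)
pose M := 1 + Num.max M0 0 + 2 * pi / tau + 1 / d + (L + 1) + B + C ^+ 2 / omega 1
  + (128 / tau) ^+ 2.
have B0 : 0 <= B by rewrite exprn_ge0// mulr_ge0 ?exprn_ge0 ?expR_ge0.
have h1 : 0 <= 2 * pi / tau by rewrite !divr_ge0 ?mulr_ge0 ?pi_ge0// ltW.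
have h2 : 0 < 1 / d by rewrite divr_gt0.
have h3 : 0 <= C ^+ 2 / omega 1 by rewrite divr_ge0 ?sqr_ge0// ltW.
have h4 : 0 <= (128 / tau) ^+ 2 by rewrite sqr_ge0.
have h5 : 0 <= Num.max M0 0 /\ M0 <= Num.max M0 0 by rewrite !le_max !lexx orbT.
have [|n [s [Ms fs]]] := @freq_ivt M.
  by rewrite /M; lra.
have s1 : 1 <= s by rewrite (le_trans _ Ms)// /M; lra.
have s0 : 0 < s by apply: lt_le_trans s1.
have sM0 : M0 < s by rewrite (lt_le_trans _ Ms)// /M; lra.
have s_pi : 2 * pi / tau <= s by rewrite (le_trans _ Ms)// /M; lra.
have s_d : 1 / d < s by rewrite (lt_le_trans _ Ms)// /M; lra.
have s_L : L < s by rewrite (lt_le_trans _ Ms)// /M; lra.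
have s_B : B <= s by rewrite (le_trans _ Ms)// /M; lra.
have s_C : C ^+ 2 / omega 1 <= s by rewrite (le_trans _ Ms)// /M; lra.
have s_tau : (128 / tau) ^+ 2 <= s by rewrite (le_trans _ Ms)// /M; lra.
clearbody M; clear Ms.
have {HM0} phis := HM0 _ sM0; rewrite /= in phis.
have pi0 := pi_gt0 R.
(* [t] will be the largest multiple of [pi / s] not above [tau]: the sine vanishes there, and
   [t >= tau / 2] because [pi / s <= tau / 2]. *)
pose N := Num.truncn (s * tau / pi).
have /andP[N1 N2] : N%:R <= s * tau / pi < N.+1%:R.
  by apply: truncn_itv; rewrite divr_ge0 ?mulr_ge0 ?ltW.
pose t := pi * N%:R / s.
have t_tau : t <= tau.
  have : N%:R * pi <= s * tau by rewrite -ler_pdivlMr.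
  by rewrite /t ler_pdivrMr//; lra.
have tau_t : tau / 2 <= t.
  have h : s * tau < pi * (N%:R + 1) by rewrite natr1 [pi * _]mulrC -ltr_pdivrMr.
  have h' : 2 * pi <= s * tau by rewrite -ler_pdivrMr.
  by rewrite /t ler_pdivlMr//; lra.
have t0 : 0 < t by lra.
have N_gt0 : (1 : R) <= N%:R.
  rewrite ler1n; case: (posnP N) => // N0.
  by move: t0; rewrite /t N0 mulr0 mul0r ltxx.
have d1 := omega_inv_gt0 s0.
have dD : omega (1 / s) <= D.
  apply/ltW/Hd; first by rewrite divr_ge0// ltW.
  by rewrite div1r -[d]invrK ltf_pV2 ?posrE ?invr_gt0// -div1r.
have sf : s <= freq s.
  rewrite /freq ler_pdivlMr ?sqrtr_gt0//.
  rewrite ler_piMr ?(ltW s0)// -[X in _ <= X]sqrtr1 ler_wsqrtr//.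
  exact: le_trans dD D1.
exists n, s, t; split => //; split; rewrite -/K.
- split=> //; rewrite /t mulrC divfK ?gt_eqF//.
  elim: (N) => [|j IHj]; first by rewrite mulr0 sin0.
  by rewrite -natr1 mulrDr mulr1 sinDpi IHj oppr0.
- have : tau <= T / 4 by rewrite ge_min lexx.
  have : tau <= 1 / (2 * L) by rewrite ge_min lexx orbT.
  rewrite ler_pdivlMr ?mulr_gt0// => h6 h7.
  split; first lra.
  by apply: le_trans h6; rewrite mulrAC mulrC ler_wpM2r// mulr_ge0// ltW.
- split=> //; rewrite /t ler_wpM2r ?invr_ge0 ?(ltW s0)//.
  by have := pi_ge2 R; nra.
- exact: dD.
split => //.
- exact: lt_le_trans sf.
(* This amounts to [C ^+ 2 <= s ^+ 2 * omega (1 / s)], whose right-hand side is at least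
   [s * omega 1] by the monotone ratio. *)
- rewrite -/C /freq mulrA ler_pdivrMr ?sqrtr_gt0//.
  rewrite [C * s]mulrC expr2 -[s * s * _]mulrA ler_wpM2l ?(ltW s0)//.
  have r0 : 0 <= s * Num.sqrt (omega (1 / s)) by rewrite mulr_ge0 ?sqrtr_ge0// ltW.
  rewrite -(@ler_pXn2r _ 2) ?nnegrE//.
  rewrite [(s * _) ^+ 2]exprMn sqr_sqrtr ?(ltW d1)//.
  have is1 : 1 / s <= 1 by rewrite ler_pdivrMr// mul1r.
  have := modulus_scale m (divr_gt0 ltr01 s0) is1; rewrite divr1 => h6.
  apply: (@le_trans _ _ (s ^+ 2 * (omega 1 * (1 / s)))); last first.
    by rewrite ler_wpM2l ?sqr_ge0.
  have -> : s ^+ 2 * (omega 1 * (1 / s)) = s * omega 1 by field; rewrite gt_eqF.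
  by rewrite -ler_pdivrMr.
(* Since [t >= tau / 2], the exponent [s * t / 8] is at least [s * tau / 16]: one half absorbs
   [s ^+ 2], the other [k%:R * phi (freq s)]. *)
- apply: (@le_trans _ _ (expR (s * tau / 32) * expR (s * tau / 32))).
    apply: ler_pM; [exact: sqr_ge0|exact: expR_ge0|exact: sqr_le_exp|rewrite ler_expR].
    have p0 : 0 < phi (freq s).
      by apply: lt_le_trans (phi_ge1 _); rewrite ?ltW// freq_gt0.
    move: phis; rewrite -/(freq s) ler_pdivlMr// mulrAC ler_pdivrMr// => h6.
    by rewrite -/(freq s); move: h6; set y := phi _; lra.
  rewrite -expRD ler_expR.
  have : s * (tau / 2) <= s * t by rewrite ler_wpM2l// ltW.
  lra.
- exact: le_trans sf.
Qed.

Record params := Params {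
  pa_t : R; pa_sig : R; pa_del : R; pa_lam : R; pa_S : R; pa_k : nat; pa_n : nat }.

Definition params_valid (p : params) : Prop :=
  [/\ 0 < pa_t p, 1 <= pa_lam p, 0 < pa_del p, pa_del p <= 1 & 0 <= pa_S p].

(** Validity is a premise, so that every [p] has a successor and [dependent_choice] applies to the
    whole type; validity along the sequence follows by induction. *)
Definition params_step (p q : params) : Prop := params_valid p ->
  [/\ params_valid q, admissible (pa_k p) (pa_t p) (pa_lam p) (pa_del p) (pa_S p)
        (pa_sig q) (pa_t q),
      pa_S q = pa_S p + pa_sig q * pa_t q /\ pa_k q = (pa_k p).+1,
      pa_del q = omega (1 / pa_sig q) &
      pa_lam q = freq (pa_sig q) /\ lambda (pa_n q) = pa_lam q].

Let params_stepP (p : params) : {q | params_step p q}.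
Proof.
apply: cid; have [v|nv] := pselect (params_valid p); last by exists p => /nv.
have [T0 L1 D0 D1 S0] := v.
have [n [s [t [ln adm]]]] := admissible_exists (pa_k p) T0 L1 D0 D1 S0.
exists (Params t s (omega (1 / s)) (freq s) (pa_S p + s * t) (pa_k p).+1 n) => _.
have [[t0 st] _ [s1 _] dD [Lf _ _ _ _]] := adm.
have s0 : 0 < s by apply: lt_le_trans s1.
split => //; split => //=.
- by rewrite ltW// (le_lt_trans L1).
- exact: omega_inv_gt0.
- exact: le_trans D1.
- by rewrite addr_ge0// mulr_ge0// ltW.
Qed.

Lemma parameters : exists (t sig del lam : nat -> R) (n : nat -> nat),
  [/\ coef_data omega t sig del,
      1 <= lam 0 /\ (forall k, lam k < lam k.+1) ,
      forall k, lambda (n k.+1) = lam k.+1,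
      forall k, sig k.+1 ^+ 2 = del k.+1 * lam k.+1 ^+ 2 &
      forall k, [/\ 2 * t k.+1 * lam k <= 1, 1 <= sig k.+1,
        2 * k%:R * 2 ^+ k * expR (2 * phase_sum t sig k) ^+ 2 * lam k.+1
          <= sig k.+1 ^+ 2,
        sig k.+1 ^+ 2 * expR (k%:R * phi (lam k.+1)) <=
          expR (sig k.+1 * t k.+1 / 8) &
        (4 ^+ k * expR (2 * phase_sum t sig k)) ^+ k.+1 <= lam k.+1]].
Proof.
have o1 := modulus_gt0 m (@ltr01 R).
(* The minimum gives both [del 0 <= 1] and [del 0 <= omega (t 0)]. The fields [pa_sig] and [pa_n]
   are dummies at index 0. *)
pose p0 := Params 1 1 (Num.min 1 (omega 1)) 1 0 0 0.
have [f [f0 fS]] := dependent_choice params_stepP p0.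
have v k : params_valid (f k).
  elim: k => [|k IHk]; last by have [] := fS k IHk.
  by rewrite f0; split => //=; [rewrite lt_min ltr01|rewrite ge_min lexx].
have kE k : pa_k (f k) = k.
  elim: k => [|k IHk]; first by rewrite f0.
  by have [_ _ [_ ->] _ _] := fS k (v k); rewrite IHk.
have SE k : pa_S (f k) = phase_sum (pa_t \o f) (pa_sig \o f) k.
  elim: k => [|k IHk]; first by rewrite f0 /phase_sum big_nil.
  have [_ _ [-> _] _ _] := fS k (v k).
  by rewrite /phase_sum big_nat_recr//= IHk.
exists (pa_t \o f), (pa_sig \o f), (pa_del \o f), (pa_lam \o f), (pa_n \o f).
split.
- split => //.
  + by rewrite /= f0.
  + by move=> k; have [] := v k.
  + by move=> k; have [_ [_ []]] := fS k (v k).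
  + by move=> k; have [] := v k.
  + by move=> k /=; have [_ [_ _ _ + _] _ -> _] := fS k (v k).
  + by have [] := v 0%N.
  + case=> [|k] /=; first by rewrite f0/= ge_min lexx orbT.
    have [_ [_ _ [s1 st] _ _] _ -> _] := fS k (v k).
    by rewrite modulus_le// divr_ge0// (le_trans ler01).
  + by move=> k /=; have [_ [_ _ [s1 _] _ _] _ _ _] := fS k (v k); apply: lt_le_trans s1.
  + by move=> k /=; have [] := fS k (v k).
  + by move=> k /=; have [_ [[_ st] _ _ _ _] _ _ _] := fS k (v k).
- split; first by rewrite /= f0.
  by move=> k /=; have [_ [_ _ _ _ [Lf _ _ _ _]] _ _ [-> _]] := fS k (v k).
- by move=> k /=; have [_ _ _ _ [_ ->]] := fS k (v k).
- move=> k /=; have [_ [_ _ [s1 _] _ _] _ -> [-> _]] := fS k (v k).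
  have s0 : 0 < pa_sig (f k.+1) by apply: lt_le_trans s1.
  have d1 := omega_inv_gt0 s0.
  by rewrite /freq exprMn exprVn sqr_sqrtr ?(ltW d1)// mulrCA divff ?mulr1// gt_eqF.
- move=> k /=; rewrite -SE.
  have [_ adm _ _ [-> _]] := fS k (v k).
  rewrite kE in adm.
  by have [_ [_ tL] [s1 _] _ [_ h1 h2 h3 _]] := adm; split.
Qed.

End ParameterChoice.

(** * The normalized modes *)

Section Modes.
Context {R : realType}.

Lemma res_dsol_sqr (x t : R) : sin (x * t) = 0 ->
  res_dsol x t ^+ 2 = x ^+ 2 * expR (x * t / 8).
Proof.
move=> s0; rewrite /res_dsol /res_exp s0 mul0r mul0r subr0 expr0n/= mul0r addr0.
rewrite 2!exprMn -expRM_natl; have := cos2Dsin2 (x * t).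
by rewrite s0 expr0n/= addr0 => ->; rewrite mulr1; congr (_ * expR _); field.
Qed.

(** A quarter period before [2 * t] the sine has absolute value 1 and the correction [sin * cos] in
    the exponent vanishes. Only the factor [expR (- (pi / 16))] is lost, and it is at least 3/4. *)
Lemma res_sol_sqr (x t : R) : sin (x * t) = 0 -> 0 < x ->
  3 / 4 * expR (x * t / 8) ^+ 2 <= res_sol x (2 * t - pi / (2 * x)) ^+ 2.
Proof.
move=> s0 x0.
have tauE : x * (2 * t - pi / (2 * x)) = (2 * (x * t)) - pi / 2.
  by field; rewrite gt_eqF.
have s2 : sin (2 * (x * t)) = 0 by rewrite mulr_natl mulr2n sinD s0 mul0r mulr0 addr0.
rewrite /res_sol tauE.
rewrite sinBpihalf exprMn sqrrN.
have -> : cos (2 * (x * t)) ^+ 2 = 1.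
  by have := cos2Dsin2 (2 * (x * t)); rewrite s2 expr0n/= addr0.
rewrite mul1r /res_exp -!expRM_natl.
rewrite cosBpihalf s2 mulr0 mul0r subr0.
have -> : 2%:R * ((2 * (x * t) - pi / 2) / 16) = - (pi / 16) + 2%:R * (x * t / 8) by field.
rewrite expRD ler_wpM2r ?expR_ge0//.
by have := @expR_ge1Dx R (- (pi / 16)); have := pihalf_lt2 R; lra.
Qed.

(** Guarantees that the peak [2 * t - pi / (2 * x)] lies inside the block. *)
Lemma phase_ge_pi (x t : R) : 0 < x -> 0 < t -> sin (x * t) = 0 -> pi / x <= t.
Proof.
move=> x0 t0 s0; rewrite ler_pdivrMr// mulrC leNgt; apply/negP => h.
have : 0 < sin (x * t) by apply: sin_gt0_pi; rewrite ?mulr_gt0.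
by rewrite s0 ltxx.
Qed.

Variables (omega phi : R -> R) (t sig del lam : nat -> R).
Hypothesis cd : coef_data omega t sig del.
Local Notation c := (coef t sig del).

Hypothesis lam_ge1 : forall k, 1 <= lam k.
Hypothesis lam_sig : forall k, sig k.+1 ^+ 2 = del k.+1 * lam k.+1 ^+ 2.
Hypothesis lam_t : forall k, 2 * t k.+1 * lam k <= 1.
Hypothesis lam_low : forall k,
  2 * k%:R * 2 ^+ k * expR (2 * phase_sum t sig k) ^+ 2 * lam k.+1 <= sig k.+1 ^+ 2.
Hypothesis lam_phi : forall k,
  sig k.+1 ^+ 2 * expR (k%:R * phi (lam k.+1)) <= expR (sig k.+1 * t k.+1 / 8).
Hypothesis phi_ge0 : forall s, 0 <= s -> 0 <= phi s.

(** Data are imposed at [t k.+1], where the resonant solution vanishes. On the block the equation is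
    the resonant one because [lam k.+1 ^+ 2 * del k.+1] is [sig k.+1 ^+ 2], so uniqueness identifies
    the two solutions. *)
Let raw_mode k : exists w dw : R -> R,
  [/\ forall s, has_deriv w s (dw s),
      forall s, has_deriv dw s (- (lam k.+1 ^+ 2 * c s) * w s),
      forall s, s \in `[t k.+1, 2 * t k.+1] -> w s = res_sol (sig k.+1) s &
      forall s, s \in `[t k.+1, 2 * t k.+1] -> dw s = res_dsol (sig k.+1) s].
Proof.
set L := lam k.+1; set x := sig k.+1.
have qM s : `|L ^+ 2 * c s| <= L ^+ 2 * (3 / 2).
  have /andP[c0 c1] := coef_ge0_le cd s.
  rewrite normrM (ger0_norm c0) (ger0_norm (sqr_ge0 L)).
  by rewrite ler_wpM2l ?sqr_ge0.
have cq : continuous (fun s => L ^+ 2 * c s).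
  by move=> s; apply: cvgM; [exact: cvg_cst|exact: coef_continuous cd s].
have q0 s : s <= 0 -> L ^+ 2 * c s = 0 by move=> s0; rewrite coef_le0 ?mulr0.
have [w [dw [w0 dw0 Hw Hdw]]] := ode_initial_data (t k.+1) 0 (res_dsol x (t k.+1)) cq q0 qM.
exists w, dw.
have H s : s \in `[t k.+1, 2 * t k.+1] -> w s = res_sol x s /\ dw s = res_dsol x s.
  rewrite in_itv/= => /andP[ks sk].
  apply: (@ode_unique R (fun s => L ^+ 2 * c s) _ _ _ _ _ (t k.+1) s ks
    (fun y _ => qM y) (fun y _ => Hw y) (fun y _ => Hdw y)
    (fun y _ => derive_res_sol x y)) => //.
  - move=> y; rewrite in_itv/= => /andP[ky ys].
    rewrite (coef_osc cd (k := k)) ?in_itv/= ?ky ?(le_trans ys)//.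
    by rewrite mulrA [L ^+ 2 * _]mulrC -lam_sig; exact: derive_res_dsol.
  - by rewrite w0 /res_sol (cd_sin cd) mul0r.
by split => // s /H[].
Qed.

Lemma modes : exists (x dx : nat -> R -> R), forall k,
  [/\ forall s, has_deriv (x k) s (dx k s),
      forall s, has_deriv (dx k) s (- (lam k.+1 ^+ 2 * c s) * x k s),
      forall s, 0 <= s -> s <= 1 ->
        lam k.+1 * (lam k.+1 ^+ 2 * x k s ^+ 2 + dx k s ^+ 2) <= 8 / 2 ^+ k,
      lam k.+1 * (lam k.+1 ^+ 2 * x k 0 ^+ 2 + dx k 0 ^+ 2) *
        expR (k%:R * phi (lam k.+1)) <= 8 / 2 ^+ k &
    (forall s, 2 * t k.+1 <= s -> s <= 1 ->
        k%:R <= lam k.+1 ^+ 2 * (lam k.+1 ^+ 2 * x k s ^+ 2 + dx k s ^+ 2)) /\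
      2 ^+ k / (3 * (4 ^+ k * expR (2 * phase_sum t sig k))) <=
        lam k.+1 ^+ 3 * x k (2 * t k.+1 - pi / (2 * sig k.+1)) ^+ 2].
Proof.
suff : forall k, exists xdx : (R -> R) * (R -> R), let x := xdx.1 in let dx := xdx.2 in
  [/\ forall s, has_deriv x s (dx s),
      forall s, has_deriv dx s (- (lam k.+1 ^+ 2 * c s) * x s),
      forall s, 0 <= s -> s <= 1 ->
        lam k.+1 * (lam k.+1 ^+ 2 * x s ^+ 2 + dx s ^+ 2) <= 8 / 2 ^+ k,
      lam k.+1 * (lam k.+1 ^+ 2 * x 0 ^+ 2 + dx 0 ^+ 2) *
        expR (k%:R * phi (lam k.+1)) <= 8 / 2 ^+ k &
    (forall s, 2 * t k.+1 <= s -> s <= 1 ->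
        k%:R <= lam k.+1 ^+ 2 * (lam k.+1 ^+ 2 * x s ^+ 2 + dx s ^+ 2)) /\
      2 ^+ k / (3 * (4 ^+ k * expR (2 * phase_sum t sig k))) <=
        lam k.+1 ^+ 3 * x (2 * t k.+1 - pi / (2 * sig k.+1)) ^+ 2].
  move=> /choice[f fP]; exists (fun k => (f k).1), (fun k => (f k).2) => k.
  exact: fP.
move=> k.
have [w [dw [Hw Hdw wE dwE]]] := raw_mode k.
have T0 := cd_t_gt0 cd k.+1; have x0 := cd_sig_gt0 cd k.
have d0 := cd_del_gt0 cd k.+1; have d1 := del_le1 cd k.+1.
have sT := cd_sin cd k; have L1 := lam_ge1 k.+1.
have tL := lam_t k.+1; have Ldx := lam_sig k; have Llow := lam_low k; have Lphi := lam_phi k.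
have phi0 : 1 <= expR (k%:R * phi (lam k.+1)).
  by rewrite -expR0 ler_expR mulr_ge0// phi_ge0// (le_trans ler01).
have K1 : 1 <= expR (2 * phase_sum t sig k).
  by rewrite -expR0 ler_expR mulr_ge0//; exact: phase_sum_ge0 cd k.
have T1 := t_le1 cd k.
have step := cd_t_step cd k.
have back := @mode_backward _ _ _ _ _ cd (lam k.+1) w dw Hw Hdw k.
have forw := @mode_forward _ _ _ _ _ cd (lam k.+1) w dw Hw Hdw k.
have pix := phase_ge_pi x0 T0 sT.
have tauv := res_sol_sqr sT x0.
set K := expR (2 * phase_sum t sig k) in K1 Llow forw *.
set L := lam k.+1 in L1 tL Ldx Llow Lphi phi0 Hdw back forw *.
set x := sig k.+1 in x0 sT Ldx Llow Lphi wE dwE pix tauv *.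
set T := t k.+1 in T0 sT tL Lphi wE dwE step back forw pix tauv *.
set d := del k.+1 in d0 d1 Ldx forw *.
set P := expR (k%:R * _) in phi0 Lphi *.
set Ee := expR (x * T / 8) in Lphi tauv.
have Ee0 : 0 < Ee := expR_gt0 _.
have TI : T \in `[T, 2 * T] by rewrite in_itv/= lexx/=; lra.
have TTI : 2 * T \in `[T, 2 * T] by rewrite in_itv/= lexx andbT; lra.
have s2T : sin (x * (2 * T)) = 0.
  by rewrite mulrCA mulr_natl mulr2n sinD sT mul0r mulr0 addr0.
have wT : w T = 0 by rewrite wE// /res_sol sT mul0r.
have w2T : w (2 * T) = 0 by rewrite wE// /res_sol s2T mul0r.
have dwT : dw T ^+ 2 = x ^+ 2 * Ee by rewrite dwE// res_dsol_sqr.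
have dw2T : dw (2 * T) ^+ 2 = x ^+ 2 * Ee ^+ 2.
  by rewrite dwE// res_dsol_sqr// /Ee -expRM_natl; congr (_ * expR _); field.
have L0 : 0 < L by apply: lt_le_trans L1.
have K0 : 0 < K by apply: lt_le_trans K1.
have p0 : 0 < 2 ^+ k :> R by rewrite exprn_gt0.
pose p := 2 ^+ k : R; rewrite -/p in p0 *.
(* Square of the amplitude. The raw energy never exceeds [8 * L ^+ 2 * Ee ^+ 2 * K], so this value
   turns [L] times the energy into [8 / p]. *)
pose a2 := (p * L ^+ 3 * K * Ee ^+ 2)^-1.
have D0 : 0 < p * L ^+ 3 * K * Ee ^+ 2 by rewrite !mulr_gt0 ?exprn_gt0.
have a20 : 0 <= a2 by rewrite invr_ge0 ltW.
pose a := Num.sqrt a2.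
have aE : a ^+ 2 = a2 by rewrite sqr_sqrtr.
have UE s : L ^+ 2 * (a * w s) ^+ 2 + (a * dw s) ^+ 2 =
    a2 * (L ^+ 2 * w s ^+ 2 + dw s ^+ 2) by rewrite -aE; ring.
have dL : x ^+ 2 / d = L ^+ 2 by rewrite Ldx mulrC mulKf// gt_eqF.
(* Before the block the energy carries one factor [Ee] against two in [a2]. The spare one absorbs
   [x ^+ 2 * P], that is, the Gevrey weight. *)
have early s : 0 <= s -> s <= T ->
    L * (a2 * (L ^+ 2 * w s ^+ 2 + dw s ^+ 2)) * P <= 8 / p.
  move=> s0 sle; have h := back s s0 sle wT L1 tL; rewrite dwT in h.
  apply: (@le_trans _ _ (L * (a2 * (8 * L ^+ 2 * (x ^+ 2 * Ee))) * P)).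
    rewrite ler_wpM2r ?expR_ge0// ler_wpM2l ?(ltW L0)// ler_wpM2l//.
  have -> : L * (a2 * (8 * L ^+ 2 * (x ^+ 2 * Ee))) * P = 8 / p * (x ^+ 2 * P / (K * Ee)).
    by rewrite /a2; field; rewrite !gt_eqF.
  rewrite ler_piMr ?divr_ge0 ?(ltW p0)// ler_pdivrMr ?mulr_gt0// mul1r.
  by apply: le_trans Lphi _; rewrite ler_peMl// ltW.
exists (fun s => a * w s, fun s => a * dw s); split => /=.
- by move=> s; exact: derive_fscale.
- move=> s; apply: has_deriv_eq; first by apply: derive_fscale; exact: Hdw.
  by rewrite /=; ring.
- move=> s s0 s1; rewrite UE.
  have [sle|/ltW Tle] := leP s T.
    apply: le_trans (early s s0 sle).
    rewrite ler_peMr// mulr_ge0 ?(ltW L0)// mulr_ge0// addr_ge0 ?sqr_ge0//.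
    by rewrite mulr_ge0 ?sqr_ge0.
  apply: (@le_trans _ _ (L * (a2 * (8 * L ^+ 2 * Ee ^+ 2 * K)))); last first.
    have -> // : L * (a2 * (8 * L ^+ 2 * Ee ^+ 2 * K)) = 8 / p.
    by rewrite /a2; field; rewrite !gt_eqF.
  rewrite ler_wpM2l ?(ltW L0)// ler_wpM2l//.
  have LE0 : 0 <= L ^+ 2 * Ee ^+ 2 by rewrite mulr_ge0 ?sqr_ge0.
  have [sle|/ltW sge] := leP s (2 * T).
    have sI : s \in `[T, 2 * T] by rewrite in_itv/= Tle.
    rewrite (wE _ sI) (dwE _ sI).
    have := res_sol_bound (ltW x0) s0.
    have eS : expR (x * s / 8) <= Ee ^+ 2.
      rewrite /Ee -expRM_natl ler_expR.
      have : x * s <= x * (2 * T) by rewrite ler_wpM2l// ltW.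
      lra.
    set rs := res_sol x s ^+ 2; set rd := res_dsol x s ^+ 2 => h.
    have {h} h : x ^+ 2 * rs + rd <= 7 * x ^+ 2 * Ee ^+ 2.
      by apply: le_trans h _; rewrite ler_wpM2l// mulr_ge0// sqr_ge0.
    have rd0 : 0 <= rd by rewrite sqr_ge0.
    have h2 : L ^+ 2 * rs + rd <= 7 * L ^+ 2 * Ee ^+ 2.
      apply: (@le_trans _ _ ((x ^+ 2 * rs + rd) / d)).
        have -> : (x ^+ 2 * rs + rd) / d = x ^+ 2 / d * rs + rd / d.
          by field; rewrite gt_eqF.
        by rewrite dL lerD2l ler_pdivlMr// ler_piMr.
      rewrite ler_pdivrMr//.
      by have -> : 7 * L ^+ 2 * Ee ^+ 2 * d = 7 * x ^+ 2 * Ee ^+ 2 by rewrite Ldx; ring.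
    apply: le_trans h2 _.
    have : L ^+ 2 * Ee ^+ 2 <= L ^+ 2 * Ee ^+ 2 * K by rewrite ler_peMr.
    by move: LE0; lra.
  have [_] := forw s sge s1 w2T; rewrite dw2T.
  have -> : x ^+ 2 * Ee ^+ 2 / d = L ^+ 2 * Ee ^+ 2 by rewrite -dL; ring.
  have : 0 <= L ^+ 2 * Ee ^+ 2 * K by rewrite mulr_ge0// ltW.
  lra.
- by rewrite UE early// ltW.
- split=> [s sge s1|].
    rewrite UE; have [+ _] := forw s sge s1 w2T; rewrite dw2T.
    rewrite expRN -/K => h.
    (* What remains is of order [x ^+ 2 / L], divided by [p * K ^+ 2]: exactly what [lam_low] makes
       large. *)
    apply: (@le_trans _ _ (L ^+ 2 * (a2 * (2 / 3 * (x ^+ 2 * Ee ^+ 2) / K)))).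
      have -> : L ^+ 2 * (a2 * (2 / 3 * (x ^+ 2 * Ee ^+ 2) / K)) =
        2 / 3 * x ^+ 2 / (p * L * K ^+ 2).
        by rewrite /a2; field; rewrite !gt_eqF.
      rewrite ler_pdivlMr ?mulr_gt0 ?exprn_gt0//.
      have : 0 <= k%:R * (p * L * K ^+ 2).
        by rewrite !mulr_ge0 ?sqr_ge0// ltW.
      by move: Llow; rewrite -/p; lra.
    by rewrite ler_wpM2l ?sqr_ge0// ler_wpM2l.
  set tau := 2 * T - _.
  have tauI : tau \in `[T, 2 * T].
    have h : pi / (2 * x) = (pi / x) / 2 by field; rewrite gt_eqF.
    have : 0 <= pi / x by rewrite divr_ge0 ?pi_ge0// ltW.
    by rewrite in_itv/= /tau h; lra.
  rewrite wE// exprMn aE.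
  (* The powers of [L] cancel, leaving [3 / 4 / (p * K)]. It is rewritten over [4 ^+ k * K], the
     quantity that [L] dominates to the power [k.+1], so that a factor [2 ^+ k] is left in the
     numerator. *)
  apply: (@le_trans _ _ (L ^+ 3 * (a2 * (3 / 4 * Ee ^+ 2)))); last first.
    by rewrite ler_wpM2l ?exprn_ge0 ?(ltW L0)// ler_wpM2l.
  have -> : L ^+ 3 * (a2 * (3 / 4 * Ee ^+ 2)) = 3 / 4 / (p * K).
    by rewrite /a2; field; rewrite !gt_eqF.
  have -> : 4 ^+ k = p * p :> R by rewrite -exprMn; congr (_ ^+ _); ring.
  have -> : p / (3 * (p * p * K)) = 1 / 3 / (p * K) by field; rewrite !gt_eqF.
  by rewrite ler_wpM2r ?invr_ge0 ?mulr_ge0 ?(ltW p0) ?(ltW K0)//; lra.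
Qed.

End Modes.

(** * Spectral measures and powers *)

Section InnerProduct.
Context {R : realType} {H : completeNormedModType R} (ip : hilbert_dot H).
Implicit Types (x y z : H) (a : R).

Lemma ipC x y : ip x y = ip y x.
Proof. by rewrite hermC/= expr0 mul1r. Qed.

Lemma ipDl x y z : ip (x + y) z = ip x z + ip y z.
Proof. exact: linearDl. Qed.

Lemma ipDr x y z : ip x (y + z) = ip x y + ip x z.
Proof. exact: linearDr. Qed.

Lemma ipZl a x y : ip (a *: x) y = a * ip x y.
Proof. exact: linearZl_LR. Qed.

Lemma ipZr a x y : ip x (a *: y) = a * ip x y.
Proof. by rewrite ipC ipZl ipC. Qed.

Lemma ip0l x : ip 0 x = 0. Proof. exact: linear0l. Qed.

Lemma ip0r x : ip x 0 = 0. Proof. by rewrite ipC ip0l. Qed.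

Lemma ipNl x y : ip (- x) y = - ip x y. Proof. by rewrite -scaleN1r ipZl mulN1r. Qed.

Lemma ipNr x y : ip x (- y) = - ip x y. Proof. by rewrite ipC ipNl ipC. Qed.

Lemma ipBl x y z : ip (x - y) z = ip x z - ip y z.
Proof. by rewrite ipDl ipNl. Qed.

Lemma ipBr x y z : ip x (y - z) = ip x y - ip x z.
Proof. by rewrite ipDr ipNr. Qed.

Lemma ip_suml (I : Type) (r : seq I) (F : I -> H) y :
  ip (\sum_(i <- r) F i) y = \sum_(i <- r) ip (F i) y.
Proof. exact: (big_morph (fun x => ip x y) (fun x x' => ipDl x x' y) (ip0l y)). Qed.

Lemma ip_sumr (I : Type) (r : seq I) (F : I -> H) y :
  ip y (\sum_(i <- r) F i) = \sum_(i <- r) ip y (F i).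
Proof. by rewrite ipC ip_suml; apply: eq_bigr => i _; rewrite ipC. Qed.

Lemma normD_sqr x y : `|x + y| ^+ 2 = `|x| ^+ 2 + 2 * ip x y + `|y| ^+ 2.
Proof. by rewrite -!(dot_norm ip) ipDl !ipDr (ipC y x); ring. Qed.

Lemma normB_sqr x y : `|x - y| ^+ 2 = `|x| ^+ 2 - 2 * ip x y + `|y| ^+ 2.
Proof. by rewrite normD_sqr ipNr normrN; ring. Qed.

Lemma ip_le x y : `|ip x y| <= `|x| * `|y|.
Proof.
rewrite -[`|x| * `|y|]ger0_norm ?mulr_ge0// -ler_sqr ?nnegrE// -!normrX.
rewrite !ger0_norm ?sqr_ge0// exprMn -!(dot_norm ip).
have [->|y0] := eqVneq y 0; first by rewrite !ip0r expr0n/= mulr0.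
have yy : 0 < ip y y by rewrite dot_norm exprn_gt0// normr_gt0.
rewrite -subr_ge0 -(pmulr_lge0 _ yy).
have -> : (ip x x * ip y y - ip x y ^+ 2) * ip y y =
    `|ip y y *: x - ip x y *: y| ^+ 2.
  by rewrite -(dot_norm ip) ipBl !ipBr !ipZl !ipZr (ipC y x); ring.
exact: sqr_ge0.
Qed.

Lemma ip_cvg (I : Type) (F : set_system I) {FF : Filter F} (u : I -> H) x y :
  u @ F --> x -> (fun t => ip (u t) y) @ F --> ip x y.
Proof.
move=> ux; apply/cvgrPdist_lt => e e0.
have e1 : 0 < e / (`|y| + 1) by rewrite divr_gt0// ltr_wpDl.
near=> t.
rewrite -ipBl; apply: le_lt_trans (ip_le _ _) _.
have h : `|x - u t| < e / (`|y| + 1) by near: t; exact: cvgr_dist_lt.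
apply: (@le_lt_trans _ _ (`|x - u t| * (`|y| + 1))).
  by rewrite ler_wpM2l// lerDl.
by rewrite -ltr_pdivlMr// ltr_wpDl.
Unshelve. all: by end_near. Qed.

End InnerProduct.

Section SpectralMeasure.
Context {R : realType} {H : completeNormedModType R} {ip : hilbert_dot H}.
Variable E : spectral_measure ip.
Local Notation T := (measurableTypeR R).
Implicit Types (x y z : H) (B C : set T).
Local Notation D := (`[0%R, +oo[%classic : set T).

Lemma projD B x y : measurable B -> E B (x + y) = E B x + E B y.
Proof. by move=> mB; have := proj_linear E mB 1 x y; rewrite !scale1r. Qed.

Lemma proj0 B : measurable B -> E B 0 = 0.
Proof.
move=> mB; have := projD 0 0 mB; rewrite addr0 => /eqP.
by rewrite -subr_eq0 opprD addrA subrr sub0r oppr_eq0 => /eqP.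
Qed.

Lemma projZ B a x : measurable B -> E B (a *: x) = a *: E B x.
Proof. by move=> mB; have := proj_linear E mB a x 0; rewrite !addr0 proj0// addr0. Qed.

Lemma projN B x : measurable B -> E B (- x) = - E B x.
Proof. by move=> mB; rewrite -scaleN1r projZ// scaleN1r. Qed.

Lemma projB B x y : measurable B -> E B (x - y) = E B x - E B y.
Proof. by move=> mB; rewrite projD// projN. Qed.

Lemma ip_proj_cap B C x y : measurable B -> measurable C ->
  ip (E B x) (E C y) = ip (E (B `&` C) x) y.
Proof. by move=> mB mC; rewrite -proj_sym// setIC proj_cap. Qed.

Lemma ip_projl B x y : measurable B -> ip (E B x) (E B y) = ip (E B x) y.
Proof. by move=> mB; rewrite ip_proj_cap// setIid. Qed.

Lemma proj_norm B x : measurable B -> `|E B x| ^+ 2 = ip (E B x) x.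
Proof. by move=> mB; rewrite -(dot_norm ip) ip_projl. Qed.

Lemma proj_le B x : measurable B -> `|E B x| <= `|x|.
Proof.
move=> mB; have [->|E0] := eqVneq (E B x) 0; first by rewrite normr0.
rewrite -(@ler_pM2l _ `|E B x|) ?normr_gt0// -expr2 proj_norm//.
exact: le_trans (ler_norm _) (ip_le _ _ _).
Qed.

Lemma proj_cvg (I : Type) (F : set_system I) {FF : Filter F} (u : I -> H) x B :
  measurable B -> u @ F --> x -> (fun t => E B (u t)) @ F --> E B x.
Proof.
move=> mB ux; apply/cvgrPdist_lt => e e0; near=> t.
rewrite -projB//; apply: le_lt_trans (proj_le _ mB) _.
by near: t; exact: cvgr_dist_lt.
Unshelve. all: by end_near. Qed.

Lemma proj_setU B C x : measurable B -> measurable C -> B `&` C = set0 ->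
  `|E (B `|` C) x| ^+ 2 = `|E B x| ^+ 2 + `|E C x| ^+ 2.
Proof.
move=> mB mC BC; apply: EFin_inj; rewrite EFinD.
have := @measureU _ _ _ (scalar_measure E x) B C mB mC BC.
by rewrite /scalar_measure.
Qed.

Lemma proj_supset B x : measurable B -> D `<=` B -> E B x = x.
Proof.
move=> mB DB; rewrite -{1}(proj_nonneg E x) -proj_cap//.
by rewrite setIC (setIidl DB) proj_nonneg.
Qed.

Lemma projT x : E setT x = x.
Proof. exact: proj_supset. Qed.

Lemma proj_setC_orth B x : measurable B -> `|x| ^+ 2 = `|E B x| ^+ 2 + `|E (~` B) x| ^+ 2.
Proof.
move=> mB; rewrite -proj_setU//; last by rewrite setICr.
  by rewrite setUv projT.
exact: measurableC.
Qed.

Definition si (D : set T) (f : T -> \bar R) x : \bar R :=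
  (\int[scalar_measure E x]_(s in D) f s)%E.

(** Orthogonality is asked at every spectral level: the cross term on [B] is [2 * ip (E B x) y]. *)
Lemma scalar_measureD x y : (forall B, measurable B -> ip (E B x) y = 0) ->
  forall B, measurable B ->
  scalar_measure E (x + y) B =
  measure_add (scalar_measure E x) (scalar_measure E y) B.
Proof.
move=> xy B mB; rewrite measure_addE /scalar_measure -EFinD projD//.
by rewrite (normD_sqr ip) ip_projl// xy// mulr0 addr0.
Qed.

Lemma si_orthD (A : set T) (f : T -> \bar R) x y :
  measurable A -> (forall s, A s -> (0 <= f s)%E) -> measurable_fun A f ->
  (forall B, measurable B -> ip (E B x) y = 0) ->
  si A f (x + y) = (si A f x + si A f y)%E.
Proof.
move=> mA f0 mf xy; rewrite /si -ge0_integral_measure_add//.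
by apply: eq_measure_integral => B mB _; exact: scalar_measureD.
Qed.

Lemma siZ (A : set T) (f : T -> \bar R) (a : R) x :
  measurable A -> (forall s, A s -> (0 <= f s)%E) -> measurable_fun A f ->
  si A f (a *: x) = ((a ^+ 2)%:E * si A f x)%E.
Proof.
move=> mA f0 mf; have a2 : 0 <= a ^+ 2 by rewrite sqr_ge0.
have := ge0_integral_mscale (scalar_measure E x) mA (NngNum a2) mf f0.
move=> /= <-; apply: eq_measure_integral => B mB _.
rewrite /mscale/= /scalar_measure projZ// normrZ exprMn EFinM.
by rewrite -normrX ger0_norm ?sqr_ge0.
Qed.

Lemma siN (A : set T) (f : T -> \bar R) x :
  si A f (- x) = si A f x.
Proof.
apply: eq_measure_integral => B mB _.
by rewrite /= /scalar_measure projN// normrN.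
Qed.

Lemma si_parallelogram (A : set T) (f : T -> \bar R) x y :
  measurable A -> (forall s, A s -> (0 <= f s)%E) -> measurable_fun A f ->
  (si A f (x + y)%R + si A f (x - y)%R = 2%:E * si A f x + 2%:E * si A f y)%E.
Proof.
move=> mA f0 mf; rewrite /si.
have two0 : (0 : R) <= 2 by [].
have h z := ge0_integral_mscale (scalar_measure E z) mA (NngNum two0) mf f0.
rewrite /= in h; rewrite -!h -!ge0_integral_measure_add//.
apply: eq_measure_integral => B mB _.
rewrite -[LHS]/(measure_add _ _ B) -[RHS]/(measure_add _ _ B) !measure_addE.
rewrite /= /mscale/= /scalar_measure -!EFinM -!EFinD.
rewrite projD// projB// (normD_sqr ip) (normB_sqr ip); congr _%:E; ring.
Qed.

(** The scalar measure of [E B x] is that of [x] restricted to [B], so only the part of [A] inside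
    [B] contributes. *)
Lemma si_proj (A B : set T) (f : T -> \bar R) x :
  measurable A -> measurable B ->
  (forall s, A s -> (0 <= f s)%E) -> measurable_fun A f ->
  si A f (E B x) = si (A `&` B) f x.
Proof.
move=> mA mB f0 mf; rewrite /si.
have mAB : measurable (A `&` B) by exact: measurableI.
have mAC : measurable (A `\` B) by exact: measurableD.
rewrite -[in LHS](setUIDK A B) ge0_integral_setU//; last 3 first.
- by rewrite setUIDK.
- by move=> s; rewrite setUIDK; exact: f0.
- apply/disj_setPS => s [[_ Bs] [_ nBs]]; exact: nBs.
rewrite [X in (_ + X)%E](_ : _ = 0%E) ?adde0.
  apply: eq_measure_integral => C mC CAB.
  rewrite /= /scalar_measure -proj_cap//; congr (`|E _ x| ^+ 2)%:E.
  by apply/setIidl => s /CAB[].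
rewrite (eq_measure_integral (mzero : measure _ _)) ?integral_measure_zero//.
move=> C mC CAB; rewrite /= /scalar_measure -proj_cap//.
rewrite (_ : C `&` B = set0) ?proj_set0 ?normr0 ?expr0n//.
by apply/seteqP; split => // s [/CAB[_ nBs] Bs]; exact: nBs.
Qed.

End SpectralMeasure.

Section Powers.
Context {R : realType} {H : completeNormedModType R} {ip : hilbert_dot H}.
Variable E : spectral_measure ip.
Local Notation T := (measurableTypeR R).
Implicit Types (x y z : H) (B C : set T).
Local Notation D := (`[0%R, +oo[%classic : set T).
Local Notation pw p := (fun s : T => (s `^ p)%:E).

Lemma measurable_pw (A : set T) (p : R) : measurable A -> measurable_fun A (pw p).
Proof.
move=> mA; apply/measurable_EFinP.
by apply: (@measurable_funS _ _ T R setT) => //; exact: measurable_powR.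
Qed.

Lemma pw_ge0 (A : set T) (p : R) s : A s -> (0 <= pw p s)%E.
Proof. by move=> _; rewrite lee_fin powR_ge0. Qed.

Lemma spectral_integralE (f : R -> R) x :
  spectral_integral E f x = si E D (fun s => (f s)%:E) x.
Proof. by []. Qed.

Lemma si_ge0 (A : set T) (f : T -> \bar R) x :
  (forall s, A s -> (0 <= f s)%E) -> (0 <= si E A f x)%E.
Proof. by move=> f0; apply: integral_ge0. Qed.

Lemma si_cst (A : set T) (r : R) x : measurable A ->
  si E A (cst r%:E) x = (r * `|E A x| ^+ 2)%:E.
Proof. by move=> mA; rewrite /si integral_cst// /= /scalar_measure -EFinM. Qed.

Lemma si_le (A : set T) (f g : T -> \bar R) x : measurable A ->
  measurable_fun A f -> measurable_fun A g -> (forall s, A s -> (0 <= f s)%E) ->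
  (forall s, A s -> (f s <= g s)%E) -> (si E A f x <= si E A g x)%E.
Proof. by move=> mA mf mg f0 fg; apply: ge0_le_integral. Qed.

Lemma powR_sqr (s p : R) : s `^ (2 * p) = (s `^ p) ^+ 2.
Proof. by rewrite mulrC powRrM powR_mulrn// powR_ge0. Qed.

(** From [s]^ b <= 1 + s [^ (2 * b)] and the finite mass of the scalar measure. This finiteness
    makes the [fine] in [pow_form] harmless. *)
Lemma si_pw_half x b : pow_dom E b x -> (si E D (pw b) x < +oo)%E.
Proof.
move=> bx; apply: (@le_lt_trans _ _ (si E D (fun s => cst 1%:E s + pw (2 * b) s)%E x)).
  apply: si_le => //.
  - exact: measurable_pw.
  - by apply: emeasurable_funD; [exact: measurable_cst|exact: measurable_pw].
  - by move=> *; rewrite lee_fin powR_ge0.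
  - move=> s _; rewrite -EFinD lee_fin powR_sqr.
    by have := sqr_ge0 (s `^ b - 1); have := powR_ge0 s b; nra.
rewrite /si ge0_integralD//.
- apply: lte_add_pinfty; last exact: bx.
  by have := si_cst 1 x (measurable_itv `[0%R, +oo[); rewrite /si => ->; exact: ltry.
- by move=> *; rewrite lee_fin powR_ge0.
- exact: measurable_pw.
Qed.

Lemma pow_dom_proj x b B : measurable B -> pow_dom E b x -> pow_dom E b (E B x).
Proof.
move=> mB bx; rewrite /pow_dom /= /pow_sqnorm spectral_integralE si_proj//.
- apply: le_lt_trans bx; apply: ge0_subset_integral; first exact: measurableI.
  + exact: measurable_itv.
  + exact: measurable_pw.
  + by move=> *; rewrite lee_fin powR_ge0.
  + exact: subIsetl.
- by move=> *; rewrite lee_fin powR_ge0.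
- exact: measurable_pw.
Qed.

Lemma pow_domD x y b : pow_dom E b x -> pow_dom E b y ->
  pow_dom E b (x + y) /\ pow_dom E b (x - y).
Proof.
move=> bx byy; have := si_parallelogram E x y (measurable_itv _) (@pw_ge0 D (2 * b))
  (measurable_pw (2 * b) (measurable_itv _)).
move=> h; have hlt : (2%:E * si E D (pw (2 * b)) x + 2%:E * si E D (pw (2 * b)) y < +oo)%E.
  by rewrite lte_add_pinfty// lte_mul_pinfty.
rewrite -h in hlt; split; apply: le_lt_trans hlt.
  by rewrite leeDl// si_ge0//; by move=> *; rewrite lee_fin powR_ge0.
by rewrite leeDr// si_ge0//; by move=> *; rewrite lee_fin powR_ge0.
Qed.

Lemma proj_orth x B C : measurable B -> measurable C ->
  ip (E C (E B x)) (x - E B x) = 0.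
Proof.
move=> mB mC; rewrite ipBr -proj_cap// ip_proj_cap//; last exact: measurableI.
by rewrite -setIA setIid subrr.
Qed.

(** With [x = x1 + x2] and [x1 = E B x], the two polarization terms belong to [2 x1 + x2] and [x2].
    The parts are orthogonal at every level, so the difference is four times the integral for
    [x1]. *)
Lemma pow_form_proj x b B : measurable B -> pow_dom E b x ->
  (pow_form E b x (E B x))%:E = si E D (pw b) (E B x).
Proof.
move=> mB bx; set x1 := E B x; set x2 := x - E B x.
have b1 := pow_dom_proj mB bx.
have b2 : pow_dom E b x2 by have [] := pow_domD bx b1.
have x12 C : measurable C -> ip (E C (2 *: x1)) x2 = 0.
  by move=> mC; rewrite projZ// ipZl proj_orth// mulr0.
have e1 : x + x1 = 2 *: x1 + x2 by rewrite /x2 -/x1 scaler_nat mulr2n addrACA subrr addr0 addrC.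
rewrite /pow_form !spectral_integralE e1 -/x2.
rewrite (si_orthD (measurable_itv _) (@pw_ge0 D b) (measurable_pw b (measurable_itv _)) x12).
rewrite (siZ E _ _ (measurable_itv _) (@pw_ge0 D b) (measurable_pw b (measurable_itv _))).
have f1 : si E D (pw b) x1 \is a fin_num.
  by rewrite ge0_fin_numE ?si_pw_half// si_ge0//; by move=> *; rewrite lee_fin powR_ge0.
have f2 : si E D (pw b) x2 \is a fin_num.
  by rewrite ge0_fin_numE ?si_pw_half// si_ge0//; by move=> *; rewrite lee_fin powR_ge0.
rewrite -[in RHS](fineK f1) -(fineK f1) -(fineK f2) -EFinM -EFinD/=; congr _%:E.
by field.
Qed.

Lemma pow_formC b x y : pow_form E b x y = pow_form E b y x.
Proof.
by rewrite /pow_form !spectral_integralE -(siN E _ _ (x - y)) opprB [x + y]addrC.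
Qed.

Section Eigenvector.
Variables (x : H) (m : R).
Hypothesis xm : is_pow E 1 x (m *: x).

(** The eigenvalue equation tested against [E B x]: on every [B] the mean of the spectral variable
    is [m], which rules out mass on either side of [m]. *)
Let eigen_si B : measurable B -> (m * `|E B x| ^+ 2)%:E = si E (D `&` B) (fun s => s%:E) x.
Proof.
move=> mB; have [x1 xP] := xm.
rewrite proj_norm// (ipC ip (E B x)) -ipZl xP; last exact: pow_dom_proj.
rewrite pow_form_proj// si_proj//.
- apply: eq_integral => s; rewrite inE/= in_itv/= andbT => -[s0 _].
  by rewrite powRr1.
- by move=> *; rewrite lee_fin powR_ge0.
- exact: measurable_pw.
Qed.

Let mid (A : set T) : measurable A -> measurable_fun A (fun s : T => s%:E).
Proof. by move=> mA; apply/measurable_EFinP; exact: measurable_id. Qed.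

Let eigen_above (r : R) : m < r -> E `[r, +oo[%classic x = 0.
Proof.
move=> mr; set B := (`[r, +oo[%classic : set T).
have mB : measurable B by exact: measurable_itv.
have mDB : measurable (D `&` B) by exact: measurableI.
have h := eigen_si mB.
(* The maximum keeps the constant nonnegative, and on [D] it is still a lower bound of [s]. *)
have : (si E (D `&` B) (cst (Num.max r 0)%:E) x <= (m * `|E B x| ^+ 2)%:E)%E.
  rewrite h; apply: si_le => //.
  - exact: mid.
  - by move=> s _; rewrite lee_fin le_max lexx orbT.
  - move=> s [/=]; rewrite /B /= !in_itv/= !andbT => s0 rs.
    by rewrite lee_fin ge_max rs.
rewrite si_cst// lee_fin proj_cap//.
rewrite proj_nonneg -subr_ge0 -mulrBl => h2.
apply/eqP; rewrite -normr_eq0 -sqrf_eq0.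
have : m - Num.max r 0 < 0 by rewrite subr_lt0 lt_max mr.
have := sqr_ge0 `|E B x|; rewrite le_eqVlt => /predU1P[<-//|n0 m0].
by move: h2; rewrite nmulr_rge0// leNgt n0.
Qed.

Let eigen_below (r : R) : r < m -> E `]-oo, r]%classic x = 0.
Proof.
move=> mr; set B := (`]-oo, r]%classic : set T).
have mB : measurable B by exact: measurable_itv.
have mDB : measurable (D `&` B) by exact: measurableI.
have h := eigen_si mB.
have [r0|r0] := ltP r 0.
  rewrite -[x](proj_nonneg E) -proj_cap//.
  rewrite (_ : B `&` D = set0) ?proj_set0//.
  by apply/seteqP; split => // s [/=]; rewrite /B /= !in_itv/= andbT; lra.
have : ((m * `|E B x| ^+ 2)%:E <= si E (D `&` B) (cst r%:E) x)%E.
  rewrite h; apply: si_le => //.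
  - exact: mid.
  - by move=> s [/=]; rewrite in_itv/= andbT lee_fin.
  - by move=> s [/= _]; rewrite /B /= in_itv/= lee_fin.
rewrite si_cst// lee_fin proj_cap//.
rewrite proj_nonneg -subr_ge0 -mulrBl => h2.
apply/eqP; rewrite -normr_eq0 -sqrf_eq0.
have := sqr_ge0 `|E B x|; rewrite le_eqVlt => /predU1P[<-//|n0].
by move: h2; rewrite nmulr_rge0 ?subr_lt0// leNgt n0.
Qed.

Let eigen_compl : E (~` [set m]) x = 0.
Proof.
pose F n : set T := `[m + n.+1%:R^-1, +oo[%classic `|` `]-oo, m - n.+1%:R^-1]%classic.
have mF n : measurable (F n) by apply: measurableU; exact: measurable_itv.
have FE : ~` [set m] = \bigcup_n F n.
  apply/seteqP; split => s /=.
    move=> /eqP sm; have d0 : 0 < `|s - m| by rewrite normr_gt0 subr_eq0.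
    have [n h] : exists n, n.+1%:R^-1 < `|s - m|.
      exists (Num.truncn `|s - m|^-1).
      by rewrite -[X in _ < X]invrK ltf_pV2 ?posrE ?invr_gt0// truncnS_gt.
    exists n => //; rewrite /F/= !in_itv/= andbT.
    have [sm'|sm'] := leP m s.
      by left; rewrite -lerBrDl ltW// -(ger0_norm (_ : 0 <= s - m)) ?subr_ge0.
    right; rewrite lerBrDl -lerBrDr -opprB ltW//.
    by rewrite -ler0_norm// subr_le0 ltW.
  move=> [n _]; rewrite /F/= !in_itv/= andbT.
  have : 0 < n.+1%:R^-1 :> R by rewrite invr_gt0.
  by move: n.+1%:R^-1 => r r0 [] h sm; move: h; rewrite sm; lra.
have : scalar_measure E x (~` [set m]) = 0%E.
  apply: (@measure_negligible _ _ _ (scalar_measure E x)).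
    by apply: measurableC; exact: measurable_set1.
  rewrite FE; apply: negligible_bigcup => n.
  exists (F n); split => //.
  apply/eqP; rewrite eq_le measure_ge0 andbT.
  have := @measureU2 _ _ _ (scalar_measure E x)
    `[m + n.+1%:R^-1, +oo[%classic `]-oo, m - n.+1%:R^-1]%classic.
  move=> h; apply: le_trans (h _ _) _; try exact: measurable_itv.
  rewrite /= /scalar_measure eigen_above ?eigen_below ?normr0 ?expr0n/= ?adde0//.
    by rewrite gtrBl invr_gt0.
  by rewrite ltrDl invr_gt0.
rewrite /scalar_measure => -[] /eqP; rewrite sqrf_eq0 normr_eq0 => /eqP.
by [].
Qed.

(** All the spectral mass of [x] sits at [m]. After this, the operator enters only through the
    action of [E] on the eigenvectors. *)
Lemma eigen_proj B : measurable B -> E B x = \1_B m *: x.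
Proof.
move=> mB.
have out C : measurable C -> ~ C m -> E C x = 0.
  move=> mC Cm; have mm : measurable (~` [set m] : set T) by apply: measurableC; exact: measurable_set1.
  rewrite (_ : C = C `&` ~` [set m]) ?proj_cap ?eigen_compl ?proj0//.
  by apply/esym/setIidl => s Cs /= sm; apply: Cm; rewrite -sm.
rewrite indicE; case: (boolP (m \in B)); rewrite ?notin_setE ?inE => mBm /=.
  rewrite scale1r; apply/eqP; rewrite eq_sym -subr_eq0 -normr_eq0 -sqrf_eq0.
  rewrite (normB_sqr ip) (ipC ip) -proj_norm// (proj_setC_orth E x mB).
  rewrite (out (~` B)) ?normr0 ?expr0n/=; last 2 first.
  - exact: measurableC.
  - by move=> /(_ mBm).
  by apply/eqP; ring.
by rewrite scale0r out.
Qed.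

End Eigenvector.

End Powers.

(** * Eigenfunction expansions *)

Section NonnegativeSeries.
Context {R : realType}.
Implicit Types (u : nat -> R) (l M : R).

Lemma real_cvg_unique u l l' : u @ \oo --> l -> u @ \oo --> l' -> l = l'.
Proof. by move=> ul ul'; rewrite -(cvg_lim _ ul)//; exact: cvg_lim. Qed.

Lemma nneseries_cvg u l : series u @ \oo --> l ->
  (\sum_(0 <= k <oo) (u k)%:E = l%:E)%E.
Proof.
move=> ul; apply: cvg_lim => //.
rewrite (_ : (fun n => _) = EFin \o series u); last first.
  by apply/funext => n; rewrite /= /series/= sumEFin.
by apply: cvg_EFin; [exact: nearW|exact: ul].
Qed.

Lemma nneseries_le u M : (forall k, 0 <= u k) ->
  (forall n, \sum_(0 <= k < n) u k <= M) ->
  (\sum_(0 <= k <oo) (u k)%:E <= M%:E)%E.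
Proof.
move=> u0 uM; apply: lime_le.
  by apply: is_cvg_nneseries => k _ _; rewrite lee_fin.
by apply: nearW => n; rewrite sumEFin lee_fin.
Qed.

Lemma bounded_series_cvg u M : (forall k, 0 <= u k) ->
  (forall n, \sum_(0 <= k < n) u k <= M) ->
  exists2 l, series u @ \oo --> l & forall n, \sum_(0 <= k < n) u k <= l.
Proof.
move=> u0 uM.
have nd : nondecreasing_seq (series u).
  by apply/nondecreasing_seqP => n; rewrite /series/= big_nat_recr//= lerDl.
have ub : has_ubound (range (series u)).
  by exists M => _ [n _ <-]; rewrite /series/=.
exists (lim (series u @ \oo)); first exact: nondecreasing_is_cvgn.
by move=> n; apply: nondecreasing_cvgn_le => //; exact: nondecreasing_is_cvgn.
Qed.

Lemma nneseries_partial_le u l : (forall k, 0 <= u k) ->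
  (\sum_(0 <= k <oo) (u k)%:E <= l%:E)%E -> forall n, \sum_(0 <= k < n) u k <= l.
Proof.
move=> u0 ul n; rewrite -lee_fin -sumEFin; apply: le_trans ul.
by apply: nneseries_lim_ge => i _ _; rewrite lee_fin.
Qed.

End NonnegativeSeries.

Section Synthesis.
Import HBNNSimple.
Context {R : realType} {H : completeNormedModType R} {ip : hilbert_dot H}.
Variable E : spectral_measure ip.
Local Notation T := (measurableTypeR R).
Implicit Types (x y z : H) (B C : set T) (a b : nat -> R).
Local Notation D := (`[0%R, +oo[%classic : set T).
Local Notation pw p := (fun s : T => (s `^ p)%:E).

Variables (f : nat -> H) (mu : nat -> R).
Hypothesis f_on : orthonormal_seq ip f.
Hypothesis mu_ge0 : forall k, 0 <= mu k.
Hypothesis f_eigen : forall k B, measurable B -> E B (f k) = \1_B (mu k) *: f k.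

Definition l2 a := exists M, forall n, \sum_(0 <= k < n) a k ^+ 2 <= M.

Definition partial a n := \sum_(0 <= k < n) a k *: f k.

Definition synth a : H := lim (partial a @ \oo).

Lemma l2_le a b : (forall k, a k ^+ 2 <= b k ^+ 2) -> l2 b -> l2 a.
Proof.
by move=> ab [M bM]; exists M => n; apply: le_trans (bM n); apply: ler_sum.
Qed.

Lemma l2D a b : l2 a -> l2 b -> l2 (fun k => a k + b k).
Proof.
move=> [M aM] [N bN]; exists (2 * M + 2 * N) => n.
apply: (@le_trans _ _ (2 * \sum_(0 <= k < n) a k ^+ 2 + 2 * \sum_(0 <= k < n) b k ^+ 2)).
  rewrite !mulr_sumr -big_split/=; apply: ler_sum => k _.
  by have := sqr_ge0 (a k - b k); nra.
by have := aM n; have := bN n; lra.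
Qed.

Lemma l2Z (c : R) a : l2 a -> l2 (fun k => c * a k).
Proof.
move=> [M aM]; exists (c ^+ 2 * M) => n.
under eq_bigr do rewrite exprMn.
by rewrite -mulr_sumr ler_wpM2l ?sqr_ge0.
Qed.

Lemma l2B a b : l2 a -> l2 b -> l2 (fun k => a k - b k).
Proof.
move=> la lb; have := l2D la (l2Z (-1) lb).
by under eq_fun do rewrite mulN1r.
Qed.

Let ip_partial_f a n k : ip (partial a n) (f k) = if (k < n)%N then a k else 0.
Proof.
rewrite /partial ip_suml.
under eq_bigr do rewrite ipZl f_on.
case: ifPn => kn.
  rewrite (@big_cat_nat _ _ _ k)//=; last exact: ltnW.
  rewrite [X in _ + X]big_ltn// eqxx mulr1 big_nat big1 ?add0r; last first.
    by move=> i /andP[_ ik]; rewrite ltn_eqF// mulr0.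
  rewrite big_nat big1 ?addr0// => i /andP[ki _].
  by rewrite gtn_eqF// mulr0.
rewrite big_nat big1// => i /andP[_ ik].
by rewrite ltn_eqF ?mulr0// (leq_trans ik)// leqNgt.
Qed.

Let partial_norm a n m : (n <= m)%N ->
  `|partial a m - partial a n| ^+ 2 =
  \sum_(0 <= k < m) a k ^+ 2 - \sum_(0 <= k < n) a k ^+ 2.
Proof.
elim: m => [|m IHm]; first by rewrite leqn0 => /eqP ->; rewrite !subrr normr0 expr0n.
rewrite leq_eqVlt => /predU1P[->|]; first by rewrite !subrr normr0 expr0n.
rewrite ltnS => nm; rewrite /partial !(big_nat_recr m)//= -/(partial a m) -/(partial a n).
rewrite addrAC (normD_sqr ip) IHm// ipZr ipBl !ip_partial_f ltnn.
rewrite ltnNge nm/= subrr mulr0 mulr0 addr0 normrZ exprMn.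
rewrite -(dot_norm ip (f m)) f_on eqxx mulr1 -normrX ger0_norm ?sqr_ge0//.
ring.
Qed.

Lemma synth_cvg a : l2 a -> partial a @ \oo --> synth a.
Proof.
move=> [M aM]; have [l al sl] := bounded_series_cvg (fun k => sqr_ge0 (a k)) aM.
have [||x ax _] := @cauchy_bound_cvg R H (partial a)
    (fun n => Num.sqrt (l - \sum_(0 <= k < n) a k ^+ 2)).
- have e : Num.sqrt (l - l) = 0 by rewrite subrr sqrtr0.
  rewrite -[X in _ --> X]e.
  apply: (cvg_comp (fun n => l - \sum_(0 <= k < n) a k ^+ 2) Num.sqrt); last first.
    exact: sqrt_continuous.
  by apply: cvgB; [exact: cvg_cst|exact: al].
- move=> n m nm; rewrite -[leLHS]ger0_norm// -sqrtr_sqr ler_wsqrtr//.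
  by rewrite partial_norm// lerD2r sl.
- by apply/cvg_ex; exists x.
Qed.

Lemma synth_unique a x : partial a @ \oo --> x -> synth a = x.
Proof. by move=> ax; apply: cvg_lim. Qed.

Lemma synthD a b : l2 a -> l2 b -> synth (fun k => a k + b k) = synth a + synth b.
Proof.
move=> la lb; apply: synth_unique.
rewrite (_ : partial _ = partial a \+ partial b).
  by apply: cvgD; exact: synth_cvg.
apply/funext => n; rewrite /partial /= -big_split/=; apply: eq_bigr => i _.
by rewrite scalerDl.
Qed.

Lemma synthZ (c : R) a : l2 a -> synth (fun k => c * a k) = c *: synth a.
Proof.
move=> la; apply: synth_unique.
rewrite (_ : partial _ = (fun n => c *: partial a n)).
  by apply: cvgZr; exact: synth_cvg.
apply/funext => n; rewrite /partial scaler_sumr; apply: eq_bigr => i _.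
by rewrite scalerA.
Qed.

Lemma synthB a b : l2 a -> l2 b -> synth (fun k => a k - b k) = synth a - synth b.
Proof.
move=> la lb; rewrite -scaleN1r -synthZ// -synthD//; last exact: l2Z.
by congr synth; apply/funext => k; rewrite mulN1r.
Qed.

Lemma ip_synth a y : l2 a ->
  series (fun k => a k * ip (f k) y) @ \oo --> ip (synth a) y.
Proof.
move=> la; have : (fun n => ip (partial a n) y) @ \oo --> ip (synth a) y.
  by apply: ip_cvg; exact: synth_cvg.
rewrite (_ : (fun n => ip (partial a n) y) = series (fun k => a k * ip (f k) y)).
  exact.
apply/funext => n; rewrite /partial ip_suml; apply: eq_bigr => i _.
by rewrite ipZl.
Qed.

Lemma ip_synth_f a k : l2 a -> ip (synth a) (f k) = a k.
Proof.
move=> la; have h : (fun n => ip (partial a n) (f k)) @ \oo --> ip (synth a) (f k).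
  by apply: ip_cvg; exact: synth_cvg.
apply: (real_cvg_unique h).
apply: cvg_near_cst; exists k.+1 => // n /= kn.
by rewrite ip_partial_f kn.
Qed.

Lemma norm_synth a : l2 a -> series (fun k => a k ^+ 2) @ \oo --> `|synth a| ^+ 2.
Proof.
move=> la; have h := ip_synth (y := synth a) la.
have e : (fun k => a k * ip (f k) (synth a)) = (fun k => a k ^+ 2).
  by apply/funext => k; rewrite (ipC ip) ip_synth_f// expr2.
by rewrite e in h; rewrite -(dot_norm ip).
Qed.

Lemma l2_indic a B : l2 a -> l2 (fun k => \1_B (mu k) * a k).
Proof.
apply: l2_le => k; rewrite exprMn indicE.
by case: (_ \in _); rewrite ?expr1n ?mul1r// expr0n/= mul0r sqr_ge0.
Qed.

Lemma proj_synth a B : measurable B -> l2 a ->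
  E B (synth a) = synth (fun k => \1_B (mu k) * a k).
Proof.
move=> mB la; apply/esym/synth_unique.
have : (fun n => E B (partial a n)) @ \oo --> E B (synth a).
  by apply: proj_cvg => //; exact: synth_cvg.
rewrite (_ : (fun n => E B (partial a n)) = partial (fun k => \1_B (mu k) * a k)).
  exact.
apply/funext => n; rewrite /partial.
rewrite (big_morph _ (fun x y => projD E x y mB) (proj0 E mB)).
by apply: eq_bigr => i _; rewrite projZ// f_eigen// scalerA mulrC.
Qed.

(** The scalar measure of [synth a] is the sum of the Dirac masses at [mu k] with weights
    [a k ^+ 2]. *)
Lemma si_synth (A : set T) (g : T -> \bar R) a : l2 a -> measurable A ->
  (forall k, A (mu k)) -> (forall s, A s -> (0 <= g s)%E) -> measurable_fun A g ->
  si E A g (synth a) = (\sum_(0 <= k <oo) ((a k ^+ 2)%:E * g (mu k)))%E.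
Proof.
move=> la mA Amu g0 mg.
have a2 k : 0 <= a k ^+ 2 by rewrite sqr_ge0.
pose m_ (k : nat) : {measure set T -> \bar R} := mscale (NngNum (a2 k)) (\d_(mu k : T)).
rewrite /si (eq_measure_integral (mseries m_ 0)) => [|B mB BA].
  rewrite ge0_integral_measure_series//; apply: eq_eseriesr => k _.
  rewrite ge0_integral_mscale//= integral_dirac//=.
  by rewrite diracE mem_set// mul1e.
rewrite /= /mseries /scalar_measure proj_synth//.
rewrite -(nneseries_cvg (norm_synth (l2_indic B la))).
apply: eq_eseriesr => k _; rewrite /m_ /= /mscale/= /dirac indicE.
by case: (_ \in _); rewrite ?mul1r ?mule1// mul0r expr0n/= mule0.
Qed.

Lemma pow_sqnorm_synth (b : R) a : l2 a ->
  pow_sqnorm E b (synth a) = (\sum_(0 <= k <oo) (mu k `^ (2 * b) * a k ^+ 2)%:E)%E.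
Proof.
move=> la; rewrite /pow_sqnorm spectral_integralE si_synth//.
- by apply: eq_eseriesr => k _; rewrite -EFinM mulrC.
- by move=> k; rewrite /= in_itv/= mu_ge0.
- by move=> *; rewrite lee_fin powR_ge0.
- exact: measurable_pw.
Qed.

(* [g] need not be measurable: the integral is then a lower integral, i.e. a
   supremum over simple functions below [g]. *)
Lemma spectral_integral_synth_le (g : R -> R) a (M : R) : l2 a ->
  (forall s, 0 <= s -> 0 <= g s) ->
  (forall n, \sum_(0 <= k < n) (a k ^+ 2 * g (mu k)) <= M) ->
  (spectral_integral E g (synth a) <= M%:E)%E.
Proof.
move=> la g0 gM; rewrite /spectral_integral ge0_integralE; last first.
  by move=> s /=; rewrite in_itv/= andbT lee_fin => /g0.
apply: ge_ereal_sup => _ [h /= hg <-].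
rewrite -integralT_nnsfun -/(si E setT _ _) si_synth//; last 2 first.
- by move=> s _; rewrite lee_fin; exact: fun_ge0.
- exact/measurable_EFinP/measurable_funP.
rewrite (@eq_eseriesr _ _ (fun k => (a k ^+ 2 * h (mu k))%:E)); last first.
  by move=> k _; rewrite EFinM.
apply: nneseries_le => [k|n].
  by rewrite mulr_ge0 ?sqr_ge0//; exact: fun_ge0.
apply: le_trans (gM n); apply: ler_sum => k _.
rewrite ler_wpM2l ?sqr_ge0//; have := hg (mu k).
by rewrite patchE mem_set/= ?in_itv/= ?mu_ge0// lee_fin.
Qed.

Definition coords y k := ip (f k) y.

Lemma l2_coords y : l2 (coords y).
Proof.
exists (`|y| ^+ 2) => n; rewrite -subr_ge0.
have <- : `|y - partial (coords y) n| ^+ 2 =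
    `|y| ^+ 2 - \sum_(0 <= k < n) coords y k ^+ 2.
  rewrite (normB_sqr ip).
  have -> : ip y (partial (coords y) n) = \sum_(0 <= k < n) coords y k ^+ 2.
    rewrite /partial ip_sumr; apply: eq_bigr => k _.
    by rewrite ipZr (ipC ip) -expr2.
  have := @partial_norm (coords y) 0 n isT.
  by rewrite {2}/partial !big_nil !subr0 => ->; ring.
exact: sqr_ge0.
Qed.

Lemma synth_coords_orth a y : l2 a -> ip (synth a) (y - synth (coords y)) = 0.
Proof.
move=> la; have h := ip_synth (y := y - synth (coords y)) la.
apply: (real_cvg_unique h).
rewrite (_ : series _ = fun=> 0); first exact: cvg_cst.
apply/funext => n; rewrite /series/= big1// => k _.
by rewrite ipBr (ipC ip _ (synth _)) ip_synth_f ?subrr ?mulr0//; exact: l2_coords.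
Qed.

(** Spectral projections map the span into itself, so the residual of [y] is orthogonal to [synth a]
    at every spectral level. *)
Lemma si_synthD (A : set T) (g : T -> \bar R) a y : l2 a -> measurable A ->
  (forall s, A s -> (0 <= g s)%E) -> measurable_fun A g ->
  si E A g (synth a + (y - synth (coords y))) =
  (si E A g (synth a) + si E A g (y - synth (coords y))%R)%E.
Proof.
move=> la mA g0 mg; apply: si_orthD => // B mB.
by rewrite proj_synth// synth_coords_orth//; exact: l2_indic.
Qed.

Let pw_si_real (b : R) a (l : R) : l2 a -> si E D (pw b) (synth a) = l%:E ->
  series (fun k => mu k `^ b * a k ^+ 2) @ \oo --> l.
Proof.
move=> la; rewrite si_synth//; last 3 first.
- by move=> k; rewrite /= in_itv/= mu_ge0.
- by move=> *; rewrite lee_fin powR_ge0.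
- exact: measurable_pw.
rewrite (@eq_eseriesr _ _ (fun k => (mu k `^ b * a k ^+ 2)%:E)); last first.
  by move=> k _; rewrite -EFinM mulrC.
have t0 k : 0 <= mu k `^ b * a k ^+ 2 by rewrite mulr_ge0 ?powR_ge0 ?sqr_ge0.
move=> hl; have [|l' cl' _] := @bounded_series_cvg _ (fun k => mu k `^ b * a k ^+ 2) l t0.
  by apply: nneseries_partial_le => //; rewrite hl.
by have := nneseries_cvg cl'; rewrite hl => -[->].
Qed.

(** The component [y2] of [y] outside the span contributes the same finite amount to both
    polarization terms and cancels. On the span, polarization is done coefficient by coefficient. *)
Lemma pow_form_synth (b : R) a y : l2 a -> l2 (fun k => mu k `^ b * a k) ->
  pow_dom E b (synth a) -> pow_dom E b y ->
  pow_form E b (synth a) y = ip (synth (fun k => mu k `^ b * a k)) y.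
Proof.
move=> la lba ba bby.
have lc := l2_coords y.
have [bp bm] := pow_domD ba bby.
have mpw := measurable_pw b (measurable_itv `[0%R, +oo[).
have pw0 s : D s -> (0 <= pw b s)%E by move=> _; rewrite lee_fin powR_ge0.
set y2 := y - synth (coords y).
have ep : synth a + y = synth (fun k => a k + coords y k) + y2.
  by rewrite synthD// /y2 -addrA [synth (coords y) + _]addrC subrK.
have em : synth a - y = synth (fun k => a k - coords y k) - y2.
  by rewrite synthB// /y2 opprB addrA subrK.
have fin x : pow_dom E b x -> si E D (pw b) x \is a fin_num.
  by move=> bx; rewrite ge0_fin_numE ?si_pw_half//; exact: si_ge0.
have sp : si E D (pw b) (synth a + y) =
    (si E D (pw b) (synth (fun k => a k + coords y k)%R) + si E D (pw b) y2)%E.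
  by rewrite ep si_synthD//; exact: l2D.
have sm : si E D (pw b) (synth a - y) =
    (si E D (pw b) (synth (fun k => a k - coords y k)%R) + si E D (pw b) y2)%E.
  rewrite em si_orthD ?siN// => B mB.
  rewrite proj_synth//; last exact: l2B.
  by rewrite ipNr synth_coords_orth ?oppr0//; exact/l2_indic/l2B.
have := fin _ bp; rewrite sp fin_numD => /andP[fp f2].
have := fin _ bm; rewrite sm fin_numD => /andP[fm _].
have cp := pw_si_real (l2D la lc) (esym (fineK fp)).
have cm := pw_si_real (l2B la lc) (esym (fineK fm)).
rewrite /pow_form !spectral_integralE sp sm (fineD fp f2) (fineD fm f2).
rewrite opprD addrACA subrr addr0.
have h := ip_synth (y := y) lba.
apply/esym; apply: (real_cvg_unique h).
have -> : series (fun k => mu k `^ b * a k * ip (f k) y) =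
    (fun n => (series (fun k => mu k `^ b * (a k + coords y k) ^+ 2) n -
     series (fun k => mu k `^ b * (a k - coords y k) ^+ 2) n) * 4^-1).
  apply/funext => n; rewrite /series/= -sumrB mulr_suml; apply: eq_bigr => k _.
  by rewrite -/(coords y k); field.
by apply: cvgMl; apply: cvgB.
Qed.

Lemma l2_pow_dom (b : R) a : l2 a -> l2 (fun k => mu k `^ b * a k) -> pow_dom E b (synth a).
Proof.
move=> la [M bM]; rewrite /pow_dom/= pow_sqnorm_synth//.
apply: (@le_lt_trans _ _ M%:E); last exact: ltry.
apply: nneseries_le => [k|n]; first by rewrite mulr_ge0 ?powR_ge0 ?sqr_ge0.
by apply: le_trans (bM n); apply: ler_sum => k _; rewrite powR_sqr exprMn.
Qed.

Lemma is_pow_synth (b : R) a : l2 a -> l2 (fun k => mu k `^ b * a k) ->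
  is_pow E b (synth a) (synth (fun k => mu k `^ b * a k)).
Proof.
move=> la lba; have ba := l2_pow_dom la lba; split => // y bby.
by rewrite pow_form_synth.
Qed.

Lemma pow_sqnorm_synth_ge (b : R) a k : l2 a ->
  ((mu k `^ (2 * b) * a k ^+ 2)%:E <= pow_sqnorm E b (synth a))%E.
Proof.
move=> la; rewrite pow_sqnorm_synth//.
have t0 i : 0 <= mu i `^ (2 * b) * a i ^+ 2 by rewrite mulr_ge0 ?powR_ge0 ?sqr_ge0.
apply: (@le_trans _ _ (\sum_(0 <= i < k.+1) (mu i `^ (2 * b) * a i ^+ 2)%:E)%E).
  by rewrite big_nat_recr//= leeDr// sume_ge0// => i _; rewrite lee_fin.
by apply: nneseries_lim_ge => i _ _; rewrite lee_fin.
Qed.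

End Synthesis.

(** * Existence and uniqueness of fractional powers on their whole domain *)

Section FractionalPowers.
Context {R : realType} {H : completeNormedModType R} {ip : hilbert_dot H}.
Variable E : spectral_measure ip.
Local Notation T := (measurableTypeR R).
Implicit Types (x y z w : H) (B C : set T).
Local Notation D := (`[0%R, +oo[%classic : set T).
Local Notation pw p := (fun s : T => (s `^ p)%:E).

Import HBNNSimple.

(* [z = f(A) w] for a simple function [f]. *)
Inductive calculus w : (T -> R) -> H -> Prop :=
| calculus0 : calculus w (fun=> 0) 0
| calculusS f z c B : calculus w f z -> 0 <= c -> measurable B ->
    calculus w (fun s => f s + c * \1_B s) (z + c *: E B w).

Lemma calculus_ge0 w f z s : calculus w f z -> 0 <= f s.
Proof.
by move=> wf; elim: wf => // {}f {}z c B _ f0 c0 _; rewrite addr_ge0// mulr_ge0.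
Qed.

Lemma calculus_measurable w f z : calculus w f z -> measurable_fun setT f.
Proof.
elim=> [|{}f {}z c B _ mf c0 mB]; first exact: measurable_cst.
by apply: measurable_funD => //; apply: measurable_funM.
Qed.

Lemma siD (A : set T) (f g : T -> \bar R) x : measurable A ->
  (forall s, A s -> (0 <= f s)%E) -> measurable_fun A f ->
  (forall s, A s -> (0 <= g s)%E) -> measurable_fun A g ->
  si E A (fun s => f s + g s)%E x = (si E A f x + si E A g x)%E.
Proof. by move=> mA f0 mf g0 mg; rewrite /si ge0_integralD. Qed.

Lemma siZl (A : set T) (f : T -> \bar R) (c : R) x : measurable A -> 0 <= c ->
  (forall s, A s -> (0 <= f s)%E) -> measurable_fun A f ->
  si E A (fun s => c%:E * f s)%E x = (c%:E * si E A f x)%E.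
Proof. by move=> mA c0 f0 mf; rewrite /si ge0_integralZl. Qed.

Lemma si_add_indic (f : T -> R) (c : R) B x : measurable_fun setT f ->
  (forall s, 0 <= f s) -> 0 <= c -> measurable B ->
  si E D (fun s => (f s + c * \1_B s)%:E) x =
  (si E D (EFin \o f) x + (c * `|E B x| ^+ 2)%:E)%E.
Proof.
move=> mf f0 c0 mB.
have m1 : measurable_fun D (EFin \o f) by apply/measurable_EFinP; exact: measurable_funTS.
have m2 : measurable_fun D (EFin \o (\1_B : T -> R)) by apply/measurable_EFinP.
have p2 s : D s -> (0 <= (EFin \o (\1_B : T -> R)) s)%E by rewrite lee_fin.
rewrite (_ : (fun s => _) =
  fun s : T => ((EFin \o f) s + c%:E * (EFin \o (\1_B : T -> R)) s)%E); last first.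
  by apply/funext => s; rewrite /= -EFinM -EFinD.
rewrite siD//; last 3 first.
- by move=> s _; rewrite lee_fin.
- by move=> s _; rewrite /= -EFinM lee_fin mulr_ge0.
- exact: measurable_funeM.
rewrite siZl//; congr (_ + _)%E.
by rewrite /si integral_indic//= /scalar_measure proj_cap// proj_nonneg EFinM.
Qed.

(** Polarization for simple functions, written as a sum so that the induction meets no finiteness
    side condition in the extended reals. *)
Lemma calculus_polar w f z y : calculus w f z ->
  (si E D (EFin \o f) (w + y)%R =
   si E D (EFin \o f) (w - y)%R + (4 * ip z y)%:E)%E.
Proof.
elim=> [|{}f {}z c B wf IHf c0 mB].
  by rewrite ip0l mulr0 adde0 /si !integral0_eq.
have mf := calculus_measurable wf; have f0 s := calculus_ge0 s wf.
have hadd x : si E D (EFin \o (fun s => f s + c * \1_B s)) x =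
    (si E D (EFin \o f) x + (c * `|E B x| ^+ 2)%:E)%E := si_add_indic x mf f0 c0 mB.
rewrite !hadd IHf ipDl ipZl; move: (si E D _ _) => S.
rewrite -!addeA -!EFinD; congr (_ + _)%E; congr _%:E.
rewrite projD// projB// (normD_sqr ip) (normB_sqr ip) ip_projl//; ring.
Qed.

Lemma calculus_indic w f z B : calculus w f z -> measurable B ->
  si E D (fun s => (f s * \1_B s)%:E) w = (ip z (E B w))%:E.
Proof.
move=> + mB; elim=> [|{}f {}z c C wf IHf c0 mC].
  by rewrite ip0l /si integral0_eq// => s _; rewrite mul0r.
have mf := calculus_measurable wf; have f0 s := calculus_ge0 s wf.
have -> : (fun s => ((f s + c * \1_C s) * \1_B s)%:E) =
    (fun s : T => ((f s * \1_B s) + c * \1_(C `&` B) s)%:E).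
  by apply/funext => s; rewrite mulrDl -mulrA indicI.
rewrite (si_add_indic (f := fun s => f s * \1_B s))//.
- rewrite [in LHS]/comp IHf -EFinD ipDl ipZl ip_proj_cap//.
  by rewrite proj_norm//; exact: measurableI.
- by apply: measurable_funM.
- by move=> s; rewrite mulr_ge0.
- exact: measurableI.
Qed.

(** Multiplicativity of the calculus: inner products of approximants become integrals, which can be
    compared by monotonicity. *)
Lemma calculus_prod w f z g z' : calculus w f z -> calculus w g z' ->
  si E D (fun s => (f s * g s)%:E) w = (ip z z')%:E.
Proof.
move=> wf; have mf := calculus_measurable wf; have f0 s := calculus_ge0 s wf.
elim=> [|{}g {}z' c B wg IHg c0 mB].
  by rewrite ip0r /si integral0_eq// => s _; rewrite mulr0.
have mg := calculus_measurable wg; have g0 s := calculus_ge0 s wg.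
have -> : (fun s => (f s * (g s + c * \1_B s))%:E) =
    (fun s : T => ((f s * g s)%:E + c%:E * (f s * \1_B s)%:E)%E).
  by apply/funext => s; rewrite -EFinM -EFinD; congr _%:E; ring.
have fB0 s : 0 <= f s * \1_B s by rewrite mulr_ge0.
have mfB : measurable_fun D (fun s : T => (f s * \1_B s)%:E).
  by apply/measurable_EFinP; apply: measurable_funTS; apply: measurable_funM.
rewrite siD//.
- rewrite IHg siZl//; last by move=> s _; rewrite lee_fin.
  by rewrite (calculus_indic wf)// -EFinM -EFinD ipDr ipZr.
- by move=> s _; rewrite lee_fin mulr_ge0.
- by apply/measurable_EFinP; apply: measurable_funTS; apply: measurable_funM.
- by move=> s _; rewrite -EFinM lee_fin mulr_ge0.
- by apply: measurable_funeM.
Qed.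

Lemma calculus_nnsfun w (h : {nnsfun T >-> R}) : exists z, calculus w h z.
Proof.
have sum_calculus (r : seq R) : {in r, forall c, 0 <= c} ->
    exists z, calculus w (fun s => \sum_(c <- r) c * \1_(h @^-1` [set c]) s) z.
  elim: r => [|c r IHr] r0.
    exists 0; rewrite (_ : (fun s => _) = fun=> 0); first exact: calculus0.
    by apply/funext => s; rewrite big_nil.
  have [|z hz] := IHr; first by move=> d dr; apply: r0; rewrite inE dr orbT.
  exists (z + c *: E (h @^-1` [set c]) w).
  rewrite (_ : (fun s => _) = fun s => \sum_(c <- r) c * \1_(h @^-1` [set c]) s +
    c * \1_(h @^-1` [set c]) s).
    by apply: calculusS => //; apply: r0; rewrite inE eqxx.
  by apply/funext => s; rewrite big_cons addrC.
have [|z hz] := sum_calculus (finmap.enum_fset (fset_set (range h))).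
  move=> c; rewrite in_fset_set; last exact: fimfunP.
  by rewrite inE => -[s _ <-]; exact: fun_ge0.
exists z; suff <- : (fun s => \sum_(c <- finmap.enum_fset (fset_set (range h)))
    c * \1_(h @^-1` [set c]) s) = h :> (T -> R) by [].
apply/funext => s; rewrite [RHS]fimfunE fsbig_finite//; exact: fimfunP.
Qed.

(** The vector is the limit of [h n] applied to [w] in the calculus, for simple functions [h n]
    increasing to the power; monotone convergence carries [calculus_polar] to the limit. Arbitrary
    [w] are needed for the test vectors of [weak_solution], where [pow_op] would otherwise be the
    default 0. *)
Lemma is_pow_exists b w : pow_dom E b w -> exists z, is_pow E b w z.
Proof.
move=> bw.
have mg : measurable_fun D (pw b) := measurable_pw b (measurable_itv _).
pose h n := nnsfun_approx (measurable_itv `[0%R, +oo[ : measurable D) mg n.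
have g0 s : D s -> (0 <= pw b s)%E by move=> _; rewrite lee_fin powR_ge0.
have hcvg s : D s -> (h n s)%:E @[n --> \oo] --> pw b s.
  by move=> Ds; exact: cvg_nnsfun_approx.
have hnd s : nondecreasing_seq (h ^~ s).
  by move=> n m nm; have /lefP := @nd_nnsfun_approx _ T R D (measurable_itv _) _ mg n m nm; exact.
have hle n s : D s -> h n s <= s `^ b.
  move=> Ds; have /fine_cvgP[_ hc] := hcvg s Ds.
  have {}hc : h n s @[n --> \oo] --> s `^ b := hc.
  rewrite -(cvg_lim _ hc)//; apply: nondecreasing_cvgn_le; first exact: hnd.
  by apply/cvg_ex; exists (s `^ b).
have [z zP] := choice (fun n => calculus_nnsfun w (h n)).
pose In n := `|z n| ^+ 2.
have InE n m : si E D (fun s => (h n s * h m s)%:E) w = (ip (z n) (z m))%:E.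
  exact: calculus_prod.
have mh n m : measurable_fun D (fun s : T => (h n s * h m s)%:E).
  by apply/measurable_EFinP; apply: measurable_funTS; apply: measurable_funM.
(* Since [h m <= h n], the inner product of [z n] and [z m] is at least [In m]. As [In] is bounded
   and nondecreasing, [z] is Cauchy. *)
have step n m : (m <= n)%N -> `|z n - z m| ^+ 2 <= In n - In m.
  move=> mn; rewrite (normB_sqr ip) /In.
  have : `|z m| ^+ 2 <= ip (z n) (z m).
    rewrite -(dot_norm ip) -lee_fin -!InE; apply: si_le => //.
      by move=> s _; rewrite lee_fin mulr_ge0.
    by move=> s _; rewrite lee_fin ler_wpM2r//; exact: hnd.
  lra.
have InM n : In n <= fine (pow_sqnorm E b w).
  rewrite -lee_fin fineK; last first.
    by rewrite ge0_fin_numE//; apply: si_ge0 => s _; rewrite lee_fin powR_ge0.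
  rewrite /In -(dot_norm ip) -InE /pow_sqnorm spectral_integralE; apply: si_le => //.
  - exact: measurable_pw.
  - by move=> s _; rewrite lee_fin mulr_ge0.
  - move=> s Ds; rewrite lee_fin powR_sqr expr2.
    by apply: ler_pM; rewrite ?hle.
have Ind : nondecreasing_seq In.
  by move=> m n mn; have := step n m mn; have := sqr_ge0 `|z n - z m|; lra.
have Icvg : cvgn In.
  by apply: nondecreasing_is_cvgn => //; exists (fine (pow_sqnorm E b w)) => _ [n _ <-].
have [||zl zcvg _] := @cauchy_bound_cvg R H z
    (fun n => Num.sqrt (lim (In @ \oo) - In n)).
- have e : Num.sqrt (lim (In @ \oo) - lim (In @ \oo)) = 0 by rewrite subrr sqrtr0.
  rewrite -[X in _ --> X]e.
  apply: (cvg_comp (fun n => lim (In @ \oo) - In n) Num.sqrt); last exact: sqrt_continuous.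
  by apply: cvgB; [exact: cvg_cst|exact: Icvg].
- move=> n m nm; rewrite -[leLHS]ger0_norm// -sqrtr_sqr ler_wsqrtr//.
  apply: le_trans (step m n nm) _; rewrite lerD2r.
  exact: nondecreasing_cvgn_le.
exists zl; split => // y yb.
have [bp bm] := pow_domD bw yb.
have sicvg x : si E D (EFin \o h n) x @[n --> \oo] --> si E D (pw b) x.
  rewrite /si (eq_integral (fun s => limn (fun n => (h n s)%:E))); last first.
    by move=> s; rewrite inE => Ds; apply/esym/cvg_lim => //; exact: hcvg.
  apply: cvg_monotone_convergence => //.
  - by move=> n; apply/measurable_EFinP; exact: measurable_funTS.
  - by move=> n s _; rewrite lee_fin; exact: fun_ge0.
  - by move=> s _ n m nm; rewrite lee_fin; exact: hnd.
have fin x : pow_dom E b x -> si E D (pw b) x \is a fin_num.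
  by move=> bx; rewrite ge0_fin_numE ?si_pw_half//; exact: si_ge0.
have e : si E D (pw b) (w + y) = (si E D (pw b) (w - y)%R + (4 * ip zl y)%:E)%E.
  have c2 : ((si E D (EFin \o h n) (w - y)%R + (4 * ip (z n) y)%:E)%E) @[n --> \oo] -->
      (si E D (pw b) (w - y)%R + (4 * ip zl y)%:E)%E.
    apply: cvgeD; [exact: fin_num_adde_defl|exact: sicvg|].
    apply: cvg_EFin; first exact: nearW.
    by apply: cvgMr; apply: ip_cvg.
  have := sicvg (w + y).
  rewrite (_ : (fun n => si E D (EFin \o h n) (w + y)) =
    (fun n => si E D (EFin \o h n) (w - y)%R + (4 * ip (z n) y)%:E)%E); last first.
    by apply/funext => n; exact: calculus_polar.
  by move=> c1; rewrite -(cvg_lim _ c1)//; exact: cvg_lim.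
rewrite /pow_form !spectral_integralE e fineD ?fin//=.
by field.
Qed.

Lemma pow_dom_bounded b x (M : R) : 0 <= b -> 0 <= M ->
  pow_dom E b (E `[0, M]%classic x).
Proof.
move=> b0 M0; rewrite /pow_dom/= /pow_sqnorm spectral_integralE si_proj//; last 2 first.
- by move=> s _; rewrite lee_fin powR_ge0.
- exact: measurable_pw.
apply: (@le_lt_trans _ _ (si E (D `&` `[0, M]%classic) (cst (M `^ (2 * b))%:E) x)).
  apply: si_le => //.
  - exact: measurableI.
  - by apply: measurable_pw; exact: measurableI.
  - by move=> s _; rewrite lee_fin powR_ge0.
  - move=> s [_ /=]; rewrite in_itv/= => /andP[s0 sM].
    by rewrite lee_fin ge0_ler_powR ?nnegrE// mulr_ge0.
by rewrite si_cst ?ltry//; exact: measurableI.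
Qed.

(** The difference [d] may be tested against its own truncations to [[0, n]], which belong to every
    domain; so all truncations of [d] vanish. *)
Lemma is_pow_unique b x z z' : 0 <= b -> is_pow E b x z -> is_pow E b x z' -> z = z'.
Proof.
move=> b0 [_ xz] [_ xz']; set d := z - z'.
have d0 n : scalar_measure E d `[0%R, n%:R]%classic = 0%E.
  have bd := pow_dom_bounded d b0 (ler0n R n).
  have : ip d (E `[0%R, n%:R]%classic d) = 0 by rewrite {1}/d ipBl xz// xz'// subrr.
  by rewrite /scalar_measure proj_norm// (ipC ip) => ->.
have : scalar_measure E d D = 0%E.
  apply: (@measure_negligible _ _ _ (scalar_measure E d)) => //.
  rewrite (_ : D = \bigcup_n `[0%R, n%:R]%classic).
    by apply: negligible_bigcup => n; exists `[0%R, n%:R]%classic; split => //; exact: d0.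
  apply/seteqP; split => s /=; rewrite ?in_itv/=.
    rewrite andbT => s0; exists (Num.truncn s).+1 => //.
    by rewrite /= in_itv/= s0/= ltW// truncnS_gt.
  by move=> [n _]; rewrite /= in_itv/= andbT => /andP[].
rewrite /scalar_measure proj_nonneg => -[] /eqP.
by rewrite sqrf_eq0 normr_eq0 subr_eq0 => /eqP.
Qed.

Lemma pow_opP b x : pow_dom E b x -> is_pow E b x (pow_op E b x).
Proof.
move=> bx; have [z xz] := is_pow_exists bx.
by apply: (@xgetPex _ 0 [set z | is_pow E b x z]); exists z.
Qed.

Lemma pow_op_unique b x z : 0 <= b -> is_pow E b x z -> pow_op E b x = z.
Proof.
by move=> b0 xz; apply: (is_pow_unique b0 _ xz); apply: pow_opP; case: xz.
Qed.

Variables (f : nat -> H) (mu : nat -> R).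
Hypothesis f_on : orthonormal_seq ip f.
Hypothesis mu_ge0 : forall k, 0 <= mu k.
Hypothesis f_eigen : forall k B, measurable B -> E B (f k) = \1_B (mu k) *: f k.

(** By symmetry of [pow_form] the power moves onto [f k], which is treated as the synthesis of a
    one-term sequence. *)
Lemma coords_pow_op b w k : pow_dom E b w ->
  @coords R H ip f (pow_op E b w) k = mu k `^ b * @coords R H ip f w k.
Proof.
move=> bw.
have dl2 (r : R) : l2 (fun i => if i == k then r else 0).
  exists (r ^+ 2) => n; have [kn|nk] := ltnP k n.
    rewrite (bigD1_seq k) ?mem_index_iota ?iota_uniq//= eqxx big1 ?addr0//.
    by move=> i /negbTE ->; rewrite expr0n.
  rewrite big_nat big1 ?sqr_ge0// => i /andP[_ ik].
  by rewrite ltn_eqF ?expr0n// (leq_trans ik).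
have fE (r : R) : synth f (fun i => if i == k then r else 0) = r *: f k.
  apply: synth_unique; apply: cvg_near_cst; exists k.+1 => // n /= kn.
  rewrite /partial (bigD1_seq k) ?mem_index_iota ?iota_uniq//= eqxx big1 ?addr0//.
  by move=> i /negbTE ->; rewrite scale0r.
have mE : (fun i => mu i `^ b * (if i == k then 1 else 0)) =
    (fun i => if i == k then mu k `^ b else 0).
  by apply/funext => i; case: eqP => [->|_]; rewrite ?mulr1 ?mulr0.
have fP := is_pow_synth f_on mu_ge0 f_eigen (b := b) (dl2 1).
rewrite mE in fP; have {}fP := fP (dl2 _).
rewrite !fE scale1r in fP.
have [bf fb] := fP; have [_ wb] := pow_opP bw.
by rewrite /coords (ipC ip) (wb _ bf) pow_formC -(fb _ bw) ipZl.
Qed.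

End FractionalPowers.

(** * Dominated convergence for series, graph norms and dual norms *)

Section DominatedSeries.
Context {R : realType} {I : Type} (F : set_system I) {FF : Filter F}.

Lemma near_sum_le (u : I -> nat -> R) (n : nat) (e : R) : 0 < e ->
  (forall k, u ^~ k @ F --> 0) -> \forall i \near F, \sum_(0 <= k < n) u i k <= e.
Proof.
elim: n e => [|n IHn] e e0 u0.
  by apply: nearW => i; rewrite big_nil ltW.
have h1 := IHn (e / 2) (divr_gt0 e0 (ltr0Sn _ _)) u0.
have h2 : \forall i \near F, u i n <= e / 2.
    by apply: (cvgr_le 0 (u0 n)); rewrite divr_gt0.
apply: filterS2 h1 h2 => i; rewrite big_nat_recr//=; lra.
Qed.

(** Tannery's theorem: the tail beyond [N] is controlled by that of [B], and the finitely many
    remaining terms tend to 0. Smallness of all partial sums is the form in which the norms below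
    consume it. *)
Lemma dominated_series (u : I -> nat -> R) (B : nat -> R) (M : R) :
  (forall n, \sum_(0 <= k < n) B k <= M) ->
  (\forall i \near F, forall k, 0 <= u i k <= B k) ->
  (forall k, u ^~ k @ F --> 0) -> (forall k, 0 <= B k) ->
  forall e, 0 < e -> \forall i \near F, forall n, \sum_(0 <= k < n) u i k <= e.
Proof.
move=> BM uB u0 B0 e e0.
have e20 : 0 < e / 2 by rewrite divr_gt0.
have [l Bl sl] := bounded_series_cvg B0 BM.
have [N _ hN] : \forall n \near \oo, l - e / 2 < series B n.
  by apply: cvgr_gt Bl _ _; lra.
have {}hN := hN N (leqnn N); rewrite /= /series/= in hN.
have h1 := near_sum_le N e20 u0.
apply: filterS2 uB h1 => i ub hs n.
have [nN|Nn] := leqP n N.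
  apply: le_trans (_ : _ <= \sum_(0 <= k < N) u i k) _; last lra.
  rewrite [leRHS](@big_cat_nat _ _ _ n)//= lerDl.
  by apply: sumr_ge0 => k _; have /andP[] := ub k.
rewrite (@big_cat_nat _ _ _ N)//=; last exact: ltnW.
have : \sum_(N <= k < n) u i k <= \sum_(N <= k < n) B k.
  by apply: ler_sum => k _; have /andP[] := ub k.
have := sl n; rewrite (@big_cat_nat _ _ _ N)//=; last exact: ltnW.
lra.
Qed.

Lemma ereal_cvg0 (g : I -> \bar R) : (forall i, (0 <= g i)%E) ->
  (forall e, 0 < e -> \forall i \near F, (g i <= e%:E)%E) -> g @ F --> 0%E.
Proof.
move=> g0 ge.
have fin i e : (g i <= e%:E)%E -> g i \is a fin_num.
  by move=> h; rewrite ge0_fin_numE//; apply: le_lt_trans h _; exact: ltry.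
apply/fine_cvgP; split.
  by apply: filterS (ge 1 ltr01) => i; exact: fin.
apply/cvgr0Pnorm_le => e e0; apply: filterS (ge e e0) => i h.
rewrite /= ger0_norm ?fine_ge0//.
by rewrite -lee_fin fineK//; exact: fin h.
Qed.

End DominatedSeries.

Section GraphNorm.
Context {R : realType} {H : completeNormedModType R} {ip : hilbert_dot H}.
Variable E : spectral_measure ip.
Variables (f : nat -> H) (mu : nat -> R).
Hypothesis f_on : orthonormal_seq ip f.
Hypothesis mu_ge1 : forall k, 1 <= mu k.
Hypothesis f_eigen : forall k B, measurable B -> E B (f k) = \1_B (mu k) *: f k.

Let mu_ge0 k : 0 <= mu k.
Proof. exact: le_trans (mu_ge1 k). Qed.

Lemma mu_pow_ge1 (p : R) k : 0 <= p -> 1 <= mu k `^ p.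
Proof. by move=> p0; rewrite -(powRr0 (mu k)) ler_powR. Qed.

Lemma weighted_l2 (p : R) (a : nat -> R) (M : R) : 0 <= p ->
  (forall n, \sum_(0 <= k < n) (mu k `^ p * a k ^+ 2) <= M) -> l2 a.
Proof.
move=> p0 aM; exists M => n; apply: le_trans (aM n); apply: ler_sum => k _.
by rewrite ler_peMl ?sqr_ge0// mu_pow_ge1.
Qed.

Lemma graph_norm_synth_le (b : R) (a : nat -> R) (e : R) : 0 <= b -> 0 <= e ->
  (forall n, \sum_(0 <= k < n) (mu k `^ (2 * b) * a k ^+ 2) <= e ^+ 2 / 2) ->
  (graph_norm E b (synth f a) <= e%:E)%E.
Proof.
move=> b0 e0 ae; have b20 : 0 <= 2 * b by rewrite mulr_ge0.
have la := weighted_l2 b20 ae.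
rewrite /graph_norm.
apply: (@le_trans _ _ (sqrte (e ^+ 2)%:E)); last by rewrite /= sqrtr_sqr ger0_norm.
rewrite lee_sqrt ?lee_fin ?sqr_ge0//.
have -> : (e ^+ 2)%:E = ((e ^+ 2 / 2)%:E + (e ^+ 2 / 2)%:E)%E by rewrite -EFinD -splitr.
apply: leeD.
  rewrite -(nneseries_cvg (norm_synth f_on la)).
  apply: nneseries_le => [k|n]; first exact: sqr_ge0.
  apply: le_trans (ae n); apply: ler_sum => k _.
  by rewrite ler_peMl ?sqr_ge0// mu_pow_ge1.
rewrite (pow_sqnorm_synth f_on mu_ge0 f_eigen)//.
by apply: nneseries_le => [k|//]; rewrite mulr_ge0 ?powR_ge0 ?sqr_ge0.
Qed.

Lemma graph_norm_cvg0 (I : Type) (F : set_system I) {FF : Filter F} (b : R)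
    (a : I -> nat -> R) (B : nat -> R) (M : R) : 0 <= b ->
  (forall n, \sum_(0 <= k < n) B k <= M) -> (forall k, 0 <= B k) ->
  (\forall i \near F, forall k, mu k `^ (2 * b) * a i k ^+ 2 <= B k) ->
  (forall k, a ^~ k @ F --> 0) ->
  graph_norm E b (synth f (a i)) @[i --> F] --> 0%E.
Proof.
move=> b0 BM B0 aB a0; apply: ereal_cvg0 => [i|e e0]; first exact: sqrte_ge0.
have e20 : 0 < e ^+ 2 / 2 by rewrite divr_gt0// exprn_gt0.
apply: (filterS _ (@dominated_series R I F _ (fun i k => mu k `^ (2 * b) * a i k ^+ 2)
  B M BM _ _ B0 _ e20)) => [i ie| |k].
- exact: graph_norm_synth_le b0 (ltW e0) ie.
- apply: filterS aB => i iB k; rewrite iB andbT.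
  by rewrite mulr_ge0 ?powR_ge0 ?sqr_ge0.
- rewrite -[X in _ --> X](mulr0 (mu k `^ (2 * b))); apply: cvgMr.
  by rewrite -[X in _ --> X](mulr0 0); apply: cvgM.
Qed.

(** Bessel's inequality with weights: the component of [w] outside the span only adds a nonnegative
    amount. *)
Lemma weighted_coords_le (b : R) w n : pow_dom E b w ->
  ((\sum_(0 <= k < n) mu k `^ (2 * b) * ip (f k) w ^+ 2)%:E <= pow_sqnorm E b w)%E.
Proof.
move=> bw; have lc := l2_coords f_on w.
set y2 := w - synth f (coords (ip := ip) f w).
have wE : w = synth f (coords (ip := ip) f w) + y2 by rewrite addrC subrK.
have f0 s : `[0%R, +oo[%classic s -> (0 <= (s `^ (2 * b))%:E)%E.
  by move=> _; rewrite lee_fin powR_ge0.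
apply: (@le_trans _ _ (pow_sqnorm E b (synth f (coords (ip := ip) f w)))); last first.
  rewrite {2}wE /pow_sqnorm !spectral_integralE /y2 (si_synthD f_on f_eigen)//.
    by rewrite leeDl// si_ge0.
  exact: measurable_pw.
rewrite (pow_sqnorm_synth f_on mu_ge0 f_eigen)// -sumEFin.
by apply: nneseries_lim_ge => k _ _; rewrite lee_fin mulr_ge0 ?powR_ge0 ?sqr_ge0.
Qed.

Lemma graph_norm_le1 (b : R) w : (graph_norm E b w <= 1)%E ->
  pow_dom E b w /\ (pow_sqnorm E b w <= 1)%E.
Proof.
move=> w1; have p0 : (0 <= pow_sqnorm E b w)%E.
  by apply: si_ge0 => s _; rewrite lee_fin powR_ge0.
have : ((`|w| ^+ 2)%:E + pow_sqnorm E b w <= 1%:E)%E.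
  by rewrite -lee_sqrt ?lee_fin//= sqrtr1.
move=> h; have {}h : (pow_sqnorm E b w <= 1)%E.
  by apply: le_trans h; rewrite leeDr// lee_fin sqr_ge0.
by split => //; apply: le_lt_trans h _; exact: ltry.
Qed.

Let amgm (r m w e : R) : 0 < m -> 0 < e ->
  `|r * w| <= m^-1 * r ^+ 2 / (2 * e) + e / 2 * (m * w ^+ 2).
Proof.
move=> m0 e0; have em0 : 0 < 2 * e * m by rewrite !mulr_gt0.
rewrite -(ler_pM2l em0).
have -> : 2 * e * m * (m^-1 * r ^+ 2 / (2 * e) + e / 2 * (m * w ^+ 2)) =
    r ^+ 2 + (e * m * w) ^+ 2 by field; rewrite !gt_eqF.
rewrite -[2 * e * m]gtr0_norm// -normrM ler_norml; apply/andP; split.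
  by have := sqr_ge0 (r + e * m * w); lra.
by have := sqr_ge0 (r - e * m * w); lra.
Qed.

Lemma dual_norm_synth_le (a x : nat -> R) (c e : R) : l2 a -> l2 x ->
  l2 (fun k => mu k `^ (3 / 4) * x k) -> 0 < e ->
  (forall n, \sum_(0 <= k < n)
    (mu k `^ (1 / 2))^-1 * (a k + c * (mu k * x k)) ^+ 2 <= e ^+ 2) ->
  (dual_norm E (1 / 4) (fun w => ip (synth f a) w +
    c * ip (pow_op E (3 / 4) (synth f x)) (pow_op E (1 / 4) w))%R <= e%:E)%E.
Proof.
move=> la lx lmx e0 re; apply: ge_ereal_sup => _ [w /= w1 <-].
have [bw sw] := graph_norm_le1 w1.
have -> : pow_op E (3 / 4) (synth f x) = synth f (fun k => mu k `^ (3 / 4) * x k).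
  by apply: pow_op_unique; [lra|exact: (is_pow_synth f_on mu_ge0 f_eigen)].
set z := pow_op E (1 / 4) w; set y := synth f (fun k => _ * x k).
have h1 := ip_synth f_on (y := w) la.
have h2 := ip_synth f_on (y := z) lmx.
pose r k := a k + c * (mu k * x k).
have h : series (fun k => r k * ip (f k) w) @ \oo --> ip (synth f a) w + c * ip y z.
  rewrite (_ : series _ = series (fun k => a k * ip (f k) w) \+
      (fun n => c * series (fun k => mu k `^ (3 / 4) * x k * ip (f k) z) n)).
    by apply: cvgD; [exact: h1|apply: cvgMr; exact: h2].
  apply/funext => n; rewrite /= /series/= mulr_sumr -big_split/=.
  apply: eq_bigr => k _.
  rewrite -[ip (f k) z]/(coords f z k) (coords_pow_op f_on mu_ge0 f_eigen k bw) /coords.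
  have e34 : mu k `^ (3 / 4) * mu k `^ (1 / 4) = mu k.
    rewrite -powRD; last by apply/implyP => _; rewrite gt_eqF// (lt_le_trans ltr01).
    by rewrite -[RHS]powRr1//; congr (_ `^ _); field.
  rewrite /r -[in LHS]e34.
  by move: (mu k `^ (3 / 4)) (mu k `^ (1 / 4)) => p q; ring.
rewrite lee_fin.
have hn : `|series (fun k => r k * ip (f k) w) n| @[n --> \oo] -->
    `|ip (synth f a) w + c * ip y z| by apply: cvg_norm; exact: h.
apply: ler_cvg_to hn (cvg_cst e) _; apply: nearW => n.
have m0 k : 0 < mu k `^ (1 / 2) by apply: powR_gt0; exact: lt_le_trans (mu_ge1 k).
have we : \sum_(0 <= k < n) mu k `^ (1 / 2) * ip (f k) w ^+ 2 <= 1.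
  rewrite -lee_fin; apply: le_trans sw; have := weighted_coords_le n bw.
  by rewrite (_ : 2 * (1 / 4) = 1 / 2 :> R)//; field.
have := re n; set Sr := \sum_(0 <= k < n) _ => rn.
apply: (@le_trans _ _ (Sr / (2 * e) + e / 2 * 1)); last first.
  have : Sr / (2 * e) <= e / 2 by rewrite ler_pdivrMr ?mulr_gt0//; lra.
  lra.
apply: (@le_trans _ _ (Sr / (2 * e) + e / 2 *
    \sum_(0 <= k < n) mu k `^ (1 / 2) * ip (f k) w ^+ 2)); last first.
  by rewrite lerD2l ler_wpM2l// divr_ge0// ltW.
rewrite /series/= mulr_suml mulr_sumr -big_split/=.
apply: le_trans (ler_norm_sum _ _ _) _; apply: ler_sum => k _.
exact: amgm.
Qed.

End GraphNorm.

Section DifferenceQuotient.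
Context {R : realType}.

(** Difference quotients are values of the derivative, so bounds on derivatives that are uniform in
    time dominate the series of quotients. *)
Lemma quotient_mvt (g dg : R -> R) (s t : R) : s \in `[0, 1] -> t \in `[0, 1] ->
  s != t -> (forall x, has_deriv g x (dg x)) ->
  exists2 z, z \in `[0, 1] & `|t - z| <= `|t - s| /\
    (s - t)^-1 * (g s - g t) = dg z.
Proof.
rewrite !in_itv/= => /andP[s0 s1] /andP[t0 t1] st dgP.
have main a b : 0 <= a -> a < b -> b <= 1 -> exists2 z, a <= z <= b &
    (b - a)^-1 * (g b - g a) = dg z.
  move=> a0 ab b1; have [z] := mvt (ltW ab) (fun x _ => dgP x).
  rewrite in_itv/= => abz e; exists z => //.
  by rewrite e mulrC mulfK// subr_eq0 gt_eqF.
move: st; rewrite neq_lt => /orP[st|ts].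
  have [z /andP[sz zt] e] := main s t s0 st t1.
  exists z; first by rewrite in_itv/=; lra.
  split; first by rewrite !ger0_norm ?subr_ge0// ?lerD2l ?lerN2// ltW.
  by rewrite -e -[s - t]opprB -[g s - g t]opprB invrN mulrNN.
have [z /andP[tz zs] e] := main t s t0 ts s1.
exists z; first by rewrite in_itv/=; lra.
split=> //; rewrite !ler0_norm ?subr_le0// ?(ltW ts)//; lra.
Qed.

Lemma quotient_cvg (g dg : R -> R) (t : R) : t \in `[0, 1] ->
  (forall x, has_deriv g x (dg x)) -> {for t, continuous dg} ->
  (s - t)^-1 * (g s - g t) @[s --> within (`[0, 1] `\ t) (nbhs t)] --> dg t.
Proof.
move=> tI dgP cdg; apply/cvgrPdist_lt => e e0.
have /cvgrPdist_lt/(_ e e0) := cdg.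
rewrite near_withinE => /nbhs_ballP[d /= d0 hd].
apply/nbhs_ballP; exists d => // s sd [sI /= /eqP st].
have [z _ [zt ->]] := quotient_mvt sI tI st dgP.
by apply: hd; exact: le_lt_trans zt sd.
Qed.

End DifferenceQuotient.

(** * Solutions given by series *)

Section SeriesSolutions.
Context {R : realType} {H : completeNormedModType R} {ip : hilbert_dot H}.
Variable E : spectral_measure ip.
Variables (f : nat -> H) (mu : nat -> R).
Hypothesis f_on : orthonormal_seq ip f.
Hypothesis mu_ge1 : forall k, 1 <= mu k.
Hypothesis f_eigen : forall k B, measurable B -> E B (f k) = \1_B (mu k) *: f k.

Lemma geometric_sum_le (C : R) n : 0 <= C -> \sum_(0 <= k < n) C / 2 ^+ k <= 2 * C.
Proof.
move=> C0; suff -> : \sum_(0 <= k < n) C / 2 ^+ k = 2 * C - 2 * (C / 2 ^+ n).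
  by rewrite gerBl mulr_ge0// divr_ge0// exprn_ge0.
elim: n => [|n IHn]; first by rewrite big_nil expr0; field.
by rewrite big_nat_recr//= IHn exprS; field; rewrite expf_neq0.
Qed.

Let geo_ge0 (C : R) k : 0 <= C -> 0 <= C / 2 ^+ k.
Proof. by move=> C0; rewrite divr_ge0// exprn_ge0. Qed.

Let mu_ge0 k : 0 <= mu k.
Proof. exact: le_trans (mu_ge1 k). Qed.

Let weighted_sum (p C : R) (a : nat -> R) n : 0 <= C ->
  (forall k, mu k `^ p * a k ^+ 2 <= C / 2 ^+ k) ->
  \sum_(0 <= k < n) mu k `^ p * a k ^+ 2 <= 2 * C.
Proof.
move=> C0 aC; apply: le_trans (geometric_sum_le n C0).
by apply: ler_sum => k _; exact: aC.
Qed.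

Lemma geometric_l2 (p C : R) (a : nat -> R) : 0 <= p -> 0 <= C ->
  (forall k, mu k `^ p * a k ^+ 2 <= C / 2 ^+ k) -> l2 a.
Proof.
by move=> p0 C0 aC; apply: (weighted_l2 mu_ge1 p0) => n; exact: (weighted_sum n C0 aC).
Qed.

Lemma geometric_pow_l2 (b C : R) (a : nat -> R) : 0 <= C ->
  (forall k, mu k `^ (2 * b) * a k ^+ 2 <= C / 2 ^+ k) ->
  l2 (fun k => mu k `^ b * a k).
Proof.
move=> C0 aC; exists (2 * C) => n; apply: le_trans (weighted_sum n C0 aC).
by apply: ler_sum => k _; rewrite exprMn powR_sqr.
Qed.

Section Regularity.
Variables (b C : R) (y dy : nat -> R -> R).
Hypothesis b0 : 0 <= b.
Hypothesis C0 : 0 <= C.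
Hypothesis yC : forall k s, s \in `[0, 1] -> mu k `^ (2 * b) * y k s ^+ 2 <= C / 2 ^+ k.
Hypothesis cy : forall k, continuous (y k).

Let b20 : 0 <= 2 * b. Proof. by rewrite mulr_ge0. Qed.

Let l2y s : s \in `[0, 1] -> l2 (y ^~ s).
Proof. by move=> sI; apply: (geometric_l2 b20 C0) => k; exact: yC. Qed.

(** Each coefficient is continuous, and the square of a difference is at most twice the sum of the
    squares, hence the dominating sequence [4 * C / 2 ^+ k]. *)
Lemma C0_pow_series : C0_pow E b (fun s => synth f (y ^~ s)).
Proof.
move=> t tI; split.
  apply: (l2_pow_dom f_on mu_ge0 f_eigen); first exact: l2y.
  by apply: (geometric_pow_l2 C0) => k; exact: yC.
have near_eq : \forall s \near within `[0, 1] (nbhs t),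
    synth f (fun k => y k s - y k t) = synth f (y ^~ s) - synth f (y ^~ t).
  rewrite near_withinE; apply: nearW => s sI.
  by rewrite (synthB f_on)//; exact: l2y.
apply: (@cvg_trans _ (graph_norm E b (synth f (fun k => y k s - y k t))
    @[s --> within `[0, 1] (nbhs t)])).
  by apply: near_eq_cvg; apply: filterS near_eq => s ->.
apply: (graph_norm_cvg0 f_on mu_ge1 f_eigen
  (B := fun k => 4 * C / 2 ^+ k) (M := 2 * (4 * C))) => //.
- by move=> n; apply: geometric_sum_le; rewrite mulr_ge0.
- by move=> k; rewrite geo_ge0// mulr_ge0.
- rewrite near_withinE; apply: nearW => s sI k.
  have h1 := yC k sI; have h2 := yC k tI.
  have w0 : 0 <= mu k `^ (2 * b) by exact: powR_ge0.
  have : 0 <= mu k `^ (2 * b) * (y k s + y k t) ^+ 2 by rewrite mulr_ge0 ?sqr_ge0.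
  by move: h1 h2; set p := (2 ^+ k)^-1; set w := mu k `^ _; lra.
- move=> k; rewrite -[X in _ --> X](subrr (y k t)); apply: cvgB; last exact: cvg_cst.
  by apply: cvg_within_filter; exact: cy.
Qed.

Hypothesis dyC : forall k s, s \in `[0, 1] ->
  mu k `^ (2 * b) * dy k s ^+ 2 <= C / 2 ^+ k.
Hypothesis cdy : forall k, continuous (dy k).
Hypothesis ydy : forall k s, has_deriv (y k) s (dy k s).

Lemma derive_pow_series :
  is_derive_pow E b (fun s => synth f (y ^~ s)) (fun s => synth f (dy ^~ s)).
Proof.
move=> t tI.
have l2dy : l2 (dy ^~ t) by apply: (geometric_l2 b20 C0) => k; exact: dyC.
have near_eq : \forall s \near within (`[0, 1] `\ t) (nbhs t),
    synth f (fun k => (s - t)^-1 * (y k s - y k t) - dy k t) =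
    (s - t)^-1 *: (synth f (y ^~ s) - synth f (y ^~ t)) - synth f (dy ^~ t).
  rewrite near_withinE; apply: nearW => s [sI _].
  have lb := l2B (l2y sI) (l2y tI).
  by rewrite (synthB f_on)//; [rewrite (synthZ f_on)// (synthB f_on)//; exact: l2y|exact: l2Z].
apply: (@cvg_trans _ (graph_norm E b (synth f (fun k => (s - t)^-1 * (y k s - y k t) - dy k t))
    @[s --> within (`[0, 1] `\ t) (nbhs t)])).
  by apply: near_eq_cvg; apply: filterS near_eq => s ->.
apply: (graph_norm_cvg0 f_on mu_ge1 f_eigen
  (B := fun k => 4 * C / 2 ^+ k) (M := 2 * (4 * C))) => //.
- by move=> n; apply: geometric_sum_le; rewrite mulr_ge0.
- by move=> k; rewrite geo_ge0// mulr_ge0.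
- rewrite near_withinE; apply: nearW => s [sI /= /eqP st] k.
  have [z zI [_ ->]] := quotient_mvt sI tI st (ydy k).
  have h1 := dyC k zI; have h2 := dyC k tI.
  have w0 : 0 <= mu k `^ (2 * b) by exact: powR_ge0.
  have : 0 <= mu k `^ (2 * b) * (dy k z + dy k t) ^+ 2 by rewrite mulr_ge0 ?sqr_ge0.
  by move: h1 h2; set p := (2 ^+ k)^-1; set w := mu k `^ _; lra.
- move=> k; rewrite -[X in _ --> X](subrr (dy k t)); apply: cvgB; last exact: cvg_cst.
  exact: quotient_cvg tI (ydy k) (@cdy k t).
Qed.

End Regularity.

Section WeakSolution.
Variables (C : R) (c : R -> R) (x dx : nat -> R -> R).
Hypothesis C0 : 0 <= C.
Hypothesis c_bound : forall s, 0 <= c s <= 3 / 2.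
Hypothesis cc : continuous c.
Hypothesis xC : forall k s, s \in `[0, 1] -> mu k `^ (3 / 2) * x k s ^+ 2 <= C / 2 ^+ k.
Hypothesis dxC : forall k s, s \in `[0, 1] -> mu k `^ (1 / 2) * dx k s ^+ 2 <= C / 2 ^+ k.
Hypothesis xdx : forall k s, has_deriv (x k) s (dx k s).
Hypothesis dxddx : forall k s, has_deriv (dx k) s (- (mu k * c s) * x k s).

Let cx k : continuous (x k).
Proof. by move=> s; exact: derive_continuous (xdx k s). Qed.

Lemma weak_solution_series :
  weak_solution E c (fun s => synth f (x ^~ s)) (fun s => synth f (dx ^~ s)).
Proof.
move=> t tI.
have h32 : 2 * (3 / 4) = 3 / 2 :> R by field.
have l2x s : s \in `[0, 1] -> l2 (x ^~ s).
  by move=> sI; apply: (@geometric_l2 (3 / 2) C) => // k; exact: xC.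
have l2mx : l2 (fun k => mu k `^ (3 / 4) * x k t).
  by apply: (geometric_pow_l2 C0) => k; rewrite h32; exact: xC.
have l2dx s : s \in `[0, 1] -> l2 (dx ^~ s).
  by move=> sI; apply: (@geometric_l2 (1 / 2) C) => // k; exact: dxC.
pose a s k := (s - t)^-1 * (dx k s - dx k t).
have l2a s : s \in `[0, 1] -> l2 (a s) by move=> sI; apply/l2Z/l2B; exact: l2dx.
apply: ereal_cvg0 => [s|e e0].
  (* The dual norm is a supremum; it is nonnegative because [w = 0] lies in the unit ball. *)
  apply: (@le_trans _ _ (`|ip ((s - t)^-1 *: (synth f (dx^~ s) - synth f (dx^~ t))) 0 +
    c t * ip (pow_op E (3 / 4) (synth f (x^~ t))) (pow_op E (1 / 4) 0)|)%:E).
    by rewrite lee_fin.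
  apply: ereal_sup_ubound; exists 0 => //=.
  rewrite /graph_norm normr0 expr0n/= add0e /pow_sqnorm spectral_integralE.
  have -> : si E `[0, +oo[%classic (fun s : measurableTypeR R => (s `^ (2 * (1 / 4)))%:E) 0 = 0%E.
    rewrite -[X in si _ _ _ X](scale0r (0 : H)) siZ ?expr0n/= ?mul0e//.
    - by move=> *; rewrite lee_fin powR_ge0.
    - exact: measurable_pw.
  by rewrite sqrte0 lee_fin.
have h : \forall s \near within (`[0, 1] `\ t) (nbhs t), forall n,
    \sum_(0 <= k < n) (mu k `^ (1 / 2))^-1 * (a s k + c t * (mu k * x k t)) ^+ 2 <= e ^+ 2.
  apply: (@dominated_series _ _ _ _
    (fun s k => (mu k `^ (1 / 2))^-1 * (a s k + c t * (mu k * x k t)) ^+ 2)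
    (fun k => 9 * C / 2 ^+ k) (2 * (9 * C))).
  - by move=> n; apply: geometric_sum_le; rewrite mulr_ge0.
  - rewrite near_withinE; apply: nearW => s [sI /= /eqP st] k.
    have m0 : 0 < mu k `^ (1 / 2) by apply: powR_gt0; exact: lt_le_trans (mu_ge1 k).
    rewrite mulr_ge0 ?invr_ge0 ?sqr_ge0 ?(ltW m0)//=.
    have [z zI [_ hz]] := quotient_mvt sI tI st (dxddx k).
    rewrite /a hz.
    have h1 := xC k zI; have h2 := xC k tI.
    have /andP[cz0 cz1] := c_bound z; have /andP[ct0 ct1] := c_bound t.
    have -> : (mu k `^ (1 / 2))^-1 * (- (mu k * c z) * x k z + c t * (mu k * x k t)) ^+ 2 =
        mu k `^ (3 / 2) * (c t * x k t - c z * x k z) ^+ 2.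
      have mE : mu k ^+ 2 = mu k `^ (1 / 2) * mu k `^ (3 / 2).
        rewrite -powRD; last by apply/implyP => _; rewrite gt_eqF// (lt_le_trans ltr01).
        by rewrite -powR_mulrn//; congr (_ `^ _); field.
      have -> : (- (mu k * c z) * x k z + c t * (mu k * x k t)) ^+ 2 =
          mu k ^+ 2 * (c t * x k t - c z * x k z) ^+ 2 by ring.
      by rewrite mE -mulrA mulKf// gt_eqF.
    have w0 : 0 <= mu k `^ (3 / 2) by exact: powR_ge0.
    set w := mu k `^ (3 / 2) in h1 h2 w0 *.
    have sq (p q : R) : 0 <= p -> p <= 3 / 2 -> w * (p * q) ^+ 2 <= 9 / 4 * (w * q ^+ 2).
      move=> p0 p1; have -> : w * (p * q) ^+ 2 = p ^+ 2 * (w * q ^+ 2) by ring.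
      apply: ler_wpM2r; first by rewrite mulr_ge0 ?sqr_ge0.
      have -> : 9 / 4 = (3 / 2) ^+ 2 :> R by field.
      by rewrite lerXn2r ?nnegrE.
    have s1 := sq _ (x k z) cz0 cz1; have s2 := sq _ (x k t) ct0 ct1.
    have : 0 <= w * (c t * x k t + c z * x k z) ^+ 2 by rewrite mulr_ge0 ?sqr_ge0.
    by move: h1 h2 s1 s2; set p := (2 ^+ k)^-1; lra.
  - move=> k; rewrite -[X in _ --> X](mulr0 (mu k `^ (1 / 2))^-1); apply: cvgMr.
    have q : a s k + c t * (mu k * x k t) @[s --> within (`[0, 1] `\ t) (nbhs t)] --> 0.
      rewrite [X in _ --> X](_ : 0 = - (mu k * c t) * x k t + c t * (mu k * x k t)); last by ring.
      apply: cvgD; last exact: cvg_cst.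
      apply: (@quotient_cvg _ (dx k) (fun s => - (mu k * c s) * x k s)) => //.
      apply: cvgM; last exact: cx.
      by apply: cvgN; apply: cvgMr; exact: cc.
    by rewrite -[X in _ --> X](mulr0 0); apply: cvgM.
  - by move=> k; rewrite geo_ge0// mulr_ge0.
  - by rewrite exprn_gt0.
have hI : \forall s \near within (`[0, 1] `\ t) (nbhs t), s \in `[0, 1].
  by rewrite near_withinE; apply: nearW => s [].
apply: filterS2 h hI => s hs sI.
have -> : (s - t)^-1 *: (synth f (dx^~ s) - synth f (dx^~ t)) = synth f (a s).
  by rewrite /a (synthZ f_on) ?(synthB f_on)//; [exact: l2dx|exact: l2dx|apply: l2B; exact: l2dx].
exact: (dual_norm_synth_le f_on mu_ge1 f_eigen (l2a _ sI) (l2x _ tI) l2mx e0 hs).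
Qed.

End WeakSolution.

End SeriesSolutions.

(** * Gevrey data at time 0 and unbounded norms at later times *)

Section EnergySeries.
Context {R : realType} {H : completeNormedModType R} {ip : hilbert_dot H}.
Variable E : spectral_measure ip.
Variables (f : nat -> H) (L : nat -> R).
Hypothesis f_on : orthonormal_seq ip f.
Hypothesis L_ge1 : forall k, 1 <= L k.
Hypothesis f_eigen : forall k B, measurable B ->
  E B (f k) = \1_B (L k ^+ 2) *: f k.

Let mu_ge1 k : 1 <= L k ^+ 2.
Proof. by rewrite exprn_ege1. Qed.

Let mu_ge0 k : 0 <= L k ^+ 2.
Proof. exact: sqr_ge0. Qed.

Let L_ge0 k : 0 <= L k.
Proof. exact: le_trans (L_ge1 k). Qed.

Lemma powR_sqr_half (x : R) n : 0 <= x -> (x ^+ 2) `^ (n%:R / 2) = x ^+ n.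
Proof.
move=> x0; rewrite -powR_mulrn// -powRrM (_ : 2%:R * (n%:R / 2) = n%:R).
  exact: powR_mulrn.
by field.
Qed.

(** The hypothesis has [k] in place of [r] in the exponent, so it serves every [r]: from the index
    [K] on it dominates, and the terms below [K] form a finite sum. *)
Lemma gevrey_synth (phi : R -> R) (r b C : R) (a : nat -> R) : 0 <= b -> 0 <= C ->
  (forall s, 0 <= s -> 0 <= phi s) ->
  (forall k, (L k ^+ 2) `^ (2 * b) * a k ^+ 2 * expR (k%:R * phi (L k)) <= C / 2 ^+ k) ->
  gevrey_space E phi r b (synth f a).
Proof.
move=> b0 C0 phi0 aC.
have w0 k : 0 <= (L k ^+ 2) `^ (2 * b) * a k ^+ 2 by rewrite mulr_ge0 ?powR_ge0 ?sqr_ge0.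
have e1 k : 1 <= expR (k%:R * phi (L k)) by rewrite -expR0 ler_expR mulr_ge0// phi0.
have la : l2 a.
  apply: (@geometric_l2 _ _ mu_ge1 (2 * b) C) => //; first by rewrite mulr_ge0.
  move=> k; apply: le_trans (aC k); rewrite ler_peMr//.
pose u k := a k ^+ 2 * ((L k ^+ 2) `^ (2 * b) * expR (r * phi (Num.sqrt (L k ^+ 2)))).
have u0 k : 0 <= u k.
  by apply: mulr_ge0; rewrite ?sqr_ge0// mulr_ge0 ?powR_ge0 ?expR_ge0.
pose K := Num.bound `|r|.
have uC k : (K <= k)%N -> u k <= C / 2 ^+ k.
  move=> Kk; apply: le_trans (aC k); rewrite /u mulrCA mulrA sqrtr_sqr ger0_norm//.
  rewrite ler_wpM2l// ler_expR ler_wpM2r ?phi0//.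
  apply: (le_trans (ler_norm r)); apply/ltW/(lt_le_trans (archi_boundP (normr_ge0 r))).
  by rewrite ler_nat.
have partial_le n : \sum_(0 <= k < n) u k <=
    \sum_(0 <= k < K) u k + \sum_(0 <= k < n) C / 2 ^+ k.
  have [nK|Kn] := leqP n K.
    rewrite (big_cat_nat (leq0n n) nK)/= -addrA lerDl addr_ge0//.
      by apply: sumr_ge0.
    by apply: sumr_ge0 => k _; rewrite divr_ge0// exprn_ge0.
  rewrite (big_cat_nat (leq0n K) (ltnW Kn))/= lerD2l.
  rewrite [leRHS](big_cat_nat (leq0n K) (ltnW Kn))/=.
  apply: ler_wpDl; first by apply: sumr_ge0 => k _; rewrite divr_ge0// exprn_ge0.
  by apply: ler_sum_nat => k /andP[Kk _]; exact: uC.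
rewrite /gevrey_space/=.
apply: (@le_lt_trans _ _ (\sum_(0 <= k < K) u k + 2 * C)%:E); last exact: ltry.
apply: (spectral_integral_synth_le f_on mu_ge0 f_eigen) => //.
- by move=> s s0; rewrite mulr_ge0 ?powR_ge0 ?expR_ge0.
- move=> n; apply: le_trans (partial_le n) _.
  by rewrite lerD2l geometric_sum_le.
Qed.

Lemma pow_dom_synth_bounded (b m : R) (a : nat -> R) : l2 a -> 0 <= m -> m <= 2 * b ->
  pow_dom E b (synth f a) -> exists P, forall k, (L k ^+ 2) `^ m * a k ^+ 2 <= P.
Proof.
move=> la m0 mb; rewrite /pow_dom/= => fin; exists (fine (pow_sqnorm E b (synth f a))) => k.
have h := pow_sqnorm_synth_ge f_on mu_ge0 f_eigen b k la.
have p0 : (0 <= pow_sqnorm E b (synth f a))%E.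
  by apply: le_trans h; rewrite lee_fin mulr_ge0 ?powR_ge0 ?sqr_ge0.
rewrite -lee_fin fineK ?ge0_fin_numE//; apply: le_trans h.
by rewrite lee_fin ler_wpM2r ?sqr_ge0// ler_powR.
Qed.

(** Membership would bound every single term of the two series, by [P] and [Q] say, whereas their
    sum is at least [k]. *)
Lemma phase_space_synth (b : R) (a da : nat -> R) (K : nat) : 1 <= b -> l2 a -> l2 da ->
  (forall k, (K <= k)%N -> k%:R <= L k ^+ 2 * (L k ^+ 2 * a k ^+ 2 + da k ^+ 2)) ->
  ~ phase_space E b (synth f a, synth f da).
Proof.
move=> b1 la lda low [/= fin1 fin2].
have m1 : 4%:R / 2 <= 2 * ((b + 1) / 2) by lra.
have m2 : 2%:R / 2 <= 2 * (b / 2) by lra.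
have [P hP] := pow_dom_synth_bounded la (divr_ge0 (ler0n _ 4) (ler0n _ 2)) m1 fin1.
have [Q hQ] := pow_dom_synth_bounded lda (divr_ge0 (ler0n _ 2) (ler0n _ 2)) m2 fin2.
pose k := maxn K (Num.bound `|P + Q|).
have PQ : P + Q < k%:R.
  apply: (le_lt_trans (ler_norm _)).
  apply: (lt_le_trans (archi_boundP (normr_ge0 _))).
  rewrite ler_nat; apply: leq_trans (leq_maxr _ _) => //.
have := low k (leq_maxl _ _); have := hP k; have := hQ k.
rewrite !powR_sqr_half//; set x := a k; set y := da k; set l := L k => hx hy.
have -> : l ^+ 2 * (l ^+ 2 * x ^+ 2 + y ^+ 2) = l ^+ 4 * x ^+ 2 + l ^+ 2 * y ^+ 2 by ring.
by move: hx hy PQ; lra.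
Qed.

(** However small the exponent [p] is, domination of [y ^+ n] with [n] at least [1 / p] is
    enough. *)
Lemma le_powR_expn (y l p : R) n : 1 <= y -> y ^+ n <= l -> 1 <= n%:R * p -> 0 <= p ->
  y <= l `^ p.
Proof.
move=> y1 yl np p0; have y0 : 0 <= y := le_trans ler01 y1.
apply: (@le_trans _ _ ((y ^+ n) `^ p)).
  rewrite -powR_mulrn// -powRrM -[leLHS]powRr1//; exact: ler_powR.
apply: ge0_ler_powR => //; rewrite nnegrE ?exprn_ge0//.
by apply: le_trans yl; rewrite exprn_ge0.
Qed.

Lemma pow_norm_synth_unbounded (b M : R) (a : nat -> nat -> R) (Y : nat -> R) :
  1 / 2 < b -> (forall k, l2 (a k)) -> (forall k, 1 <= Y k) ->
  (forall k, Y k ^+ k.+1 <= L k) ->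
  (forall k, 2 ^+ k / (3 * Y k) <= L k ^+ 3 * a k k ^+ 2) ->
  exists k, (M%:E < pow_norm E ((b + 1) / 2) (synth f (a k)))%E.
Proof.
move=> b2 la Y1 YL aY; have p0 : 0 < 2 * b - 1 by lra.
pose k := maxn (Num.bound `|(2 * b - 1)^-1|) (Num.bound `|3 * M ^+ 2|).
exists k.
have k1 : (2 * b - 1)^-1 < k%:R.
  apply: (le_lt_trans (ler_norm _)); apply: (lt_le_trans (archi_boundP (normr_ge0 _))).
  by rewrite ler_nat; apply: leq_trans (leq_maxl _ _).
have k2 : 3 * M ^+ 2 < k%:R.
  apply: (le_lt_trans (ler_norm _)); apply: (lt_le_trans (archi_boundP (normr_ge0 _))).
  by rewrite ler_nat; apply: leq_trans (leq_maxr _ _).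
have kp : (k%:R : R) <= 2 ^+ k by rewrite -natrX ler_nat ltnW// ltn_expl.
have Yp : Y k <= L k `^ (2 * b - 1).
  apply: le_powR_expn (YL k) _ (ltW p0); first exact: Y1.
  move: k1; rewrite -[X in X < _]mul1r ltr_pdivrMr// => k1.
  by apply/ltW/(lt_le_trans k1); rewrite ler_wpM2r ?ler_nat// ltW.
have Y0 : 0 < Y k := lt_le_trans ltr01 (Y1 k).
have a2 : 0 <= L k ^+ 3 * a k k ^+ 2 by rewrite mulr_ge0 ?sqr_ge0// exprn_ge0.
have low : M ^+ 2 < (L k ^+ 2) `^ (2 * ((b + 1) / 2)) * a k k ^+ 2.
  have -> : (L k ^+ 2) `^ (2 * ((b + 1) / 2)) = L k `^ (2 * b - 1) * L k ^+ 3.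
    rewrite -!powR_mulrn// -powRD; last by apply/implyP => _; rewrite gt_eqF// (lt_le_trans ltr01).
    by rewrite -powRrM; congr (_ `^ _); field.
  rewrite -mulrA; apply: (@lt_le_trans _ _ (Y k * (2 ^+ k / (3 * Y k)))).
    have -> : Y k * (2 ^+ k / (3 * Y k)) = 2 ^+ k / 3 by field; rewrite gt_eqF.
    by move: k2 kp; set z := 2 ^+ k; set q := M ^+ 2; lra.
  apply: le_trans (ler_wpM2l (ltW Y0) (aY k)) _.
  exact: ler_wpM2r.
rewrite /pow_norm; apply: (@le_lt_trans _ _ (sqrte (M ^+ 2)%:E)).
  by rewrite /= lee_fin sqrtr_sqr ler_norm.
have h := pow_sqnorm_synth_ge f_on mu_ge0 f_eigen ((b + 1) / 2) k (la k).
have P0 : (0 <= pow_sqnorm E ((b + 1) / 2) (synth f (a k)))%E.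
  by apply: le_trans h; rewrite lee_fin mulr_ge0 ?powR_ge0 ?sqr_ge0.
rewrite ltNge lee_sqrt ?lee_fin ?sqr_ge0// -ltNge.
by apply: lt_le_trans h; rewrite lte_fin.
Qed.

End EnergySeries.

Theorem proposition3p7 (R : realType) (H : completeNormedModType R)
    (ip : hilbert_dot H) (H_separable : separable H)
    (A : unbounded_op H) (A_linear : op_linear A)
    (A_self_adjoint : op_self_adjoint ip A) (A_nonneg : op_nonneg ip A)
    (E : spectral_measure ip) (A_E : spectral_resolution E A)
    (e : nat -> H) (lambda : nat -> R)
    (e_orthonormal : orthonormal_seq ip e)
    (lambda_gt0 : forall k, 0 < lambda k)
    (lambda_increasing : increasing_seq lambda)
    (lambda_unbounded : forall M : R, exists k, M < lambda k)
    (e_eigen : forall k, op_dom A (e k) /\ A (e k) = lambda k ^+ 2 *: e k)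
    (omega : R -> R)
    (omega_ge0 : forall s, 0 <= s -> 0 <= omega s)
    (omega_cont : {within `[0, +oo[, continuous omega})
    (omega_increasing : forall a b, 0 <= a -> a < b -> omega a < omega b)
    (omega0 : omega 0 = 0)
    (omega_subadditive : forall a b, 0 <= a -> 0 <= b ->
      omega (a + b) <= omega a + omega b)
    (omega_ratio : forall a b, 0 < a -> a <= b -> a / omega a <= b / omega b)
    (phi : R -> R)
    (phi_ge1 : forall s, 0 <= s -> 1 <= phi s)
    (phi_lim : s * (phi (s / Num.sqrt (omega (1 / s))))^-1
      @[s --> +oo] --> +oo) :
  exists (c : R -> R) (v dv : R -> H),
    (forall t, t \in `[0, 1] -> 0 <= c t <= 3 / 2) /\
    [/\ omega_continuous omega `[0, 1] c,
        forall r, 0 < r ->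
          gevrey_space E phi r (3 / 4) (v 0) /\
          gevrey_space E phi r (1 / 4) (dv 0),
        [/\ C1_pow E (1 / 4) v dv, C0_pow E (3 / 4) v &
            weak_solution E c v dv],
        forall t, t \in `]0, 1] -> forall b, 1 <= b ->
          ~ phase_space E b (v t, dv t) &
        exists tau : nat -> R,
          [/\ forall k, tau k \in `]0, 1],
              tau @ \oo --> 0 &
              forall b, 1 / 2 < b -> forall M : R, exists k,
                (M%:E < pow_norm E ((b + 1) / 2) (v (tau k)))%E]].

Proof.
have m : modulus omega by split.
have phi_ge0 s : 0 <= s -> 0 <= phi s by move=> /phi_ge1; exact: le_trans.
have [t [sig [del [lam [n [cd [lam0 lamS] n_lam lam_sig par]]]]]] :=
  parameters m phi_ge1 phi_lim lambda_unbounded.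
have lam_ge1 k : 1 <= lam k.
  by elim: k => // k IHk; exact: le_trans IHk (ltW (lamS k)).
have [x [dx xP]] : exists x dx : nat -> R -> R, forall k,
  [/\ forall s, has_deriv (x k) s (dx k s),
      forall s, has_deriv (dx k) s (- (lam k.+1 ^+ 2 * coef t sig del s) * x k s),
      forall s, 0 <= s -> s <= 1 ->
        lam k.+1 * (lam k.+1 ^+ 2 * x k s ^+ 2 + dx k s ^+ 2) <= 8 / 2 ^+ k,
      lam k.+1 * (lam k.+1 ^+ 2 * x k 0 ^+ 2 + dx k 0 ^+ 2) *
        expR (k%:R * phi (lam k.+1)) <= 8 / 2 ^+ k &
    (forall s, 2 * t k.+1 <= s -> s <= 1 ->
        k%:R <= lam k.+1 ^+ 2 * (lam k.+1 ^+ 2 * x k s ^+ 2 + dx k s ^+ 2)) /\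
      2 ^+ k / (3 * (4 ^+ k * expR (2 * phase_sum t sig k))) <=
        lam k.+1 ^+ 3 * x k (2 * t k.+1 - pi / (2 * sig k.+1)) ^+ 2].
  by apply: (modes cd lam_ge1 lam_sig) => // k; have [] := par k.
(* The shift drops the initial parameters, whose frequency is not an eigenvalue. [L k] is a square
   root of the eigenvalue [mu k]. *)
pose f k := e (n k.+1); pose L k := lam k.+1; pose mu k := L k ^+ 2.
have L_ge1 k : 1 <= L k by exact: lam_ge1.
have L0 k : 0 < L k := lt_le_trans ltr01 (L_ge1 k).
have mu_ge1 k : 1 <= mu k by rewrite exprn_ege1.
have f_on : orthonormal_seq ip f.
  (* The strictly increasing frequencies force the selected indices [n k.+1] to be distinct. *)
  have lam_inj : injective lam by apply: inc_inj; apply/increasing_seqP.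
  move=> i j; rewrite /f e_orthonormal; congr (_%:R); apply/congr1.
  apply/eqP/eqP => [ij|->//].
  by have := congr1 lambda ij; rewrite !n_lam => /lam_inj [].
have f_eigen k B : measurable B -> E B (f k) = \1_B (mu k) *: f k.
  apply: eigen_proj; rewrite /mu /L -n_lam; have [De <-] := e_eigen (n k.+1).
  exact: (A_E.2 _ De).
have x_le k s : s \in `[0, 1] -> mu k `^ (2 * (3 / 4)) * x k s ^+ 2 <= 8 / 2 ^+ k.
  rewrite in_itv/= => /andP[s0 s1]; have [_ _ /(_ s s0 s1) + _ _] := xP k.
  rewrite (_ : 2 * (3 / 4) = 3%:R / 2); last by field.
  rewrite powR_sqr_half ?(ltW (L0 k))//; apply: le_trans.
  rewrite -/(L k) mulrDr mulrA -exprS lerDl mulr_ge0 ?sqr_ge0//.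
  exact: ltW.
have dx_le k s : s \in `[0, 1] -> mu k `^ (2 * (1 / 4)) * dx k s ^+ 2 <= 8 / 2 ^+ k.
  rewrite in_itv/= => /andP[s0 s1]; have [_ _ /(_ s s0 s1) + _ _] := xP k.
  rewrite (_ : 2 * (1 / 4) = 1%:R / 2); last by field.
  rewrite powR_sqr_half ?(ltW (L0 k))// expr1; apply: le_trans.
  rewrite -/(L k) mulrDr lerDr mulr_ge0 ?(ltW (L0 k))//.
  by apply: mulr_ge0; exact: sqr_ge0.
have x_le14 k s : s \in `[0, 1] -> mu k `^ (2 * (1 / 4)) * x k s ^+ 2 <= 8 / 2 ^+ k.
  move=> sI; apply: le_trans (x_le k s sI).
  by rewrite ler_wpM2r ?sqr_ge0// ler_powR//; lra.
have q34 : 0 <= 3 / 4 :> R by lra.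
have q14 : 0 <= 1 / 4 :> R by lra.
have l2x s : s \in `[0, 1] -> l2 (x ^~ s).
  by move=> sI; apply: (@geometric_l2 _ _ mu_ge1 (2 * (3 / 4)) 8) => [|//|k];
    [lra|exact: x_le].
have l2dx s : s \in `[0, 1] -> l2 (dx ^~ s).
  by move=> sI; apply: (@geometric_l2 _ _ mu_ge1 (2 * (1 / 4)) 8) => [|//|k];
    [lra|exact: dx_le].
have xdx k s : has_deriv (x k) s (dx k s) by have [] := xP k.
have dxddx k s : has_deriv (dx k) s (- (mu k * coef t sig del s) * x k s).
  by have [] := xP k.
have cx k : continuous (x k) by move=> s; exact: derive_continuous (xdx k s).
have cdx k : continuous (dx k) by move=> s; exact: derive_continuous (dxddx k s).
have I0 : (0 : R) \in `[0, 1] by rewrite in_itv/= lexx ler01.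
exists (coef t sig del), (fun s => synth f (x ^~ s)), (fun s => synth f (dx ^~ s)).
split; first by move=> s _; exact: coef_ge0_le cd s.
split.
- exact: coef_omega_continuous cd.
- move=> r r0; have h k : (mu k `^ (3%:R / 2) * x k 0 ^+ 2 + mu k `^ (1%:R / 2) * dx k 0 ^+ 2) *
      expR (k%:R * phi (L k)) <= 8 / 2 ^+ k.
    have [_ _ _ + _] := xP k; rewrite !powR_sqr_half ?(ltW (L0 k))// expr1.
    by rewrite -/(L k) mulrDr mulrA -exprS.
  split.
    apply: (@gevrey_synth _ _ _ _ _ _ f_on L_ge1 f_eigen _ _ _ 8) => // k; apply: le_trans (h k).
    rewrite (_ : 2 * (3 / 4) = 3%:R / 2); last by field.
    rewrite ler_wpM2r ?expR_ge0// lerDl; apply: mulr_ge0; rewrite ?powR_ge0 ?sqr_ge0//.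
  apply: (@gevrey_synth _ _ _ _ _ _ f_on L_ge1 f_eigen _ _ _ 8) => // k; apply: le_trans (h k).
  rewrite (_ : 2 * (1 / 4) = 1%:R / 2); last by field.
  rewrite ler_wpM2r ?expR_ge0// lerDr; apply: mulr_ge0; rewrite ?powR_ge0 ?sqr_ge0//.
- split; first split.
  + exact: (@C0_pow_series _ _ _ _ _ _ f_on mu_ge1 f_eigen _ 8).
  + exact: (@C0_pow_series _ _ _ _ _ _ f_on mu_ge1 f_eigen _ 8).
  + exact: (@derive_pow_series _ _ _ _ _ _ f_on mu_ge1 f_eigen _ 8).
  + exact: (@C0_pow_series _ _ _ _ _ _ f_on mu_ge1 f_eigen _ 8).
  + apply: (@weak_solution_series _ _ _ _ _ _ f_on mu_ge1 f_eigen 8) => //.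
    * by move=> s; exact: coef_ge0_le cd s.
    * exact: coef_continuous cd.
    * by move=> k s sI; rewrite -(_ : 2 * (3 / 4) = 3 / 2); [exact: x_le|field].
    * by move=> k s sI; rewrite -(_ : 2 * (1 / 4) = 1 / 2); [exact: dx_le|field].
- move=> s; rewrite in_itv/= => /andP[s0 s1] b b1.
  have sI : s \in `[0, 1] by rewrite in_itv/= s1 ltW.
  (* All modes from [K] on have finished their resonance before time [s]. *)
  have [K _ hK] : \forall k \near \oo, t k <= s / 2.
    by apply: (cvgr_le _ (cvg_t cd)); rewrite divr_gt0.
  apply: (@phase_space_synth _ _ _ _ _ _ f_on L_ge1 f_eigen b _ _ K b1 (l2x _ sI) (l2dx _ sI)).
  move=> k Kk; have [_ _ _ _ [+ _]] := xP k; apply => //.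
  by have := hK k.+1 (leqW Kk); rewrite /=; lra.
have tau_bounds k : 0 < 2 * t k.+1 - pi / (2 * sig k.+1) <= 2 * t k.+1.
  have s0 := cd_sig_gt0 cd k; have t0 := cd_t_gt0 cd k.+1.
  have := phase_ge_pi s0 t0 (cd_sin cd k); have := divr_gt0 (pi_gt0 R) s0.
  rewrite invfM mulrCA; set z := pi / sig k.+1; lra.
exists (fun k => 2 * t k.+1 - pi / (2 * sig k.+1)).
have tau_I k : 2 * t k.+1 - pi / (2 * sig k.+1) \in `]0, 1].
  rewrite in_itv/=; have /andP[-> h] := tau_bounds k; apply: (le_trans h).
  by have := cd_t_step cd k; have := t_le1 cd k; have := cd_t_gt0 cd k.+1; lra.
split=> //.
- apply: (@squeeze_cvgr _ _ _ _ (fun=> 0) (fun k => 2 * t k.+1)).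
  + by apply: nearW => k; have /andP[/ltW -> ->] := tau_bounds k.
  + exact: cvg_cst.
  + rewrite -[X in _ --> X](mulr0 2); apply: cvgMr.
    by have := cvg_t cd; rewrite -(cvg_shiftS t).
- move=> b b12 M.
  apply: (pow_norm_synth_unbounded f_on L_ge1 f_eigen M
    (a := fun k => x ^~ (2 * t k.+1 - pi / (2 * sig k.+1)))
    (Y := fun k => 4 ^+ k * expR (2 * phase_sum t sig k)) b12).
  + move=> k; apply: l2x; have := tau_I k.
    by rewrite !in_itv/= => /andP[/ltW -> ->].
  + move=> k; rewrite mulr_ege1 ?exprn_ege1 ?ler1n//.
    by rewrite -expR0 ler_expR mulr_ge0// (phase_sum_ge0 cd).
  + by move=> k; have [] := par k.
  + by move=> k; have [_ _ _ _ []] := xP k.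
Qed.
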